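(* Let $\mathcal{E}$ be a regular Dirichlet form on $L^2(X,m)$ with associated selfadjoint operator $\mathcal{L}$, and assume that $\mathcal{L}$ is spatially locally compact. Let $B\subset X$ be a closed set of finite capacity and put $G:=X\setminus B$. Then the operator $\varphi(\mathcal{L}_G)-\varphi(\mathcal{L})$ on $L^2(X,m)$ is compact for every $\varphi\in C_0(\mathbb{R})$. In particular, $$\sigma_{ess}(\mathcal{L}_G)=\sigma_{ess}(\mathcal{L}).$$
   Context: Throughout, $X$ is a locally compact separable metric space and $m$ is a positive Radon measure on $X$ with $\operatorname{supp} m=X$; functions are real valued. $C_c(X)$ is the space of continuous functions with compact support; $C_0(\mathbb{R})$ is the closure of $C_c(\mathbb{R})$ in the supremum norm. A regular Dirichlet form $\mathcal{E}$ on $L^2(X,m)$ with domain $\mathcal{D}$ is a densely defined closed non-negative symmetric form such that $C\circ u\in\mathcal{D}$ and $\mathcal{E}(C\circ u,C\circ u)\le\mathcal{E}(u,u)$ for all $u\in\mathcal{D}$ and all normal contractions $C:\mathbb{R}\to\mathbb{R}$ (i.e. $C(0)=0$, $|C(\xi)-C(\zeta)|\le|\xi-\zeta|$), and such that $\mathcal{D}\cap C_c(X)$ is dense in $\mathcal{D}$ with respect to the energy norm $\|u\|_{\mathcal{E}}=(\mathcal{E}(u,u)+\|u\|^2_{L^2(X,m)})^{1/2}$ and dense in $C_c(X)$ with respect to the supremum norm. The associated selfadjoint operator $\mathcal{L}\ge 0$ is the one with $\langle\mathcal{L}u,v\rangle=\mathcal{E}(u,v)$ for $u$ in the domain of $\mathcal{L}$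 and $v\in\mathcal{D}$. $\mathcal{L}$ is called spatially locally compact if $\mathbf{1}_E e^{-\mathcal{L}}$ is a compact operator on $L^2(X,m)$ for every measurable $E\subset X$ with $m(E)<\infty$ (where $\mathbf{1}_E$ denotes multiplication by the characteristic function of $E$). Capacity: for $U\subset X$ open, $\operatorname{cap}(U)=\inf\{(\mathcal{E}(v,v)+\|v\|^2_{L^2(X,m)})^{1/2}: v\in\mathcal{D},\ \mathbf{1}_U\le v\}$ with $\inf\emptyset=\infty$; for arbitrary $A\subset X$, $\operatorname{cap}(A)=\inf\{\operatorname{cap}(U): A\subset U,\ U\text{ open}\}$. For $U\subset X$ open, $\mathcal{E}_U$ is the restriction of $\mathcal{E}$ to the closure of $\mathcal{D}\cap C_c(U)$ with respect to $\|\cdot\|_{\mathcal{E}}$; it is a regular Dirichlet form on $L^2(U,m)$, and $\mathcal{L}_U$ is its associated selfadjoint operator on $L^2(U,m)$. For $\varphi\in C_0(\mathbb{R})$ the operator $\varphi(\mathcal{L}_U)$ is regarded as an operator on $L^2(X,m)$ by extending it by $0$ on $L^2(X\setminus U,m)$. The essential spectrum $\sigma_{ess}(\mathcal{L}_G)$ is that of $\mathcal{L}_G$ as an operator in $L^2(G,m)$; $\sigma_{ess}$ is the complement in the spectrum of the isolated eigenvalues of finite multiplicity. *)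

(* Defs.v *)
From HB Require Import structures.
From mathcomp Require Import all_boot all_order all_algebra.
From mathcomp Require Import all_classical all_reals all_analysis.
From mathcomp Require Import measurable_realfun ess_sup_inf.

Set Implicit Arguments.
Unset Strict Implicit.
Unset Printing Implicit Defensive.
Import Order.TTheory GRing.Theory Num.Theory.
Import numFieldNormedType.Exports.
Local Open Scope classical_set_scope.
Local Open Scope ring_scope.
Local Open Scope quotient_scope.

Section Lspace_normed.
Context d (T : measurableType d) (R : realType).
Variables (mu : {measure set T -> \bar R}) (p : \bar R) (p1 : (1 <= p)%E).
Local Notation L := (LspaceType mu p1).
Local Notation Lf := (LfunType mu p1).
Local Notation M := {mfun T >-> measurableTypeR R}.

HB.instance Definition _ := gen_eqMixin L.
HB.instance Definition _ := gen_choiceMixin L.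

Lemma eq_Lnorm_ae (f g : T -> R) :
  measurable_fun setT f -> measurable_fun setT g -> f = g %[ae mu] ->
  ('N[mu]_p[EFin \o f] = 'N[mu]_p[EFin \o g])%E.
Proof.
move=> mf mg fg; case: p p1 => [r r1||//].
- rewrite unlock /Lnorm; congr (_ `^ _)%E.
  have mpow (h : T -> R) : measurable_fun setT h ->
      measurable_fun setT (fun x => `|(h x)%:E| `^ r)%E.
    move=> mh.
    apply: (@measurableT_comp _ _ _ _ _ _ (fun x : \bar R => x `^ r)%E).
      exact: measurable_poweR.
    by apply: measurableT_comp => //; exact/measurable_EFinP.
  apply: ge0_ae_eq_integral => //; try exact: mpow.
  - by move=> x _; exact: poweR_ge0.
  - by move=> x _; exact: poweR_ge0.
  - by apply: filterS fg => x /= /(_ I) ->.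
- rewrite unlock /Lnorm; case: ifP => // _ _; apply: eq_ess_sup.
  by apply: filterS fg => x /= /(_ I) ->.
Qed.

Lemma Lspace_mfunE (g : M) :
  ((\pi_({mfun_ mu, T >-> measurableTypeR R}) g
     : {mfun_ mu, T >-> measurableTypeR R}) : T -> R) = g %[ae mu].
Proof.
rewrite /aqEqMfun_to_fun; case: piP => h /eqP.
by rewrite eqmodE => /asboolP/ae_eq_sym.
Qed.

Section class.
Variable f : Lf.
Let fm : @measurable_fun _ _ T (measurableTypeR R) setT f.
Proof. exact: (@measurable_funPT _ _ _ _ f). Qed.
Let fM : M := HB.pack (f : T -> R) (@isMeasurableFun.Build _ _ T (measurableTypeR R) f fm).
Let c : {mfun_ mu, T >-> measurableTypeR R} := \pi fM.
Let c_fin : finite_norm mu p c.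
Proof.
rewrite /finite_norm.
have mc : measurable_fun setT (c : T -> R) by exact: (@measurable_funPT _ _ _ _ (repr c)).
have -> := eq_Lnorm_ae mc fm (Lspace_mfunE fM).
exact: (Lfunction_finite p1 f).
Qed.
Definition Lspace_class : L := HB.pack c (@isFinLebesgue.Build d T R mu p p1 c c_fin).
Lemma Lspace_classE : (Lspace_class : T -> R) = f %[ae mu].
Proof. exact: Lspace_mfunE. Qed.
End class.

Section repr.
Variable u : L.
Let um : measurable_fun setT (u : T -> R).
Proof. exact: (@measurable_funPT _ _ _ _ (repr (u : {mfun_ mu, T >-> measurableTypeR R}))). Qed.
#[local] HB.instance Definition _ :=
  @isMeasurableFun.Build _ _ T R (u : T -> R) um.
#[local] HB.instance Definition _ :=
  @isLfunction.Build d T R mu p p1 (u : T -> R) (@Lebesgue_finite _ _ _ _ _ p1 u).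
Definition Lspace_repr : Lf := (u : T -> R).
End repr.

Lemma Lspace_eqP (u v : L) : (u : T -> R) = v %[ae mu] -> u = v.
Proof.
move=> uv.
have e : (u : {mfun_ mu, T >-> measurableTypeR R}) = v.
  by rewrite -[LHS]reprK -[RHS]reprK; apply/eqP; rewrite eqmodE; apply/asboolP.
case: u v {uv} e => [u [[cu]]] [v [[cv]]] /= e; subst v.
by rewrite (Prop_irrelevance cu cv).
Qed.

Definition Lspace_zero : L := Lspace_class 0.
Definition Lspace_add (u v : L) : L := Lspace_class (Lspace_repr u + Lspace_repr v).
Definition Lspace_opp (u : L) : L := Lspace_class (- Lspace_repr u).
Definition Lspace_scale (a : R) (u : L) : L := Lspace_class (a *: Lspace_repr u).

Lemma Lspace_zeroE : (Lspace_zero : T -> R) = (fun=> 0) %[ae mu].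
Proof. exact: Lspace_classE. Qed.

Lemma Lspace_addE u v :
  (Lspace_add u v : T -> R) = (fun x => u x + v x) %[ae mu].
Proof. exact: Lspace_classE. Qed.

Lemma Lspace_oppE u : (Lspace_opp u : T -> R) = (fun x => - u x) %[ae mu].
Proof. exact: Lspace_classE. Qed.

Lemma Lspace_scaleE a u :
  (Lspace_scale a u : T -> R) = (fun x => a * u x) %[ae mu].
Proof. exact: Lspace_classE. Qed.

Fact Lspace_addA : associative Lspace_add.
Proof.
move=> u v w; apply: Lspace_eqP.
have h1 := Lspace_addE u (Lspace_add v w).
have h2 := Lspace_addE v w.
have h3 := Lspace_addE (Lspace_add u v) w.
have h4 := Lspace_addE u v.
near=> x; move=> _.
by rewrite (near h1 x _)// (near h2 x _)// (near h3 x _)// (near h4 x _)// addrA.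
Unshelve. all: by end_near. Qed.

Fact Lspace_addC : commutative Lspace_add.
Proof.
move=> u v; apply: Lspace_eqP.
have h1 := Lspace_addE u v.
have h2 := Lspace_addE v u.
near=> x; move=> _.
by rewrite (near h1 x _)// (near h2 x _)// addrC.
Unshelve. all: by end_near. Qed.

Fact Lspace_add0 : left_id Lspace_zero Lspace_add.
Proof.
move=> u; apply: Lspace_eqP.
have h1 := Lspace_addE Lspace_zero u.
have h2 := Lspace_zeroE.
near=> x; move=> _.
by rewrite (near h1 x _)// (near h2 x _)// add0r.
Unshelve. all: by end_near. Qed.

Fact Lspace_addN : left_inverse Lspace_zero Lspace_opp Lspace_add.
Proof.
move=> u; apply: Lspace_eqP.
have h1 := Lspace_addE (Lspace_opp u) u.
have h2 := Lspace_zeroE.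
have h3 := Lspace_oppE u.
near=> x; move=> _.
by rewrite (near h1 x _)// (near h2 x _)// (near h3 x _)// addNr.
Unshelve. all: by end_near. Qed.

HB.instance Definition _ := GRing.isZmodule.Build L
  Lspace_addA Lspace_addC Lspace_add0 Lspace_addN.

Fact Lspace_scaleA a b u :
  Lspace_scale a (Lspace_scale b u) = Lspace_scale (a * b) u.
Proof.
apply: Lspace_eqP.
have h1 := Lspace_scaleE a (Lspace_scale b u).
have h2 := Lspace_scaleE b u.
have h3 := Lspace_scaleE (a * b) u.
near=> x; move=> _.
by rewrite (near h1 x _)// (near h2 x _)// (near h3 x _)// mulrA.
Unshelve. all: by end_near. Qed.

Fact Lspace_scale1 : left_id 1 Lspace_scale.
Proof.
move=> u; apply: Lspace_eqP.
have h1 := Lspace_scaleE 1 u.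
near=> x; move=> _.
by rewrite (near h1 x _)// mul1r.
Unshelve. all: by end_near. Qed.

Fact Lspace_scaleDr : right_distributive Lspace_scale +%R.
Proof.
move=> a u v; apply: Lspace_eqP.
have h1 := Lspace_scaleE a (u + v).
have h2 := Lspace_addE u v.
have h3 := Lspace_addE (Lspace_scale a u) (Lspace_scale a v).
have h4 := Lspace_scaleE a u.
have h5 := Lspace_scaleE a v.
near=> x; move=> _.
by rewrite (near h1 x _)// (near h2 x _)// (near h3 x _)// (near h4 x _)// (near h5 x _)// mulrDr.
Unshelve. all: by end_near. Qed.

Fact Lspace_scaleDl u : {morph Lspace_scale^~ u : a b / a + b}.
Proof.
move=> a b; apply: Lspace_eqP.
have h1 := Lspace_scaleE (a + b) u.
have h3 := Lspace_addE (Lspace_scale a u) (Lspace_scale b u).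
have h4 := Lspace_scaleE a u.
have h5 := Lspace_scaleE b u.
near=> x; move=> _.
by rewrite (near h1 x _)// (near h3 x _)// (near h4 x _)// (near h5 x _)// mulrDl.
Unshelve. all: by end_near. Qed.

HB.instance Definition _ := GRing.Zmodule_isLmodule.Build R L
  Lspace_scaleA Lspace_scale1 Lspace_scaleDr Lspace_scaleDl.

Definition Lspace_norm (u : L) : R := fine ('N[mu]_p[EFin \o (u : T -> R)])%E.


Lemma Lspace_measurable (u : L) : measurable_fun setT (u : T -> R).
Proof. exact: (@measurable_funPT _ _ _ _ (Lspace_repr u)). Qed.

Lemma Lspace_norm_class (f : Lf) :
  Lspace_norm (Lspace_class f) = fine ('N[mu]_p[EFin \o (f : T -> R)])%E.
Proof.
congr fine; apply: eq_Lnorm_ae; [exact: Lspace_measurable| |exact: Lspace_classE].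
exact: (@measurable_funPT _ _ _ _ f).
Qed.

Fact Lspace_normD u v : Lspace_norm (u + v) <= Lspace_norm u + Lspace_norm v.
Proof. by rewrite [leLHS]Lspace_norm_class; exact: ler_LnormD. Qed.

Fact Lspace_normZ a u : Lspace_norm (a *: u) = `|a| * Lspace_norm u.
Proof.
rewrite [LHS]Lspace_norm_class; apply: EFin_inj.
by rewrite EFinM (finite_norm_fine (Lspace_repr u)) finite_norm_fine; exact: LnormZ.
Qed.

Fact Lspace_norm0_eq0 u : Lspace_norm u = 0 -> u = 0.
Proof.
move=> /(@fine_Lnormr_eq0 _ _ _ _ _ p1 (Lspace_repr u)) u0; apply: Lspace_eqP.
have h := Lspace_zeroE.
near=> x; move=> _.
by rewrite (near h x _)//; exact: (near u0 x _).
Unshelve. all: by end_near. Qed.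

HB.instance Definition _ := Lmodule_isNormed.Build R L
  Lspace_normD Lspace_normZ Lspace_norm0_eq0.

End Lspace_normed.

Section continuous_functions.
Context (R : realType).

Definition supp (T : topologicalType) (f : T -> R) : set T :=
  closure [set x | f x != 0].

(* Elements of C_c(U) are extended by 0 to the whole space. *)
Definition Cc (T : topologicalType) (U : set T) : set (T -> R) :=
  [set f | [/\ continuous f, compact (supp f) & supp f `<=` U]].

Definition C0 : set (R -> R) :=
  [set f | forall e, 0 < e ->
     exists2 g, Cc [set: R] g & forall t, `|f t - g t| <= e].

Definition normal_contraction (C : R -> R) : Prop :=
  C 0 = 0 /\ forall s t, `|C s - C t| <= `|s - t|.

End continuous_functions.

Section operators.
Context (R : realType) (H : normedModType R).

Definition compact_operator (T : H -> H) : Prop :=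
  linear T /\ precompact (T @` [set u | `|u| <= 1]).

(* An unbounded operator in a closed subspace V of H is given by its graph
   A `<=` V `*` V. Only real spectral parameters occur: the operators of
   interest are selfadjoint, so that the spectrum of their complexification
   is real and eigenspaces have the same dimension over the reals as after
   complexification. *)

Definition resolvent_set (V : set H) (A : set (H * H)) : set R :=
  [set w | (forall g, V g -> exists2 uv, A uv & uv.2 - w *: uv.1 = g) /\
           exists c, forall uv, A uv -> `|uv.1| <= c * `|uv.2 - w *: uv.1| ].

Definition spectrum V A : set R := ~` resolvent_set V A.

Definition eigenspace (A : set (H * H)) (w : R) : set H :=
  [set u | A (u, w *: u)].

Definition finite_dim (K : set H) : Prop :=
  exists n (b : 'I_n -> H),
    forall u, K u -> exists c : 'I_n -> R, u = \sum_(i < n) c i *: b i.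

Definition discrete_spectrum V A : set R :=
  [set w | [/\ exists2 u, eigenspace A w u & u != 0,
               finite_dim (eigenspace A w) &
               exists2 e, 0 < e & forall t, spectrum V A t ->
                 `|t - w| < e -> t = w]].

Definition ess_spectrum V A : set R := spectrum V A `\` discrete_spectrum V A.

Variable ip : H -> H -> R.

(* The functional calculus phi |-> phi(A), phi in C_0(R), of a selfadjoint
   operator A in V: the unique contractive algebra homomorphism into the
   bounded symmetric operators on V that sends 1 / (t - z) to (A - z)^-1 for
   every nonreal z. Writing z = a + ib and 1 / (t - z) = r(t) + i q(t) with r
   and q real, the last condition is (A - z)(r(A) + i q(A)) = 1, that is
   (A - a) r(A) + b q(A) = 1 and (A - a) q(A) - b r(A) = 0. The operators
   phi(A) are extended by 0 on the orthogonal complement of V. *)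
Record C0_calculus (V : set H) (A : set (H * H)) (Phi : (R -> R) -> H -> H)
    : Prop := {
  calc_linear : forall f, C0 f -> linear (Phi f) ;
  calc_contr : forall f c, C0 f -> (forall t, `|f t| <= c) ->
    forall u, `|Phi f u| <= c * `|u| ;
  calc_sym : forall f u v, C0 f -> ip (Phi f u) v = ip u (Phi f v) ;
  calc_range : forall f u, C0 f -> V (Phi f u) ;
  calc_orth : forall f u, C0 f -> (forall v, V v -> ip u v = 0) ->
    Phi f u = 0 ;
  calc_lin : forall a f g u, C0 f -> C0 g ->
    Phi (fun t => a * f t + g t) u = a *: Phi f u + Phi g u ;
  calc_mul : forall f g u, C0 f -> C0 g ->
    Phi (fun t => f t * g t) u = Phi f (Phi g u) ;
  calc_resolvent : forall a b g, b != 0 -> V g ->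
    let r := Phi (fun t => (t - a) / ((t - a) ^+ 2 + b ^+ 2)) g in
    let q := Phi (fun t => b / ((t - a) ^+ 2 + b ^+ 2)) g in
    A (r, g + a *: r - b *: q) /\ A (q, b *: r + a *: q)
}.

Definition fun_calc V A (phi : R -> R) : H -> H :=
  xget (fun _ _ => 0) (C0_calculus V A) phi.

End operators.

Section forms.
Context (R : realType) (H : normedModType R).

Record energy_form := EnergyForm { fdom : set H ; fval : H -> H -> R }.

Implicit Type E : energy_form.

Definition energy_norm E (u : H) : R := Num.sqrt (fval E u u + `|u| ^+ 2).

Record closed_form E : Prop := {
  fdom0 : fdom E 0 ;
  fdom_lin : forall a u v, fdom E u -> fdom E v -> fdom E (a *: u + v) ;
  fdom_dense : dense (fdom E) ;
  fval_lin : forall a u v w, fdom E u -> fdom E v -> fdom E w ->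
    fval E (a *: u + v) w = a * fval E u w + fval E v w ;
  fval_sym : forall u v, fdom E u -> fdom E v -> fval E u v = fval E v u ;
  fval_ge0 : forall u, fdom E u -> 0 <= fval E u u ;
  fval_closed : forall u_ : nat -> H, (forall n, fdom E (u_ n)) ->
    (forall e, 0 < e -> exists N, forall i j, (N <= i)%N -> (N <= j)%N ->
       energy_norm E (u_ i - u_ j) < e) ->
    exists2 u, fdom E u & energy_norm E (u_ n - u) @[n --> \oo] --> (0 : R)
}.

(* The operator L in V with <L u, v> = E(u, v) for all v in the domain of E. *)
Definition form_operator (ip : H -> H -> R) (V : set H) E : set (H * H) :=
  [set uv | [/\ fdom E uv.1, V uv.2 &
     forall v, fdom E v -> ip uv.2 v = fval E uv.1 v]].

End forms.

(* Pointed because measurable types are. *)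
HB.structure Definition PointedMetric (K : numDomainType) :=
  { T of Metric K T & Pointed T }.
Notation pmetricType := PointedMetric.type.

Notation borel X := (g_sigma_algebraType (@open X)).
Notation L2 m := (LspaceType m (lee1n 2)).

Definition separable (X : topologicalType) : Prop :=
  exists2 S : set X, countable S & dense S.

Section dirichlet_forms.
Context (R : realType) (X : pmetricType R).
Variable m : {measure set (borel X) -> \bar R}.

Definition radon_measure : Prop :=
  (forall K : set X, compact K -> (m K < +oo)%E) /\
  (forall A : set (borel X), measurable A ->
     m A = ereal_sup [set m K | K in [set K : set X | compact K /\ K `<=` A]]).

Definition msupp : set X :=
  [set x | forall U : set X, open U -> U x -> (0 < m U)%E].

Definition L2ip (u v : L2 m) : R := \int[m]_x (u x * v x).

Definition L2on (U : set X) : set (L2 m) :=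
  [set u | \forall x \ae m, ~ U x -> u x = 0].

Definition mul_indic (F : set X) (u : L2 m) : L2 m :=
  xget 0 [set v : L2 m | v = (fun x => \1_F x * u x) %[ae m]].

Implicit Type E : energy_form (L2 m).

Definition dom_Cc E (U : set X) : set (L2 m) :=
  [set u | fdom E u /\ exists2 f : X -> R, Cc U f & u = f %[ae m]].

Record regular_dirichlet_form E : Prop := {
  rdf_closed : closed_form E ;
  rdf_markov : forall C u, normal_contraction C -> fdom E u ->
    exists v : L2 m, [/\ fdom E v, v = (fun x => C (u x)) %[ae m] &
      fval E v v <= fval E u u] ;
  rdf_core : forall u e, fdom E u -> 0 < e ->
    exists2 v, dom_Cc E [set: X] v & energy_norm E (u - v) < e ;
  rdf_sup_dense : forall (f : X -> R) e, Cc [set: X] f -> 0 < e ->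
    exists g : X -> R, [/\ Cc [set: X] g,
      exists2 v : L2 m, fdom E v & v = g %[ae m] &
      forall x, `|f x - g x| <= e]
}.

Definition cap_open E (U : set X) : \bar R :=
  ereal_inf [set (energy_norm E v)%:E | v in
    [set v : L2 m | fdom E v /\ \forall x \ae m, \1_U x <= v x]].

Definition cap E (A : set X) : \bar R :=
  ereal_inf [set cap_open E U | U in [set U | open U /\ A `<=` U]].

Definition form_on E (U : set X) : energy_form (L2 m) :=
  EnergyForm [set u | fdom E u /\ forall e, 0 < e ->
          exists2 v, dom_Cc E U v & energy_norm E (u - v) < e]
       (fval E).

(* L^2(U, m) is identified with the subspace L2on U of L^2(X, m). *)
Definition assoc_op E : set (L2 m * L2 m) := form_operator L2ip setT E.
Definition assoc_op_on E (U : set X) : set (L2 m * L2 m) :=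
  form_operator L2ip (L2on U) (form_on E U).

Definition phi_op E (phi : R -> R) : L2 m -> L2 m :=
  fun_calc L2ip setT (assoc_op E) phi.
Definition phi_op_on E (U : set X) (phi : R -> R) : L2 m -> L2 m :=
  fun_calc L2ip (L2on U) (assoc_op_on E U) phi.

(* e^-L is phi(L) for any phi in C_0(R) equal to e^-t on the half-line
   t >= 0, which contains the spectrum of L. *)
Definition heat_op E : L2 m -> L2 m := phi_op E (fun t => expR (- `|t|)).

Definition spatially_locally_compact E : Prop :=
  forall F : set (borel X), measurable F -> (m F < +oo)%E ->
    compact_operator (fun u => mul_indic F (heat_op E u)).

End dirichlet_forms.

Arguments L2on {R X} m U.

(* Main.v *)
(** Let T = (L + 1)^-1, let T_G be (L_G + 1)^-1 extended by 0, and let P be the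
    projection onto D(E_G) for the inner product E(u, v) + <u, v>, so that
    T_G = P T.  If eta in D(E) satisfies 0 <= eta <= 1 and eta = 1 near B, then
    for 0 <= h <= 1 positivity of 1 - P gives 0 <= (T - T_G) h <= e with
    e = (1 - P) eta in L^2.  By a Schur test T - T_G is therefore small in
    norm after multiplication by 1_{e <= d}, while {e > d} has finite measure,
    where the spatial local compactness of L applies: T - T_G is compact.
    The functions phi with phi(L_G) - phi(L) compact form a closed subspace
    containing the real and imaginary parts of 1 / (t - i), by the second
    resolvent identity, and stable under products; a Bernstein approximation
    shows that they exhaust C_0(R).  Finally w lies outside the essential
    spectrum of L iff phi(L) is compact for some phi in C_0(R) with
    phi(w) <> 0, a condition insensitive to compact perturbations.

    The functional calculus itself is the limit of Bernstein polynomials in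
    the bounded operator T. *)

Require Import Defs.
From HB Require Import structures.
From mathcomp Require Import all_boot all_order all_algebra.
From mathcomp Require finmap.
From mathcomp Require Import all_classical all_reals all_analysis.
From mathcomp Require Import measurable_realfun.
From mathcomp Require Import ring lra zify.
Import Order.TTheory GRing.Theory Num.Theory.
Import numFieldNormedType.Exports.
Local Open Scope classical_set_scope.
Local Open Scope ring_scope.

Set Implicit Arguments.
Unset Strict Implicit.
Unset Printing Implicit Defensive.

(** * Bernstein functional calculus *)

(** The scalars are real, so [1 / (t - i)] always occurs as the pair [re], [im] of its real and
    imaginary parts; [im], which is [1 / (t^2 + 1)], generates the even functions and [re] supplies
    the odd ones. Operator bounds are drawn from quadratic forms instead of a spectral measure: a
    continuous g satisfies [|g s - g t| <= e + C (s - t)^2] on [0, 1], and the right-hand side can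
    be summed against Bernstein polynomials because their first two moments are explicit. The
    difference [K = T - T_G] is handled without an integral kernel: the Schur test rests on a
    pointwise Cauchy-Schwarz inequality for positive operators. Local compactness is inherited from
    T through the form inequalities [0 <= K <= T] and [K^2 <= K]. Truncations of functions in the
    form domain are controlled only through bounds on their form norm. Membership in D(E_G) is
    therefore proved by L^2 approximation with bounded form norm, and a minimization argument
    upgrades this to convergence in the form norm. *)

Record inner_product (R : realType) (H : normedModType R) (ip : H -> H -> R)
    : Prop := InnerProduct {
  ipDl : forall u v w, ip (u + v) w = ip u w + ip v w ;
  ipZl : forall a u w, ip (a *: u) w = a * ip u w ;
  ipC : forall u v, ip u v = ip v u ;
  ipE : forall u, ip u u = `|u| ^+ 2 }.

Definition cauchy_complete (R : realType) (H : normedModType R) : Prop :=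
  forall u_ : nat -> H,
    (forall e : R, 0 < e -> exists N, forall i j, (N <= i)%N -> (N <= j)%N ->
       `|u_ i - u_ j| <= e) ->
  exists u, forall e : R, 0 < e -> exists N, forall n, (N <= n)%N ->
    `|u_ n - u| <= e.

Section linear_facts.
Context (R : pzRingType) (U V : lmodType R) (S : U -> V) (lS : linear S).

Lemma linD u v : S (u + v) = S u + S v.
Proof. by rewrite -[u]scale1r lS !scale1r. Qed.

Lemma lin0 : S 0 = 0.
Proof. by apply: (addrI (S 0)); rewrite -linD !addr0. Qed.

Lemma linZ a u : S (a *: u) = a *: S u.
Proof. by rewrite -[a *: u]addr0 lS lin0 addr0. Qed.

Lemma linN u : S (- u) = - S u.
Proof. by rewrite -scaleN1r linZ scaleN1r. Qed.

Lemma linB u v : S (u - v) = S u - S v.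
Proof. by rewrite linD linN. Qed.

Lemma lin_sum I (s : seq I) (P : pred I) (F : I -> U) :
  S (\sum_(i <- s | P i) F i) = \sum_(i <- s | P i) S (F i).
Proof. by apply: (big_morph S linD lin0). Qed.

End linear_facts.

Lemma eps_le (R : realType) (x y : R) :
  (forall e, 0 < e -> x <= y + e) -> x <= y.
Proof. by move=> h; apply/ler_addgt0Pr => e /h. Qed.

Lemma eps_eq0 (R : realType) (H : normedModType R) (x : H) :
  (forall e : R, 0 < e -> `|x| <= e) -> x = 0.
Proof.
move=> h; apply/normr0_eq0/eqP; rewrite eq_le normr_ge0 andbT.
by apply: eps_le => e e0; rewrite add0r h.
Qed.

Lemma small_mul (R : realType) (e c : R) : 0 < e -> 0 <= c ->
  exists2 d : R, 0 < d & c * d <= e.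
Proof.
move=> e0 c0; exists (e / (c + 1)); first by rewrite divr_gt0// ltr_wpDl.
by rewrite mulrA ler_pdivrMr ?ltr_wpDl// mulrC ler_wpM2l ?lerDl ?ltW.
Qed.

Lemma exists_inv_lt (R : realType) (e : R) : 0 < e ->
  exists N, forall n, (N <= n)%N -> n.+1%:R^-1 <= e.
Proof.
move=> e0; exists (Num.truncn e^-1) => n hn.
have h := truncnS_gt e^-1.
rewrite invf_ple ?posrE// ?ltr0n//.
by rewrite (le_trans (ltW h))// ler_nat.
Qed.

Definition seqlim (R : realType) (H : normedModType R) (x : nat -> H) (l : H) :=
  forall e : R, 0 < e -> exists N, forall n, (N <= n)%N -> `|x n - l| <= e.

Section seqlim.
Context (R : realType) (H : normedModType R).
Implicit Types (x y : nat -> H) (l : H).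

Lemma seqlim_cst l : seqlim (fun=> l) l.
Proof. by move=> e e0; exists 0%N => n _; rewrite subrr normr0 ltW. Qed.

Lemma seqlim_uniq x l l' : seqlim x l -> seqlim x l' -> l = l'.
Proof.
move=> h h'; apply/eqP; rewrite -subr_eq0; apply/eqP/eps_eq0 => e e0.
have e20 : 0 < e / 2 by rewrite divr_gt0.
have [N hN] := h _ e20; have [M hM] := h' _ e20.
rewrite -(subrKA (x (maxn N M))) (splitr e) (le_trans (ler_normD _ _))// lerD//.
  by rewrite distrC hN ?leq_maxl.
by rewrite hM ?leq_maxr.
Qed.

Lemma seqlimD x y l l' : seqlim x l -> seqlim y l' -> seqlim (x \+ y) (l + l').
Proof.
move=> h h' e e0; have e20 : 0 < e / 2 by rewrite divr_gt0.
have [N hN] := h _ e20; have [M hM] := h' _ e20.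
exists (maxn N M) => n; rewrite geq_max => /andP[Nn Mn].
by rewrite /= opprD addrACA (splitr e) (le_trans (ler_normD _ _))// lerD ?hN ?hM.
Qed.

Lemma seqlim_bounded (S : H -> H) (c : R) x l : 0 <= c -> linear S ->
  (forall u, `|S u| <= c * `|u|) -> seqlim x l -> seqlim (S \o x) (S l).
Proof.
move=> c0 lS cS h e e0; have [d d0 hd] := small_mul e0 c0.
have [N hN] := h _ d0; exists N => n Nn /=; rewrite -(linB lS).
by rewrite (le_trans (cS _))// (le_trans _ hd)// ler_wpM2l// hN.
Qed.

Lemma seqlimZ a x l : seqlim x l -> seqlim (fun n => a *: x n) (a *: l).
Proof.
apply: (@seqlim_bounded ( *:%R a) `|a|) => //.
- by move=> b u v; rewrite scalerDr !scalerA mulrC.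
- by move=> u; rewrite normrZ.
Qed.

Lemma seqlim_le x l (c : R) : seqlim x l -> (forall n, `|x n| <= c) -> `|l| <= c.
Proof.
move=> h hc; apply: eps_le => e e0; have [N /(_ N (leqnn _)) hN] := h e e0.
by rewrite -[l](subKr (x N)) (le_trans (ler_normB _ _))// lerD.
Qed.

End seqlim.

Section inner_theory.
Context (R : realType) (H : normedModType R) (ip : H -> H -> R).
Hypothesis ipP : inner_product ip.

Lemma ipDr u v w : ip u (v + w) = ip u v + ip u w.
Proof. by rewrite (ipC ipP) (ipDl ipP) !(ipC ipP u). Qed.

Lemma ipZr a u v : ip u (a *: v) = a * ip u v.
Proof. by rewrite (ipC ipP) (ipZl ipP) (ipC ipP u). Qed.

Lemma ip0l v : ip 0 v = 0.
Proof. by rewrite -(scale0r 0) (ipZl ipP) mul0r. Qed.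

Lemma ip0r v : ip v 0 = 0.
Proof. by rewrite (ipC ipP) ip0l. Qed.

Lemma ipNl u v : ip (- u) v = - ip u v.
Proof. by rewrite -scaleN1r (ipZl ipP) mulN1r. Qed.

Lemma ipNr u v : ip u (- v) = - ip u v.
Proof. by rewrite (ipC ipP) ipNl (ipC ipP). Qed.

Lemma ipBl u v w : ip (u - v) w = ip u w - ip v w.
Proof. by rewrite (ipDl ipP) ipNl. Qed.

Lemma ipBr u v w : ip u (v - w) = ip u v - ip u w.
Proof. by rewrite ipDr ipNr. Qed.

Lemma ip_suml I (s : seq I) (P : pred I) (F : I -> H) v :
  ip (\sum_(i <- s | P i) F i) v = \sum_(i <- s | P i) ip (F i) v.
Proof. by apply: (big_morph (ip^~ v)); [move=> *; exact: ipDl|exact: ip0l]. Qed.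

Lemma ip_sumr I (s : seq I) (P : pred I) (F : I -> H) v :
  ip v (\sum_(i <- s | P i) F i) = \sum_(i <- s | P i) ip v (F i).
Proof. by apply: (big_morph (ip v)); [move=> *; exact: ipDr|exact: ip0r]. Qed.

Lemma ip_ge0 u : 0 <= ip u u.
Proof. by rewrite (ipE ipP) sqr_ge0. Qed.

Lemma ip_eq0 u : (forall v, ip u v = 0) -> u = 0.
Proof.
move=> /(_ u)/eqP; rewrite (ipE ipP) sqrf_eq0 => /eqP; exact: normr0_eq0.
Qed.

Lemma ip_inj u v : (forall w, ip u w = ip v w) -> u = v.
Proof.
by move=> h; apply/eqP; rewrite -subr_eq0; apply/eqP/ip_eq0 => w; rewrite ipBl h subrr.
Qed.

Lemma normD_sqr u v : `|u + v| ^+ 2 = `|u| ^+ 2 + 2 * ip u v + `|v| ^+ 2.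
Proof. rewrite -!(ipE ipP) (ipDl ipP) !ipDr (ipC ipP v u); ring. Qed.

Lemma normB_sqr u v : `|u - v| ^+ 2 = `|u| ^+ 2 - 2 * ip u v + `|v| ^+ 2.
Proof. by rewrite normD_sqr ipNr normrN mulrN. Qed.

Lemma cauchy_schwarz u v : `|ip u v| <= `|u| * `|v|.
Proof.
wlog: u v / 0 <= ip u v => [hw|uv].
  case: (lerP 0 (ip u v)) => [/hw//|uv0].
  have := hw (- u) v; rewrite ipNl !normrN; apply.
  by rewrite oppr_ge0 ltW.
rewrite ger0_norm//.
have [->|u0] := eqVneq u 0; first by rewrite ip0l mulr_ge0.
have [->|v0] := eqVneq v 0; first by rewrite ip0r mulr_ge0.
have nu : 0 < `|u| by rewrite normr_gt0.
have nv : 0 < `|v| by rewrite normr_gt0.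
have := sqr_ge0 `| (`|v| *: u - `|u| *: v) |.
rewrite normB_sqr !normrZ !normr_id (ipZl ipP) ipZr => h.
have : 0 <= (`|u| * `|v|) * (`|u| * `|v| - ip u v) by nra.
by rewrite pmulr_rge0 ?mulr_gt0// subr_ge0.
Qed.

(** Polarization and the parallelogram identity give [2 <S u, v> <= c (|u|^2 + |v|^2)]; it remains
    to choose v. This converts every later inequality between quadratic forms into a norm bound. *)
Lemma norm_le_quadratic (S : H -> H) (c : R) : linear S -> 0 <= c ->
  (forall u v, ip (S u) v = ip u (S v)) ->
  (forall u, `|ip (S u) u| <= c * `|u| ^+ 2) ->
  forall u, `|S u| <= c * `|u|.
Proof.
move=> lS c0 sS qS.
have SD := linD lS; have SZ := linZ lS.
have pol u v : 2 * ip (S u) v <= c * (`|u| ^+ 2 + `|v| ^+ 2).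
  have h1 := le_trans (ler_norm _) (qS (u + v)).
  have := qS (u - v); rewrite ler_norml => /andP[h3 _].
  move: h1 h3; rewrite SD (linB lS).
  rewrite !(ipDl ipP) !ipDr !ipNl !ipNr normD_sqr normB_sqr (sS v u) (ipC ipP v (S u)).
  move: (ip (S u) u) (ip (S u) v) (ip (S v) v) (ip u v) (`|u| ^+ 2) (`|v| ^+ 2) => *.
  lra.
move=> u.
have [->|Su0] := eqVneq (S u) 0; first by rewrite normr0 mulr_ge0.
have [u0|u0] := eqVneq u 0.
  by rewrite u0 -(scale0r 0) SZ scale0r normr0 mulr_ge0.
have nu : 0 < `|u| by rewrite normr_gt0.
have nSu : 0 < `|S u| by rewrite normr_gt0.
(* The test vector has the direction of [S u] and the length of [u], which balances the two
   squares. *)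
have := pol u ((`|u| / `|S u|) *: S u).
rewrite ipZr (ipE ipP) normrZ normrM normfV !normr_id divfK ?gt_eqF// => h.
have e : 2 * (`|u| / `|S u| * `|S u| ^+ 2) = 2 * `|u| * `|S u| by field; rewrite gt_eqF.
have : 0 <= 2 * `|u| * (c * `|u| - `|S u|) by rewrite e in h; nra.
by rewrite pmulr_rge0 ?mulr_gt0// subr_ge0.
Qed.

End inner_theory.

Ltac ip_ring ipP :=
  apply: (ip_inj ipP) => ?;
  rewrite ?(ipDl ipP, ipNl ipP, ipZl ipP, ip0l ipP); ring.

(** * Bernstein polynomials and their moments *)

Section bernstein.
Context (R : realType).
Local Open Scope ring_scope.

Definition bernstein n k : {poly R} := 'C(n, k)%:R *: ('X ^+ k * (1 - 'X) ^+ (n - k)).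

(** The identity [k C(n+1, k) = (n+1) C(n, k-1)]: a weight [k] lowers the degree by one. A constant
    [F] yields the first moment, a linear one the second. *)
Lemma bernstein_shift (n : nat) (F : nat -> R) :
  \sum_(k < n.+2) (k%:R * F k) *: bernstein n.+1 k =
  n.+1%:R *: ('X * \sum_(j < n.+1) F j.+1 *: bernstein n j).
Proof.
rewrite big_ord_recl /= mul0r scale0r add0r mulr_sumr scaler_sumr.
apply: eq_bigr => j _; rewrite /bernstein /= /bump /= add1n subSS.
have -> (a b : R) (Y : {poly R}) : 'X * (a *: (b *: ('X ^+ j * Y))) =
    (a * b) *: ('X ^+ j.+1 * Y) by rewrite -!scalerAr scalerA exprS mulrA.
by rewrite !scalerA; congr (_ *: _); rewrite mulrAC -natrM -mul_bin_diag natrM; ring.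
Qed.

Lemma sum_bernstein n : \sum_(k < n.+1) bernstein n k = 1.
Proof.
have := exprDn_comm n (mulrC (1 - 'X : {poly R}) 'X).
rewrite subrK expr1n => ->; apply: eq_bigr => k _.
by rewrite /bernstein scaler_nat [in RHS]mulrC.
Qed.

Lemma sum_bernstein1 n :
  \sum_(k < n.+2) (k%:R / n.+1%:R) *: bernstein n.+1 k = 'X.
Proof.
have := bernstein_shift n (fun=> n.+1%:R^-1).
by rewrite -scaler_sumr sum_bernstein -scalerAr scalerA mulfV ?pnatr_eq0// scale1r mulr1.
Qed.

(** The excess over ['X ^+ 2] is the variance of the binomial distribution; its factor [n.+1%:R^-1]
    is the source of every convergence rate below. *)
Lemma sum_bernstein2 n :
  \sum_(k < n.+2) (k%:R / n.+1%:R) ^+ 2 *: bernstein n.+1 k =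
    'X ^+ 2 + n.+1%:R^-1 *: ('X * (1 - 'X)).
Proof.
have n0 : n.+1%:R != 0 :> R by rewrite pnatr_eq0.
have := bernstein_shift n (fun k => k%:R / n.+1%:R ^+ 2).
under eq_bigr do rewrite mulrA -expr2 -expr_div_n.
move=> ->.
have -> : \sum_(j < n.+1) (j.+1%:R / n.+1%:R ^+ 2) *: bernstein n j =
   n.+1%:R ^- 2 *: (n%:R *: 'X + 1).
  under eq_bigr => j _ do rewrite mulrC -scalerA -[j.+1%:R]natr1 scalerDl scale1r.
  rewrite -scaler_sumr big_split /= sum_bernstein; congr (_ *: (_ + _)).
  (* [bernstein_shift] needs a positive degree, hence the separate case of degree 0. *)
  case: n n0 => [|n] n0; first by rewrite big_ord1 scale0r scale0r.
  transitivity (\sum_(i < n.+2) (i%:R * 1) *: bernstein n.+1 i).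
    by apply: eq_bigr => i _; rewrite mulr1.
  rewrite (bernstein_shift n (fun=> 1)).
  by under eq_bigr do rewrite scale1r; rewrite sum_bernstein mulr1.
rewrite -scalerAr scalerA mulrDr mulr1 -scalerAr -expr2.
have -> : n%:R = n.+1%:R - 1 :> R by rewrite -natr1 addrK.
have -> : n.+1%:R / n.+1%:R ^+ 2 = n.+1%:R^-1 :> R
  by rewrite expr2 invfM mulrA mulfV ?mul1r.
rewrite scalerDr scalerA mulrBr mulr1 mulVf// scalerBl scale1r mulrBr mulr1.
by rewrite -expr2 scalerBr -addrA [- _ + _]addrC.
Qed.

End bernstein.

(** * Polynomials in a bounded operator *)

Section polynomial_calculus.
Context (R : realType) (H : normedModType R) (T : H -> H) (lT : linear T).

Implicit Types (p q : {poly R}) (u v : H).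

Definition peval p u : H :=
  \sum_(i < size p) p`_i *: iter i T u.

Lemma pevalE n p u : (size p <= n)%N ->
  peval p u = \sum_(i < n) p`_i *: iter i T u.
Proof.
move=> pn; rewrite /peval (big_ord_widen n (fun i => p`_i *: iter i T u))//.
rewrite big_mkcond; apply: eq_bigr => i _ /=.
by case: ltnP => // /(nth_default 0) ->; rewrite scale0r.
Qed.

Lemma pevalD p q u : peval (p + q) u = peval p u + peval q u.
Proof.
have h := size_polyD p q.
rewrite (pevalE _ h) (pevalE (n := maxn (size p) (size q)) _ (leq_maxl _ _)).
rewrite (pevalE (n := maxn (size p) (size q)) _ (leq_maxr _ _)) -big_split /=.
by apply: eq_bigr => i _; rewrite coefD scalerDl.
Qed.

Lemma pevalZ a p u : peval (a *: p) u = a *: peval p u.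
Proof.
rewrite (pevalE _ (size_scale_leq a p)) scaler_sumr.
by apply: eq_bigr => i _; rewrite coefZ scalerA.
Qed.

Lemma peval0 u : peval 0 u = 0.
Proof. by rewrite /peval size_poly0 big_ord0. Qed.

Lemma pevalN p u : peval (- p) u = - peval p u.
Proof. by rewrite -scaleN1r pevalZ scaleN1r. Qed.

Lemma pevalB p q u : peval (p - q) u = peval p u - peval q u.
Proof. by rewrite pevalD pevalN. Qed.

Lemma peval_sum I (s : seq I) (P : pred I) (F : I -> {poly R}) u :
  peval (\sum_(i <- s | P i) F i) u = \sum_(i <- s | P i) peval (F i) u.
Proof.
apply: (big_morph (fun p => peval p u)) => [p q|]; [exact: pevalD|exact: peval0].
Qed.

Lemma pevalC c u : peval c%:P u = c *: u.
Proof. by rewrite (pevalE _ (size_polyC_leq1 c)) big_ord1 coefC. Qed.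

Lemma peval1 u : peval 1 u = u.
Proof. by rewrite -[1]/(1%:P) pevalC scale1r. Qed.

Lemma peval_linear p : linear (peval p).
Proof.
have lI i : linear (iter i T).
  by elim: i => [//|i IH] a u v /=; rewrite IH lT.
move=> a u v; rewrite /peval scaler_sumr -big_split; apply: eq_bigr => i _ /=.
by rewrite lI scalerDr !scalerA mulrC.
Qed.

Lemma pevalMX p u : peval (p * 'X) u = T (peval p u).
Proof.
rewrite [in RHS]/peval (lin_sum lT).
have h : (size (p * 'X)%R <= (size p).+1)%N.
  by rewrite (leq_trans (size_polyMleq _ _))// size_polyX addn2.
rewrite (pevalE _ h) big_ord_recl coefMX /= scale0r add0r.
by apply: eq_bigr => i _; rewrite coefMX /= (linZ lT).
Qed.

Lemma pevalX u : peval 'X u = T u.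
Proof. by rewrite -['X]mul1r pevalMX peval1. Qed.

Lemma pevalM p q u : peval (p * q) u = peval p (peval q u).
Proof.
elim/poly_ind: p u => [|p c IH] u; first by rewrite mul0r !peval0.
by rewrite mulrDl !pevalD mulrAC !pevalMX IH mul_polyC pevalZ pevalC.
Qed.

Section positivity.
Context (ip : H -> H -> R) (ipP : inner_product ip).
Hypothesis sT : forall u v, ip (T u) v = ip u (T v).

Lemma peval_sym p u v : ip (peval p u) v = ip u (peval p v).
Proof.
rewrite (ip_suml ipP) (ip_sumr ipP); apply: eq_bigr => i _.
rewrite (ipZl ipP) (ipZr ipP); congr (_ * _).
by elim: (nat_of_ord i) u v => [//|j IH] u v; rewrite iterS sT IH iterSr.
Qed.

Definition ppos (p : {poly R}) := forall u, 0 <= ip (peval p u) u.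

Lemma pposD p q : ppos p -> ppos q -> ppos (p + q).
Proof. by move=> hp hq u; rewrite pevalD (ipDl ipP) addr_ge0. Qed.

Lemma pposZ a p : 0 <= a -> ppos p -> ppos (a *: p).
Proof. by move=> a0 hp u; rewrite pevalZ (ipZl ipP) mulr_ge0. Qed.

(** By symmetry the form of [p * q ^+ 2] at [u] is the form of [p] at [q(T) u]. *)
Lemma pposMsqr p q : ppos p -> ppos (p * q ^+ 2).
Proof.
by move=> hp u; rewrite expr2 mulrA mulrC pevalM peval_sym pevalM.
Qed.

Hypothesis T0 : forall u, 0 <= ip (T u) u.
Hypothesis T1 : forall u, ip (T u) u <= `|u| ^+ 2.

(** Even exponents are squares and are removed by [pposMsqr]. The only product left is
    ['X * (1 - 'X)], which the identity [X (1 - X) = (1 - X) X^2 + X (1 - X)^2] turns into positive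
    terms without a square root of T. *)
Lemma ppos_monomial k l : ppos ('X ^+ k * (1 - 'X) ^+ l).
Proof.
have p1 : ppos 1 by move=> u; rewrite peval1 (ip_ge0 ipP).
have pX : ppos 'X by move=> u; rewrite pevalX.
have pY : ppos (1 - 'X).
  by move=> u; rewrite pevalB peval1 pevalX (ipBl ipP) subr_ge0 (ipE ipP).
have pXY : ppos ('X * (1 - 'X)).
  have -> : 'X * (1 - 'X) = (1 - 'X) * 'X ^+ 2 + 'X * (1 - 'X) ^+ 2 :> {poly R} by ring.
  by apply: pposD; exact: pposMsqr.
rewrite -(odd_double_half k) -(odd_double_half l) !exprD -!muln2 !exprM mulrACA.
rewrite -exprMn; apply: pposMsqr.
case: (odd k); case: (odd l); rewrite ?expr1 ?expr0 ?mul1r ?mulr1//.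
Qed.

(* The quadratic form of a combination of a positive partition of unity is
   estimated term by term, as if the operators were numbers. *)
Lemma peval_partition_bound (I : finType) (P : I -> {poly R}) (c d : I -> R)
    (Q : {poly R}) (e C k : R) :
  (forall i, ppos (P i)) -> \sum_i P i = 1 -> 0 <= e -> 0 <= C -> 0 <= k ->
  (forall i, `|c i| <= e + C * d i) -> \sum_i d i *: P i = Q ->
  (forall u, ip (peval Q u) u <= k * `|u| ^+ 2) ->
  forall u, `|peval (\sum_i c i *: P i) u| <= (e + C * k) * `|u|.
Proof.
move=> Ppos P1 e0 C0 k0 cd dQ Qk.
apply: (norm_le_quadratic ipP (peval_linear _)).
- by rewrite addr_ge0 ?mulr_ge0.
- exact: peval_sym.
move=> u; rewrite peval_sum (ip_suml ipP).
rewrite (le_trans (ler_norm_sum _ _ _))//.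
apply: (@le_trans _ _ (\sum_i (e + C * d i) * ip (peval (P i) u) u)).
  apply: ler_sum => i _; rewrite pevalZ (ipZl ipP) normrM.
  by rewrite (ger0_norm (Ppos i u)); exact: ler_wpM2r (Ppos i u) _ _ (cd i).
under eq_bigr do rewrite mulrDl -mulrA.
rewrite big_split /= -!mulr_sumr -(ip_suml ipP) -peval_sum P1 peval1 (ipE ipP).
have -> : \sum_i d i * ip (peval (P i) u) u = ip (peval Q u) u.
  by rewrite -dQ peval_sum (ip_suml ipP); apply: eq_bigr => i _; rewrite pevalZ (ipZl ipP).
by rewrite mulrDl lerD2l -mulrA ler_wpM2l.
Qed.

End positivity.
End polynomial_calculus.

(** Uniform continuity on [0, 1] in a form that is linear in [(s - t) ^+ 2], so that it can be
    averaged against Bernstein polynomials knowing only their second moment. *)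
Definition quad_modulus (R : realType) (g : R -> R) := forall e : R, 0 < e ->
  exists2 C : R, 0 <= C & forall s t, 0 <= s <= 1 -> 0 <= t <= 1 ->
    `|g s - g t| <= e + C * (s - t) ^+ 2.

Lemma quad_modulus_bounded (R : realType) (g : R -> R) : quad_modulus g ->
  exists2 M : R, 0 <= M & forall s, 0 <= s <= 1 -> `|g s| <= M.
Proof.
move=> /(_ _ ltr01)[C C0 hC]; exists (`|g 0| + (1 + C)) => [|s s01].
  by rewrite !addr_ge0.
have := hC s 0 s01; rewrite lexx ler01 subr0 => /(_ isT) h.
rewrite -[g s](subrK (g 0)) addrC (le_trans (ler_normD _ _))// lerD2l.
rewrite (le_trans h)// lerD2l ler_piMr//.
by case/andP: s01 => ? ?; rewrite expr_le1.
Qed.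

Lemma quad_modulusM (R : realType) (f g : R -> R) :
  quad_modulus f -> quad_modulus g -> quad_modulus (fun x => f x * g x).
Proof.
move=> hf hg.
have [M M0 hM] := quad_modulus_bounded hf; have [N N0 hN] := quad_modulus_bounded hg.
move=> e e0; have e20 : 0 < e / 2 by rewrite divr_gt0.
have [d d0 dM] := small_mul e20 M0; have [d' d'0 dN] := small_mul e20 N0.
have [C C0 hC] := hf _ d'0; have [D D0 hD] := hg _ d0.
exists (M * D + N * C) => [|s t hs ht]; first by rewrite addr_ge0 ?mulr_ge0.
have -> : f s * g s - f t * g t = f s * (g s - g t) + g t * (f s - f t) by ring.
rewrite (le_trans (ler_normD _ _))// !normrM.
have h1 := ler_pM (normr_ge0 (f s)) (normr_ge0 _) (hM s hs) (hD s t hs ht).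
have h2 := ler_pM (normr_ge0 (g t)) (normr_ge0 _) (hN t ht) (hC s t hs ht).
rewrite (le_trans (lerD h1 h2))// !mulrDr mulrDl !mulrA.
move: (M * D * _) (N * C * _) => a b; lra.
Qed.

Lemma quad_modulus_id (R : realType) : quad_modulus (@id R).
Proof.
(* The constant comes from [2 e |x| <= e^2 + x^2]. *)
move=> e e0; exists e^-1 => [|s t _ _]; first by rewrite invr_ge0 ltW.
have := sqr_ge0 (`|s - t| - e / 2 * 2); rewrite divfK// => h.
have {h} : e * `|s - t| <= e * (e + e^-1 * (s - t) ^+ 2).
  rewrite mulrDr mulrA mulfV ?gt_eqF// mul1r -(real_normK (num_real (s - t))).
  have : 0 <= `|s - t| * e by rewrite mulr_ge0// ltW.
  by nra.
by rewrite ler_pM2l.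
Qed.

(** The degree is [n.+1], so that the nodes never involve a division by 0. *)
Definition bern (R : realType) (g : R -> R) n : {poly R} :=
  \sum_(k < n.+2) g (k%:R / n.+1%:R) *: bernstein R n.+1 k.

Lemma bern_node (R : realType) n (k : 'I_n.+2) :
  0 <= (k%:R / n.+1%:R : R) <= 1.
Proof.
rewrite divr_ge0//= ler_pdivrMr ?ltr0n// mul1r ler_nat -ltnS; exact: ltn_ord.
Qed.

Lemma root_bern0 (R : realType) (g : R -> R) n : g 0 = 0 -> root (bern g n) 0.
Proof.
move=> g0; rewrite /root /bern horner_sum big1// => k _.
rewrite hornerZ /bernstein hornerZ !hornerE expr0n.
by case: (nat_of_ord k) => [|j]; rewrite /= ?mul0r ?g0 ?mulr0 ?mul0r.
Qed.

Section bernstein_calculus.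
Context (R : realType) (H : normedModType R) (ip : H -> H -> R).
Hypotheses (ipP : inner_product ip) (cH : cauchy_complete H).
Context (T : H -> H).
Hypotheses (lT : linear T) (sT : forall u v, ip (T u) v = ip u (T v)).
Hypotheses (T0 : forall u, 0 <= ip (T u) u).
Hypotheses (T1 : forall u, ip (T u) u <= `|u| ^+ 2).

(** Products of two Bernstein bases form a positive partition of unity indexed by pairs of nodes.
    Comparing two degrees, or a product with a single polynomial, becomes an estimate of a function
    of two variables near the diagonal. *)
Let P n m (i : 'I_n.+2 * 'I_m.+2) : {poly R} :=
  bernstein R n.+1 i.1 * bernstein R m.+1 i.2.

Let P_pos n m i : ppos T ip (@P n m i).
Proof.
rewrite /P /bernstein -scalerAl -scalerAr mulrACA -!exprD.
by do 2![apply: (pposZ ipP); first by rewrite ler0n]; exact: ppos_monomial.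
Qed.

Let P_prod n m (a : 'I_n.+2 -> R) (b : 'I_m.+2 -> R) :
  \sum_i (a i.1 * b i.2) *: @P n m i =
  (\sum_i a i *: bernstein R n.+1 i) * (\sum_i b i *: bernstein R m.+1 i).
Proof.
rewrite big_distrlr /= pair_bigA /=; apply: eq_bigr => -[i j] _ /=.
have h (x y : R) (p q : {poly R}) : (x * y) *: (p * q) = (x *: p) * (y *: q).
  by rewrite -scalerAl -scalerAr scalerA.
exact: h.
Qed.

Let P_sum n m : \sum_i @P n m i = 1.
Proof.
have := P_prod (fun _ : 'I_n.+2 => 1) (fun _ : 'I_m.+2 => 1).
under eq_bigr do rewrite mul1r scale1r.
by move=> ->; under eq_bigr do rewrite scale1r;
  rewrite sum_bernstein mul1r; under eq_bigr do rewrite scale1r; rewrite sum_bernstein.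
Qed.

(** Summing [(x_i - y_j)^2] against the partition adds the two variances: the result is
    [(1/(n+1) + 1/(m+1)) X (1 - X)], whose form at T is at most that multiple of [|u|^2]. *)
Lemma bern_double_bound (h : R -> R -> R) (e C : R) n m u : 0 <= e -> 0 <= C ->
  (forall s t, 0 <= s <= 1 -> 0 <= t <= 1 -> `|h s t| <= e + C * (s - t) ^+ 2) ->
  `|peval T (\sum_(i : 'I_n.+2 * 'I_m.+2)
      h (i.1%:R / n.+1%:R) (i.2%:R / m.+1%:R) *: P i) u|
    <= (e + C * (n.+1%:R^-1 + m.+1%:R^-1)) * `|u|.
Proof.
move=> e0 C0 hh.
apply: (peval_partition_bound lT ipP sT (P := @P n m)
  (c := fun i => h (i.1%:R / n.+1%:R) (i.2%:R / m.+1%:R))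
  (d := fun i => (i.1%:R / n.+1%:R - i.2%:R / m.+1%:R) ^+ 2)
  (Q := (n.+1%:R^-1 + m.+1%:R^-1) *: ('X * (1 - 'X)))
  (@P_pos n m) (P_sum n m)) => //.
- by move=> i; apply: hh; exact: bern_node.
- pose x (i : 'I_n.+2) : R := i%:R / n.+1%:R; pose y (i : 'I_m.+2) : R := i%:R / m.+1%:R.
    have -> : \sum_(i : 'I_n.+2 * 'I_m.+2)
         (i.1%:R / n.+1%:R - i.2%:R / m.+1%:R) ^+ 2 *: P i =
       \sum_i (x i.1 ^+ 2 * 1) *: @P n m i - 2 *: \sum_i (x i.1 * y i.2) *: @P n m i
         + \sum_i (1 * y i.2 ^+ 2) *: @P n m i.
      rewrite scaler_sumr -sumrB -big_split /=; apply: eq_bigr => i _.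
      rewrite scalerA -scalerBl -scalerDl; congr (_ *: _); rewrite /x /y; ring.
    rewrite (P_prod (fun i => x i ^+ 2) (fun=> 1)) (P_prod x y).
    rewrite (P_prod (fun=> 1) (fun i => y i ^+ 2)).
    rewrite !sum_bernstein1 !sum_bernstein2.
    have one k : \sum_(i < k.+2) 1 *: bernstein R k.+1 i = 1.
      by under eq_bigr do rewrite scale1r; exact: sum_bernstein.
    rewrite !one mulr1 mul1r [RHS]scalerDl -expr2 scaler_nat mulr2n; ring.
- move=> u'; rewrite pevalZ (ipZl ipP) ler_wpM2l// mulrBr mulr1 pevalB pevalX//.
  rewrite pevalM// !pevalX// (ipBl ipP) [ip (T (T _)) _]sT (ipE ipP).
  by rewrite (le_trans _ (T1 u'))// gerBl sqr_ge0.
Qed.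

Definition bern_limit (g : R -> R) (u : H) :=
  seqlim (fun n => peval T (bern g n) u).

Definition psi (g : R -> R) (u : H) : H := xget 0 (bern_limit g u).

Lemma bern_diff g n m : bern g n - bern g m =
  \sum_(i : 'I_n.+2 * 'I_m.+2) (g (i.1%:R / n.+1%:R) - g (i.2%:R / m.+1%:R)) *: P i.
Proof.
under eq_bigr do rewrite scalerBl; rewrite sumrB /bern.
have h1 := P_prod (fun i : 'I_n.+2 => g (i%:R / n.+1%:R)) (fun _ : 'I_m.+2 => 1).
have h2 := P_prod (fun _ : 'I_n.+2 => 1) (fun i : 'I_m.+2 => g (i%:R / m.+1%:R)).
have one k : \sum_(i < k.+2) 1 *: bernstein R k.+1 i = 1.
  by under eq_bigr do rewrite scale1r; exact: sum_bernstein.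
rewrite one mulr1 in h1; rewrite one mul1r in h2.
rewrite -h1 -h2; congr (_ - _); apply: eq_bigr => i _; by rewrite ?mulr1 ?mul1r.
Qed.

Lemma bern_cauchy g : quad_modulus g -> forall e : R, 0 < e -> exists N, forall n m u,
  (N <= n)%N -> (N <= m)%N -> `|peval T (bern g n) u - peval T (bern g m) u| <= e * `|u|.
Proof.
move=> hg e e0; have e20 : 0 < e / 2 by rewrite divr_gt0.
have [C C0 hC] := hg _ e20.
have [d d0 hd] := small_mul e20 C0.
have d20 : 0 < d / 2 by rewrite divr_gt0.
have [N hN] := exists_inv_lt d20; exists N => n m u nN mN.
rewrite -pevalB bern_diff.
apply: le_trans (bern_double_bound (h := fun s t => g s - g t) _ _ u (ltW e20) C0 hC) _.
rewrite ler_wpM2r// [leRHS](splitr e) lerD2l (le_trans _ hd)//.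
by rewrite ler_wpM2l// (splitr d) lerD// hN.
Qed.

(** Letting the second index of the Cauchy estimate tend to infinity keeps it uniform in [u]:
    convergence holds in operator norm, although [psi] is defined by pointwise limits. *)
Lemma psiP g : quad_modulus g -> forall e : R, 0 < e -> exists N, forall n u,
  (N <= n)%N -> `|peval T (bern g n) u - psi g u| <= e * `|u|.
Proof.
move=> hg.
have key u : bern_limit g u (psi g u).
  have [e e0|v hv] := cH (u_ := fun n => peval T (bern g n) u); last first.
    by apply: (@xgetPex _ 0 (bern_limit g u)); exists v.
  have [d d0 hd] := small_mul e0 (normr_ge0 u).
  have [N hN] := bern_cauchy hg d0; exists N => i j iN jN.
  by rewrite (le_trans (hN i j u iN jN))// mulrC.
move=> e e0; have [N hN] := bern_cauchy hg e0; exists N => n u nN.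
apply: eps_le => d d0; have [M hM] := key u d d0.
rewrite -[X in `|X|](subrKA (peval T (bern g (maxn N M)) u)).
rewrite (le_trans (ler_normD _ _))// lerD//; first by rewrite hN// leq_maxl.
by rewrite hM// leq_maxr.
Qed.


Lemma psi_limit g u : quad_modulus g -> seqlim (fun n => peval T (bern g n) u) (psi g u).
Proof.
move=> hg e e0; have [d d0 hd] := small_mul e0 (normr_ge0 u).
have [N hN] := psiP hg d0; exists N => n Nn.
by rewrite (le_trans (hN n u Nn))// mulrC.
Qed.

Lemma bern_le g (c : R) n u : 0 <= c -> (forall s, 0 <= s <= 1 -> `|g s| <= c) ->
  `|peval T (bern g n) u| <= c * `|u|.
Proof.
move=> c0 gc.
have := @bern_double_bound (fun s _ => g s) c 0 n n u c0 (lexx _).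
have -> : \sum_(i : 'I_n.+2 * 'I_n.+2) g (i.1%:R / n.+1%:R) *: P i = bern g n.
  have := P_prod (fun i : 'I_n.+2 => g (i%:R / n.+1%:R)) (fun _ : 'I_n.+2 => 1).
  have -> : \sum_(i < n.+2) 1 *: bernstein R n.+1 i = 1.
    by under eq_bigr do rewrite scale1r; exact: sum_bernstein.
  by rewrite mulr1 /bern => <-; apply: eq_bigr => i _; rewrite mulr1.
by rewrite mul0r addr0; apply => s t hs _; rewrite mul0r addr0 gc.
Qed.

Lemma psi_le g (c : R) u : quad_modulus g -> 0 <= c ->
  (forall s, 0 <= s <= 1 -> `|g s| <= c) -> `|psi g u| <= c * `|u|.
Proof.
move=> hg c0 gc; apply: (seqlim_le (psi_limit u hg)) => n; exact: bern_le.
Qed.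

Lemma psi_linear g : quad_modulus g -> linear (psi g).
Proof.
move=> hg a u v; apply: seqlim_uniq (psi_limit _ hg) _.
under [X in seqlim X]funext do rewrite peval_linear//.
by apply: seqlimD; [apply: seqlimZ|]; exact: psi_limit.
Qed.

Lemma psi_sym g u v : quad_modulus g -> ip (psi g u) v = ip u (psi g v).
Proof.
move=> hg; apply/eqP; rewrite -subr_eq0 -normr_le0; apply: eps_le => e e0.
rewrite add0r.
have c0 : 0 <= 2 * `|u| * `|v| by rewrite !mulr_ge0.
have [d d0 hd] := small_mul e0 c0.
have [N hN] := psiP hg d0.
have -> : ip (psi g u) v - ip u (psi g v) =
   ip (psi g u - peval T (bern g N) u) v - ip u (psi g v - peval T (bern g N) v).
  by rewrite (ipBl ipP) (ipBr ipP) (peval_sym ipP sT); ring.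
rewrite (le_trans (ler_normB _ _))//.
have h1 := cauchy_schwarz ipP (psi g u - peval T (bern g N) u) v.
have h2 := cauchy_schwarz ipP u (psi g v - peval T (bern g N) v).
rewrite (le_trans (lerD h1 h2))//.
have h3 := hN N u (leqnn _); have h4 := hN N v (leqnn _).
rewrite distrC in h3; rewrite distrC in h4.
have h5 := ler_wpM2r (normr_ge0 v) h3; have h6 := ler_wpM2l (normr_ge0 u) h4.
rewrite (le_trans (lerD h5 h6))// (le_trans _ hd)//.
by rewrite le_eqVlt; apply/orP; left; apply/eqP; ring.
Qed.

Lemma psi_lin a f g u : quad_modulus f -> quad_modulus g ->
  quad_modulus (fun t => a * f t + g t) ->
  psi (fun t => a * f t + g t) u = a *: psi f u + psi g u.
Proof.
move=> hf hg hfg; apply: seqlim_uniq (psi_limit _ hfg) _.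
have e n : bern (fun t => a * f t + g t) n = a *: bern f n + bern g n.
  rewrite /bern scaler_sumr -big_split; apply: eq_bigr => i _ /=.
  by rewrite scalerDl scalerA.
under [X in seqlim X]funext do rewrite e pevalD pevalZ.
by apply: seqlimD; [apply: seqlimZ|]; exact: psi_limit.
Qed.

Lemma psi_eq f g u : (forall s, 0 <= s <= 1 -> f s = g s) -> psi f u = psi g u.
Proof.
move=> fg; have -> // : psi f = psi g.
rewrite /psi /bern_limit; apply/funext => v; congr (xget 0 (seqlim _)).
apply/funext => n; congr (peval T _ v); apply: eq_bigr => i _.
by rewrite fg// bern_node.
Qed.

Lemma psi_id u : psi id u = T u.
Proof.
apply: seqlim_uniq (psi_limit _ (@quad_modulus_id R)) _.
under [X in seqlim X]funext do rewrite /bern sum_bernstein1 pevalX//.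
exact: seqlim_cst.
Qed.

(** The difference is the double sum of [f(x_i) (g(y_j) - g(x_i))], a function that is small near
    the diagonal. *)
Lemma bern_mul f g : quad_modulus f -> quad_modulus g ->
  forall e : R, 0 < e -> exists N, forall n u, (N <= n)%N ->
  `|peval T (bern f n * bern g n - bern (fun t => f t * g t) n) u| <= e * `|u|.
Proof.
move=> hf hg e e0; have e20 : 0 < e / 2 by rewrite divr_gt0.
have [M M0 fM] := quad_modulus_bounded hf.
have [d d0 hd] := small_mul e20 M0.
have [C C0 hC] := hg _ d0.
have MC0 : 0 <= M * C * 2 by rewrite !mulr_ge0.
have [d2 d20 hd2] := small_mul e20 MC0.
have [N hN] := exists_inv_lt d20; exists N => n u Nn.
have -> : bern f n * bern g n - bern (fun t => f t * g t) n =
  \sum_(i : 'I_n.+2 * 'I_n.+2) (f (i.1%:R / n.+1%:R) *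
    (g (i.2%:R / n.+1%:R) - g (i.1%:R / n.+1%:R))) *: P i.
  have h1 := P_prod (fun i : 'I_n.+2 => f (i%:R / n.+1%:R)) (fun i : 'I_n.+2 => g (i%:R / n.+1%:R)).
  have h2 := P_prod (fun i : 'I_n.+2 => f (i%:R / n.+1%:R) * g (i%:R / n.+1%:R)) (fun _ : 'I_n.+2 => 1).
  have one : \sum_(i < n.+2) 1 *: bernstein R n.+1 i = 1.
    by under eq_bigr do rewrite scale1r; exact: sum_bernstein.
  rewrite one mulr1 in h2; rewrite /bern -h1 -h2 -sumrB; apply: eq_bigr => i _.
  by rewrite -scalerBl mulr1 mulrBr.
have Md0 : 0 <= M * d by rewrite mulr_ge0// ltW.
apply: le_trans (bern_double_bound (h := fun s t => f s * (g t - g s))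
  (C := M * C) n n u Md0 _ _) _.
- by rewrite mulr_ge0.
- move=> s t hs ht; rewrite normrM -mulrA -mulrDr.
  by apply: ler_pM => //; [exact: fM|rewrite -(opprB t s) sqrrN hC].
- rewrite ler_wpM2r// (splitr e) lerD// (le_trans _ hd2)//.
  by rewrite -!mulrA ler_wpM2l// ler_wpM2l// mulr_natl mulr2n lerD// hN.
Qed.

Lemma psi_mul f g u : quad_modulus f -> quad_modulus g ->
  psi (fun t => f t * g t) u = psi f (psi g u).
Proof.
move=> hf hg; have hfg := quad_modulusM hf hg.
have [M M0 fM] := quad_modulus_bounded hf.
apply: seqlim_uniq (psi_limit _ hfg) _ => e e0.
have e20 : 0 < e / 2 by rewrite divr_gt0.
have [d d0 hd] := small_mul e20 (normr_ge0 u).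
have lf n u' := bern_le n u' M0 fM.
have h1 : seqlim (fun n => peval T (bern f n) (peval T (bern g n) u)) (psi f (psi g u)).
  move=> r r0; have r20 : 0 < r / 2 by rewrite divr_gt0.
  have [d' d'0 hd'] := small_mul r20 M0.
  have [N hN] := psi_limit u hg d'0; have [N' hN'] := psi_limit (psi g u) hf r20.
  exists (maxn N N') => n; rewrite geq_max => /andP[Nn N'n].
  rewrite -(subrKA (peval T (bern f n) (psi g u))) (splitr r).
  rewrite (le_trans (ler_normD _ _))// lerD ?hN'// -(linB (peval_linear lT _)).
  by rewrite (le_trans (lf _ _))// (le_trans _ hd')// ler_wpM2l// hN.
have [N hN] := h1 _ e20; have [N' hN'] := bern_mul hf hg d0.
exists (maxn N N') => n; rewrite geq_max => /andP[Nn N'n].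
rewrite -(subrKA (peval T (bern f n * bern g n) u)) (splitr e).
rewrite (le_trans (ler_normD _ _))// lerD//; last by rewrite pevalM// hN.
rewrite distrC -pevalB (le_trans (hN' _ _ N'n))// mulrC//.
Qed.

Section psi_vanishing.
Context (g : R -> R).
Hypotheses (hg : quad_modulus g) (g0 : g 0 = 0).

Let bern_factor n : exists q, bern g n = q * 'X.
Proof. by have /factor_theorem[q] := root_bern0 n g0; rewrite subr0 => qE; exists q. Qed.

(** As [g 0 = 0], every [bern g n] is divisible by ['X], so its value at T lies in the range of T;
    the closedness of [V] covers the limit. The same factor of T gives the statement on the
    kernel. *)
Lemma psi_closed (V : set H) u :
  (forall x l, (forall n, V (x n)) -> seqlim x l -> V l) ->
  (forall u, V (T u)) -> V (psi g u).
Proof.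
move=> Vcl VT; apply: Vcl (psi_limit u hg) => n.
by have [q ->] := bern_factor n; rewrite pevalMX.
Qed.

Lemma psi_ker u : T u = 0 -> psi g u = 0.
Proof.
move=> Tu; apply: seqlim_uniq (psi_limit u hg) _.
rewrite (_ : (fun n => _) = fun=> 0); first exact: seqlim_cst.
apply/funext => n; have [q ->] := bern_factor n.
by rewrite pevalM// pevalX// Tu (lin0 (peval_linear lT _)).
Qed.

End psi_vanishing.

End bernstein_calculus.

(** * Continuous functions and their transport to [0, 1] *)

Section quad_modulus_continuous.
Context (R : realType).
Implicit Types (f g : R -> R).

(** Close pairs are handled by continuity; for distant ones a large [C] makes [C (s - t)^2] exceed
    twice the supremum of [|g|]. *)
Lemma continuous_quad_modulus g : continuous g -> quad_modulus g.
Proof.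
move=> cg e e0.
have [M M0 hM] : exists2 M : R, 0 <= M & forall s, 0 <= s <= 1 -> `|g s| <= M.
  have cK : compact (g @` `[0, 1]).
    by apply: continuous_compact (@segment_compact R 0 1); exact: continuous_subspaceT.
  have [M [_ hM]] := compact_bounded cK.
  exists (`|M| + 1) => [|s s01]; first by rewrite addr_ge0.
  apply: (hM (`|M| + 1)); first by rewrite ltr_pwDr// ler_norm.
  by exists s => //=; rewrite in_itv.
(* The constant [C] is the parameter along the filter [+oo]: near each point all large [C] work, so
   one [C] serves the whole segment. *)
have := @segment_compact R 0 1; rewrite compact_near_coveringP => /(_ R (+oo) 
  (fun C s => forall t, 0 <= t <= 1 -> `|g s - g t| <= e + C * (s - t) ^+ 2)).
case=> [x x01|C0 [_ hC]]; last first.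
  exists (`|C0| + 1) => [|s t hs ht]; first by rewrite addr_ge0.
  have C0C : C0 < `|C0| + 1 by rewrite ltr_pwDr// ler_norm.
  by apply: (hC _ C0C s) => //=; rewrite in_itv.
have e20 : 0 < e / 2 by rewrite divr_gt0.
have /cvgrPdist_lt/(_ _ e20)/nbhs_ballP[d /= d0 hd] := cg x.
have d20 : 0 < d / 2 by rewrite divr_gt0.
exists (ball x (d / 2), [set C | 0 <= C /\ 2 * M <= C * (d / 2) ^+ 2]) => /=.
  split; first exact: nbhsx_ballx.
  apply: filterI; first exact: nbhs_pinfty_ge.
  exists (2 * M / (d / 2) ^+ 2); split=> [|C]; first exact: num_real.
  by rewrite ltr_pdivrMr ?exprn_gt0// => /ltW.
move=> [s C] /= [xs [C0 hC]] t ht.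
have xs' : ball x d s by apply: le_ball xs; rewrite ler_pdivrMr// ler_peMr ?ltW// ltr1n.
have /= h2 := hd _ xs'.
have [ts|ts] := ltP `|s - t| (d / 2).
  have xt : ball x d t by rewrite [d]splitr; apply: ball_triangle xs _.
  have /= h1 := hd _ xt.
  have -> : g s - g t = (g x - g t) - (g x - g s) by ring.
  have h5 : 0 <= C * (s - t) ^+ 2 by rewrite mulr_ge0//; exact: sqr_ge0.
  have := ler_normB (g x - g t) (g x - g s); lra.
(* The nearby point [s] may lie outside [0, 1], where [M] bounds nothing; its value is bounded
   through [g x]. *)
have hx : `|g x| <= M by apply: hM; move: x01 => /=; rewrite in_itv.
have hst : C * (d / 2) ^+ 2 <= C * (s - t) ^+ 2.
  by rewrite ler_wpM2l// -(real_normK (num_real (s - t))) ler_pXn2r// ?nnegrE ltW.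
have -> : g s - g t = g x - (g x - g s) - g t by ring.
have := ler_normB (g x - (g x - g s)) (g t).
have := ler_normB (g x) (g x - g s); have := hM t ht.
by lra.
Qed.

(* The substitution sends functions vanishing at infinity to functions
   vanishing at 0; [rho] is [1/s - 1] or its square root below. *)
Definition pull (rho f : R -> R) (s : R) := if s <= 0 then 0 else f (rho s).

Definition blowup (rho : R -> R) :=
  (forall s, 0 < s -> {for s, continuous rho}) /\
  forall M, exists2 d : R, 0 < d & forall s, 0 < s < d -> M < rho s.

Lemma Cc_vanish f : Cc [set: R] f -> exists2 M : R, 0 <= M &
  forall t, M < `|t| -> f t = 0.
Proof.
move=> [_ /compact_bounded[M [_ hM]] _].
exists (`|M| + 1) => [|t Mt]; first by rewrite addr_ge0.
apply: contrapT => /eqP ft.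
have := hM (`|M| + 1); rewrite ltr_pwDr ?ler_norm// => /(_ isT t) h.
have /h /= : supp f t by exact: subset_closure.
by rewrite leNgt Mt.
Qed.

(** At [s <= 0] the point is that [rho] has left the support of [f] for all small positive
    arguments. *)
Lemma continuous_pull rho f : blowup rho -> Cc [set: R] f -> continuous (pull rho f).
Proof.
move=> [crho brho] fc s; have [cf _ _] := fc; have [M M0 fM] := Cc_vanish fc.
have [s0|s0] := ltP 0 s.
  have hcf : {for s, continuous (f \o rho)} by apply: continuous_comp; [exact: crho|exact: cf].
  rewrite /continuous_at /pull leNgt s0 /=; apply: cvg_trans hcf.
  apply: near_eq_cvg; near=> t; rewrite leNgt; have -> // : 0 < t.
  by near: t; exact: lt_nbhsr.
have [d d0 hd] := brho M.
rewrite /continuous_at /pull s0; apply: cvg_near_cst.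
near=> t; case: ifPn => //; rewrite -ltNge => t0; apply: fM.
have : t < d by near: t; apply: lt_nbhsl; exact: le_lt_trans s0 d0.
by move=> td; rewrite (lt_le_trans _ (ler_norm _))// hd// t0 td.
Unshelve. all: by end_near. Qed.

Lemma pull_quad_modulus rho f : blowup rho -> C0 f -> quad_modulus (pull rho f).
Proof.
move=> hrho f0 e e0; have e30 : 0 < e / 3 by rewrite divr_gt0.
have [g gc fg] := f0 _ e30.
have [C C0 hC] := continuous_quad_modulus (continuous_pull hrho gc) e30.
exists C => // s t hs ht.
have fg' x : `|pull rho f x - pull rho g x| <= e / 3.
  by rewrite /pull; case: ifP => _ //; rewrite subrr normr0 ltW.
have -> : pull rho f s - pull rho f t = (pull rho f s - pull rho g s)
   + (pull rho g s - pull rho g t) - (pull rho f t - pull rho g t) by ring.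
have := hC s t hs ht; have := fg' s; have := fg' t.
have := ler_normB ((pull rho f s - pull rho g s) + (pull rho g s - pull rho g t)) (pull rho f t - pull rho g t).
have := ler_normD (pull rho f s - pull rho g s) (pull rho g s - pull rho g t).
lra.
Qed.

Definition inv_sub1 (s : R) : R := s^-1 - 1.

Lemma blowup_inv_sub1 : blowup inv_sub1.
Proof.
split=> [s s0|M].
  apply: cvgB; last exact: cvg_cst.
  by apply: cvgV; [rewrite gt_eqF|exact: cvg_id].
have M0 : 0 < `|M| + 1 by rewrite ltr_wpDl.
exists (`|M| + 1)^-1 => [|s /andP[s0 sM]]; first by rewrite invr_gt0.
rewrite /inv_sub1 ltrBrDr (le_lt_trans (lerD (ler_norm M) (lexx 1)))//.
by rewrite -[ltLHS]invrK ltf_pV2 ?posrE// invr_gt0.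
Qed.

Lemma blowup_sqrt : blowup (fun s => Num.sqrt (inv_sub1 s)).
Proof.
have [h1 h2] := blowup_inv_sub1; split=> [s s0|M].
  by apply: (@continuous_comp _ _ _ inv_sub1 Num.sqrt); [exact: h1|exact: sqrt_continuous].
have [d d0 hd] := h2 (M ^+ 2); exists d => // s /hd h.
rewrite (le_lt_trans (ler_norm M))// -sqrtr_sqr ltr_sqrt//.
by rewrite (le_lt_trans _ h)// sqr_ge0.
Qed.

End quad_modulus_continuous.

(** * Functions vanishing at infinity *)

Section C0_functions.
Context (R : realType).
Implicit Types (f g : R -> R).

Lemma CcP f (M : R) : continuous f -> (forall t, M < `|t| -> f t = 0) -> Cc [set: R] f.
Proof.
move=> cf fM; split => //.
apply: (@subclosed_compact _ _ `[- M, M]); [exact: closed_closure|exact: segment_compact|].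
rewrite [X in _ `<=` X](closure_id _).1; last exact: itv_closed.
apply: closureS => t /= ft; rewrite in_itv /= -ler_norml leNgt.
by apply: contra_neqN ft => /fM.
Qed.

Definition plateau (w d t : R) : R := Num.max 0 (Num.min 1 (2 - `|t - w| / d)).

Lemma plateau01 w d t : 0 <= plateau w d t <= 1.
Proof. by rewrite /plateau le_max lexx /= ge_max ler01 ge_min lexx. Qed.

Lemma plateau1 w d t : 0 < d -> `|t - w| <= d -> plateau w d t = 1.
Proof.
move=> d0 h; rewrite /plateau min_l ?max_r//.
by rewrite lerBrDr addrC -lerBrDr (_ : 2 - 1 = 1) ?ler_pdivrMr ?mul1r//; ring.
Qed.

Lemma plateau0 w d t : 0 < d -> 2 * d <= `|t - w| -> plateau w d t = 0.
Proof.
move=> d0 h; rewrite /plateau max_l// ge_min; apply/orP; right.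
by rewrite subr_le0 ler_pdivlMr.
Qed.

Lemma continuous_plateau w d : continuous (plateau w d).
Proof.
move=> t.
apply: (@continuous_max R _ (fun=> 0) (fun t => Num.min 1 (2 - `|t - w| / d))).
  exact: cvg_cst.
apply: (@continuous_min R _ (fun=> 1) (fun t => 2 - `|t - w| / d)); first exact: cvg_cst.
apply: cvgB; first exact: cvg_cst.
apply: cvgM; last exact: cvg_cst.
apply: (@continuous_comp _ _ _ (fun x => x - w) (@Num.norm R R)).
  by apply: cvgB; [exact: cvg_id|exact: cvg_cst].
exact: norm_continuous.
Qed.

Lemma C0P f : C0 f <-> continuous f /\
  forall e : R, 0 < e -> exists M : R, forall t, M < `|t| -> `|f t| <= e.
Proof.
split=> [hf|[cf vf] e e0].
  split=> [t|e e0]; last first.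
    have [g gc fg] := hf e e0; have [M M0 gM] := Cc_vanish gc.
    by exists M => t /gM gt0; have := fg t; rewrite gt0 subr0.
  apply/cvgrPdist_le => e e0; have e30 : 0 < e / 3 by rewrite divr_gt0.
  have [g [cg _ _] fg] := hf _ e30.
  have /cvgrPdist_le/(_ _ e30) := cg t.
  apply: filterS => s h /=; have h1 := fg t; have := fg s.
  have := ler_normB ((f t - g t) + (g t - g s)) (f s - g s).
  have := ler_normD (f t - g t) (g t - g s).
  have -> : f t - g t + (g t - g s) - (f s - g s) = f t - f s by ring.
  by lra.
have [M vM] := vf e e0; pose N := `|M| + 1; have N0 : 0 < N by rewrite ltr_wpDl.
exists (fun t => f t * plateau 0 N t) => [|t].
  apply: (CcP (M := 2 * N)) => [t|t ht]; first by apply: cvgM; [exact: cf|exact: continuous_plateau].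
  by rewrite plateau0 ?mulr0// subr0 ltW.
have -> : f t - f t * plateau 0 N t = f t * (1 - plateau 0 N t) by ring.
have [b0 b1] := andP (plateau01 0 N t).
have [tN|tN] := leP `|t| N; first by rewrite plateau1 ?subr0// subrr mulr0 normr0 ltW.
rewrite normrM (ger0_norm (_ : 0 <= 1 - _)); last by rewrite subr_ge0.
rewrite -[e]mulr1 ler_pM ?subr_ge0 ?gerBl ?vM//.
by rewrite (le_lt_trans (ler_norm _))// (lt_trans _ tN)// ltrDl.
Qed.

Lemma C0_continuous f : C0 f -> continuous f. Proof. by case/C0P. Qed.

Lemma C0_bounded f : C0 f -> exists2 C : R, 0 <= C & forall t, `|f t| <= C.
Proof.
move=> /(_ _ ltr01)[g gc fg]; have [M M0 gM] := Cc_vanish gc.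
have cK : compact (g @` `[- M, M]).
  apply: continuous_compact (@segment_compact R (- M) M).
  by apply: continuous_subspaceT; case: gc.
have [N [_ hN]] := compact_bounded cK.
exists (1 + (`|N| + 1)) => [|t]; first by rewrite !addr_ge0.
have gN : `|g t| <= `|N| + 1.
  have [tM|/gM ->] := leP `|t| M; last by rewrite normr0 addr_ge0.
  apply: (hN (`|N| + 1)); first by rewrite ltr_pwDr// ler_norm.
  by exists t => //=; rewrite in_itv /= -ler_norml.
by rewrite -[f t](subrK (g t)) (le_trans (ler_normD _ _))// lerD.
Qed.

Lemma Cc_C0 f : Cc [set: R] f -> C0 f.
Proof. by move=> fc e e0; exists f => // t; rewrite subrr normr0 ltW. Qed.

Lemma C0_lin a f g : C0 f -> C0 g -> C0 (fun t => a * f t + g t).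
Proof.
move=> /C0P[cf vf] /C0P[cg vg]; apply/C0P; split=> [t|e e0].
  by apply: cvgD; [apply: cvgM; [exact: cvg_cst|exact: cf]|exact: cg].
have e20 : 0 < e / 2 by rewrite divr_gt0.
have [d d0 hd] := small_mul e20 (normr_ge0 a).
have [M hM] := vf _ d0; have [N hN] := vg _ e20.
exists (Num.max M N) => t; rewrite gt_max => /andP[Mt Nt].
rewrite (splitr e) (le_trans (ler_normD _ _))// lerD ?hN// normrM.
by rewrite (le_trans _ hd)// ler_wpM2l// hM.
Qed.

Lemma C0_0 : C0 (fun _ : R => 0).
Proof. by apply/C0P; split=> [t|e e0]; [exact: cvg_cst|exists 0 => t _; rewrite normr0 ltW]. Qed.

Lemma C0D f g : C0 f -> C0 g -> C0 (fun t => f t + g t).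
Proof.
move=> hf hg; have := C0_lin 1 hf hg.
by congr (C0 _); apply/funext => t; rewrite mul1r.
Qed.

Lemma C0Z a f : C0 f -> C0 (fun t => a * f t).
Proof.
move=> hf; have := C0_lin a hf C0_0.
by congr (C0 _); apply/funext => t; rewrite addr0.
Qed.

Lemma C0_mulr f (g : R -> R) (c : R) : C0 f -> continuous g ->
  (forall t, `|g t| <= c) -> C0 (fun t => f t * g t).
Proof.
move=> /C0P[cf vf] cg gc; apply/C0P; split=> [t|e e0].
  by apply: cvgM; [exact: cf|exact: cg].
have c0 : 0 <= c by rewrite (le_trans (normr_ge0 _) (gc 0)).
have [d d0 hd] := small_mul e0 c0; have [M hM] := vf _ d0.
exists M => t Mt; rewrite normrM mulrC (le_trans _ hd)// ler_pM// hM//.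
Qed.

Lemma C0M f g : C0 f -> C0 g -> C0 (fun t => f t * g t).
Proof.
move=> hf hg; have [c _ gc] := C0_bounded hg.
by apply: C0_mulr gc => //; exact: C0_continuous.
Qed.

Lemma C0_decay f (a C : R) : continuous f -> (forall t, `|f t| * `|t - a| <= C) -> C0 f.
Proof.
move=> cf hf; apply/C0P; split=> // e e0.
exists (`|a| + `|C| / e) => t ht.
have h1 : `|C| / e < `|t - a|.
  by rewrite -(ltrD2l `|a|) (lt_le_trans ht)// addrC -{1}[t](subrK a) ler_normD.
have ta : 0 < `|t - a| by rewrite (le_lt_trans _ h1)// divr_ge0// ltW.
rewrite -(ler_pM2r ta) (le_trans (hf t))// (le_trans (ler_norm C))//.
by rewrite mulrC -ler_pdivrMr// ltW.
Qed.

(** Real part, followed by the imaginary part, of [1 / (t - (a + i b))]. *)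
Definition re_res (a b t : R) : R := (t - a) / ((t - a) ^+ 2 + b ^+ 2).
Definition im_res (a b t : R) : R := b / ((t - a) ^+ 2 + b ^+ 2).

Section resolvent_functions.
Context (a b : R) (b0 : b != 0).

Lemma res_den_gt0 (t : R) : 0 < (t - a) ^+ 2 + b ^+ 2.
Proof. by rewrite ltr_wpDl ?sqr_ge0// lt_neqAle eq_sym sqrf_eq0 b0 sqr_ge0. Qed.

Lemma continuous_res_den : continuous (fun t => ((t - a) ^+ 2 + b ^+ 2)^-1).
Proof.
move=> t; apply: cvgV; first by rewrite gt_eqF// res_den_gt0.
apply: cvgD; last exact: cvg_cst.
by apply: cvgM; (apply: cvgB; [exact: cvg_id|exact: cvg_cst]).
Qed.

Lemma C0_re_res : C0 (re_res a b).
Proof.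
apply: (@C0_decay _ a 1) => [t|t].
  apply: cvgM; last exact: continuous_res_den.
  by apply: cvgB; [exact: cvg_id|exact: cvg_cst].
rewrite -normrM /re_res mulrAC -expr2 ger0_norm; last first.
  by rewrite divr_ge0 ?sqr_ge0// ltW// res_den_gt0.
by rewrite ler_pdivrMr ?res_den_gt0// mul1r lerDl sqr_ge0.
Qed.

Lemma C0_im_res : C0 (im_res a b).
Proof.
apply: (@C0_decay _ a 1) => [t|t].
  by apply: cvgM; [exact: cvg_cst|exact: continuous_res_den].
rewrite -normrM /im_res mulrAC normrM (ger0_norm (_ : 0 <= _^-1)); last first.
  by rewrite invr_ge0 ltW// res_den_gt0.
rewrite ler_pdivrMr ?res_den_gt0// mul1r normrM.
rewrite -(real_normK (num_real (t - a))) -(real_normK (num_real b)).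
have := sqr_ge0 (`|b| - `|t - a|); have := sqr_ge0 (`|b| + `|t - a|).
by move: `|b| `|t - a| => x y; nra.
Qed.

End resolvent_functions.
End C0_functions.

(** * Existence of the functional calculus *)

Section calculus_existence.
Context (R : realType) (H : normedModType R) (ip : H -> H -> R).
Hypotheses (ipP : inner_product ip) (cH : cauchy_complete H).
Context (T : H -> H).
Hypotheses (lT : linear T) (sT : forall u v, ip (T u) v = ip u (T v)).
Hypotheses (T0 : forall u, 0 <= ip (T u) u).
Hypotheses (T1 : forall u, ip (T u) u <= `|u| ^+ 2).
Context (V : set H) (A : set (H * H)).
Hypotheses (Vlin : forall a u v, V u -> V v -> V (a *: u + v)).
Hypotheses (Vcl : forall x l, (forall n, V (x n)) -> seqlim x l -> V l).
Hypotheses (TV : forall u, V (T u)).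
Hypotheses (TVp : forall u, (forall v, V v -> ip u v = 0) -> T u = 0).
Hypotheses (TA : forall u, V u -> A (T u, u - T u)).

(** With [T = (A + 1)^-1], the spectral value t of A becomes [s = 1 / (t + 1)], so that [f(A)] is
    [G f] evaluated at T. Infinity corresponds to [s = 0], where [G f] vanishes. *)
Let G (f : R -> R) := pull (@inv_sub1 R) f.

Let GM f : C0 f -> quad_modulus (G f).
Proof. exact: (pull_quad_modulus (@blowup_inv_sub1 R)). Qed.

Let quad_modulus_lin (a : R) f g : quad_modulus f -> quad_modulus g ->
  quad_modulus (fun t : R => a * f t + g t).
Proof.
move=> hf hg e e0; have e20 : 0 < e / 2 by rewrite divr_gt0.
have [d d0 hd] := small_mul e20 (normr_ge0 a).
have [C C0 hC] := hf _ d0; have [D D0 hD] := hg _ e20.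
exists (`|a| * C + D) => [|s t hs ht]; first by rewrite addr_ge0 ?mulr_ge0.
have -> : a * f s + g s - (a * f t + g t) = a * (f s - f t) + (g s - g t) by ring.
rewrite (le_trans (ler_normD _ _))// normrM.
have := hD s t hs ht; have := ler_wpM2l (normr_ge0 a) (hC s t hs ht).
rewrite mulrDr mulrA mulrDl; move: (_ * C * _) (D * _) => x y; lra.
Qed.

Lemma C0_calculus_exists : C0_calculus ip V A (fun f => psi T (G f)).
Proof.
have psi_T h u : quad_modulus h -> psi T (fun s => s * h s) u = T (psi T h u).
  move=> hh; rewrite -(psi_id ipP cH lT sT T0 T1).
  exact: (psi_mul ipP cH lT sT T0 T1 _ (@quad_modulus_id R) hh).
have G0 f : G f 0 = 0 by rewrite /G /pull lexx.
(* Nonzero constants do not belong to [C0], but [psi] is defined on them and yields scalar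
   operators; the resolvent equations need the term [g] itself. *)
have hcst c : quad_modulus (fun _ : R => c : R).
  by move=> e e0; exists 0 => // s t _ _; rewrite subrr normr0 mul0r addr0 ltW.
have psi_cst c u : psi T (fun=> c) u = c *: u.
  apply: seqlim_uniq (psi_limit ipP cH lT sT T0 T1 u (hcst c)) _.
  rewrite (_ : (fun n => _) = fun=> c *: u); first exact: seqlim_cst.
  apply/funext => n; rewrite /bern -scaler_sumr.
  by rewrite sum_bernstein pevalZ peval1.
have psiD (a : R) f g u (hf : quad_modulus f) (hg : quad_modulus g) :=
  psi_lin ipP cH lT sT T0 T1 u hf hg (quad_modulus_lin a hf hg).
split.
- move=> f hf; exact: (psi_linear ipP cH lT sT T0 T1 (GM hf)).
- move=> f c hf fc u; apply: (psi_le ipP cH lT sT T0 T1) => //; first exact: GM.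
    by rewrite (le_trans (normr_ge0 _) (fc 0)).
  move=> s _; rewrite /G /pull; case: ifP => // _.
  by rewrite normr0 (le_trans (normr_ge0 _) (fc 0)).
- move=> f u v hf; exact: (psi_sym ipP cH lT sT T0 T1 u v (GM hf)).
- move=> f u hf; apply: (psi_closed ipP cH lT sT T0 T1 (GM hf) (G0 f)) => //.
- move=> f u hf /TVp; exact: (psi_ker ipP cH lT sT T0 T1 (GM hf) (G0 f)).
- move=> a f g u hf hg; rewrite -(psiD _ _ _ _ (GM hf) (GM hg)).
  apply: psi_eq => s _; rewrite /G /pull; case: ifP => // _; by rewrite mulr0 addr0.
- move=> f g u hf hg; rewrite -(psi_mul ipP cH lT sT T0 T1 _ (GM hf) (GM hg)).
  apply: psi_eq => s _; rewrite /G /pull; case: ifP => // _; by rewrite mulr0.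
move=> a b g b0 Vg.
rewrite -[fun t => (t - a) / _]/(re_res a b) -[fun t => b / _]/(im_res a b).
set r := psi T (G (re_res a b)) g; set q := psi T (G (im_res a b)) g.
have hr := GM (C0_re_res a b0); have hq := GM (C0_im_res a b0).
have Vr : V r by apply: (psi_closed ipP cH lT sT T0 T1 hr (G0 _)).
have Vq : V q by apply: (psi_closed ipP cH lT sT T0 T1 hq (G0 _)).
have V0 : V 0 by rewrite -(addNr r) -scaleN1r; exact: Vlin.
have res_eq (s : R) : 0 <= s -> s <= 0 \/
    exists x : R, [/\ s = x^-1, x != 0 & (x - 1 - a) ^+ 2 + b ^+ 2 != 0].
  rewrite le_eqVlt => /orP[/eqP <-|s0]; [by left|right].
  by exists s^-1; rewrite invrK invr_eq0 !gt_eqF// res_den_gt0.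
(* In the variable [s = 1 / (t + 1)], the equation [(t - a) r + b q = 1] reads
   [r = s (1 + (a + 1) r - b q)]. *)
have rE : r = T (g + (a + 1) *: r - b *: q).
  have hd := quad_modulus_lin (a + 1) hr (hcst 1).
  have -> : g + (a + 1) *: r - b *: q =
      psi T (fun s => - b * G (im_res a b) s + ((a + 1) * G (re_res a b) s + 1)) g.
    by rewrite psiD// psiD// psi_cst scale1r scaleNr addrC [g + _]addrC.
  rewrite -psi_T//; last exact: quad_modulus_lin.
  apply: psi_eq => s /andP[s0 _]; rewrite /G /pull; case: ifPn => s0'.
    by rewrite (@le_anti _ _ s 0) ?mul0r// s0 s0'.
  have [|[x [-> x0 D0]]] := res_eq _ s0; first by rewrite (negPf s0').
  by rewrite /re_res /im_res /inv_sub1 invrK; field; rewrite x0 D0.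
(* Likewise [(t - a) q = b r] becomes [q = s (b r + (a + 1) q)]. *)
have qE : q = T (b *: r + (a + 1) *: q).
  have hd := quad_modulus_lin b hr (hcst 0).
  have -> : b *: r + (a + 1) *: q =
      psi T (fun s => (a + 1) * G (im_res a b) s + (b * G (re_res a b) s + 0)) g.
    by rewrite psiD// psiD// psi_cst scale0r addr0 addrC.
  rewrite -psi_T//; last exact: quad_modulus_lin.
  apply: psi_eq => s /andP[s0 _]; rewrite /G /pull; case: ifPn => s0'.
    by rewrite (@le_anti _ _ s 0) ?mul0r// s0 s0'.
  have [|[x [-> x0 D0]]] := res_eq _ s0; first by rewrite (negPf s0').
  by rewrite /re_res /im_res /inv_sub1 invrK; field; rewrite x0 D0.
have VD u v : V u -> V v -> V (u + v) by move=> hu hv; rewrite -[u]scale1r; exact: Vlin.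
have VZ c u : V u -> V (c *: u) by move=> hu; rewrite -[_ *: _]addr0; exact: Vlin.
(* [TA] at the arguments of T in [rE] and [qE]: subtracting the value of T lowers the coefficient
   [a + 1] to [a]. *)
split.
  have := TA (VD _ _ (VD _ _ Vg (VZ (a + 1) _ Vr)) (VZ (- b) _ Vq)).
  rewrite scaleNr -rE; congr (A (_, _)).
  by rewrite addrAC scalerDl scale1r addrA addrK.
have := TA (VD _ _ (VZ b _ Vr) (VZ (a + 1) _ Vq)).
by rewrite -qE scalerDl scale1r addrA addrK.
Qed.

End calculus_existence.

(** * Totally bounded operators *)

Section totally_bounded_operators.
Import finmap.
Context (R : realType) (H : normedModType R).
Implicit Types (K L : H -> H).

(* The unit ball is cut into finitely many pieces (the fibres of [c]) whose
   images are small: the image of the ball is totally bounded. *)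
Definition tb_operator K := forall e : R, 0 < e ->
  exists (I : finType) (c : H -> I), forall u v,
    `|u| <= 1 -> `|v| <= 1 -> c u = c v -> `|K u - K v| <= e.

(** Finitely many balls of radius [e / 2] cover the closure of the image; a vector is sent to the
    index of the first ball that contains its image. *)
Lemma compact_tb_operator K : compact_operator K -> tb_operator K.
Proof.
move=> [_]; rewrite precompactE compact_cover => cK e e0.
have e20 : 0 < e / 2 by rewrite divr_gt0.
set S := (X in closure X) in cK.
have [D' D'S hD'] := cK H S (fun x => ball x (e / 2)) (fun x _ => ball_open x _)
  (fun y Sy => let: ex_intro x (conj Sx yx) := Sy _ (nbhsx_ballx y _ e20) in
     ex_intro2 _ _ x Sx (ball_sym yx)).
pose s : seq H := enum_fset D'.
exists 'I_(size s).+1, (fun u => inord (find (fun x => `[< ball x (e / 2) (K u) >]) s)).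
move=> u v u1 v1.
have hfind w : `|w| <= 1 -> (find (fun x => `[< ball x (e / 2) (K w) >]) s < size s)%N.
  move=> w1; rewrite -has_find.
  have [x /= xD xw] : cover [set` D'] (fun x => ball x (e / 2)) (K w).
    by apply/hD'/subset_closure; exists w.
  by apply/hasP; exists x => //; apply/asboolP.
move=> /(congr1 val); rewrite /= !inordK ?ltnS; try exact/ltnW/hfind.
move=> uv.
have hn w : `|w| <= 1 -> ball (nth 0 s (find (fun x => `[< ball x (e / 2) (K w) >]) s)) (e / 2) (K w).
  move=> /hfind; rewrite -has_find => hw; apply/asboolP.
  exact: (nth_find 0 hw).
have := hn v v1; have := hn u u1; rewrite uv; set x := nth _ _ _ => xu xv.
have := ball_triangle (ball_sym xu) xv; rewrite -splitr -ball_normE /= => h.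
by rewrite ltW.
Qed.

(** An ultrafilter on the closure of the image must contain one of finitely many small balls, at
    every scale. The centres of those of radius [1 / (n + 1)] form a Cauchy sequence, whose limit is
    the limit of the ultrafilter. *)
Lemma tb_compact_operator K : cauchy_complete H -> linear K -> tb_operator K ->
  compact_operator K.
Proof.
move=> cH lK tK; split => //; rewrite precompactE compact_ultra => F FU FS.
set S := (X in closure X) in FS *.
have FF : ProperFilter F by exact: ultra_proper.
have FI B C : F B -> F C -> exists y, B y /\ C y.
  by move=> FB FC; exact: (@filter_ex _ F FF _ (@filterI _ F FF _ _ FB FC)).
have small (e : R) : 0 < e -> exists x, F [set y | `|y - x| <= e].
  move=> e0; have e20 : 0 < e / 2 by rewrite divr_gt0.
  (* One representative per piece serves as centre; the default 0 is met only on empty pieces. *)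
  have [I [c hc]] := tK _ e20.
  pose rep i := xget 0 [set u | `|u| <= 1 /\ c u = i].
  apply: contrapT => /forallNP nF.
  have nF' i : F (~` [set y | `|y - K (rep i)| <= e]).
    by case: (in_ultra_setVsetC [set y | `|y - K (rep i)| <= e] FU) => // /nF.
  have /filter_ex[y [yS hy]] : F (closure S `&` [set y | forall i, ~ `|y - K (rep i)| <= e]).
    by apply: filterI => //; exact: filter_forall.
  have [_ [[u u1 <-]]] := yS _ (nbhsx_ballx y _ e20).
  rewrite -ball_normE /= => yu; apply: (hy (c u)).
  have [r1 rc] : `|rep (c u)| <= 1 /\ c (rep (c u)) = c u.
    by apply: (@xgetPex _ 0 [set v | `|v| <= 1 /\ c v = c u]); exists u.
  rewrite -(subrKA (K u)) (splitr e) (le_trans (ler_normD _ _))// lerD//; first exact: ltW.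
  exact: hc.
have /choice[x hx] n : exists x, F [set y | `|y - x| <= n.+1%:R^-1].
  by apply: small; rewrite invr_gt0 ltr0n.
have [|l hl] := cH x.
  move=> e e0; have e20 : 0 < e / 2 by rewrite divr_gt0.
  have [N hN] := exists_inv_lt e20; exists N => i j iN jN.
  have [y [/= yi yj]] := FI _ _ (hx i) (hx j).
  rewrite -(subrKA y) (splitr e) (le_trans (ler_normD _ _))// lerD//.
    by rewrite distrC (le_trans yi)// hN.
  by rewrite (le_trans yj)// hN.
have Fl : F --> l.
  move=> A /nbhs_ballP[e /= e0 lA]; apply: filterS lA _.
  have e40 : 0 < e / 4 by rewrite divr_gt0.
  have [N hN] := exists_inv_lt e40; have [M hM] := hl _ e40.
  apply: filterS (hx (maxn N M)) => y /= hy; rewrite -ball_normE /=.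
  rewrite distrC -(subrKA (x (maxn N M))) (le_lt_trans (ler_normD _ _))//.
  apply: le_lt_trans (lerD (le_trans hy (hN _ (leq_maxl N M))) (hM _ (leq_maxr N M))) _.
  lra.
exists l; split => //.
have /closure_id -> : closed (closure S) by exact: closed_closure.
move=> B /Fl FB; by have [y []] := FI _ _ FS FB; exists y.
Qed.

(** The square on the left allows a comparison of quadratic forms, [|K w|^2 <= <L w, w>], to carry
    compactness from [L] to [K]. *)
Lemma tb_operator_dom K L (C : R) : 0 <= C ->
  (forall u v, `|u| <= 1 -> `|v| <= 1 -> `|K u - K v| ^+ 2 <= C * `|L u - L v|) ->
  tb_operator L -> tb_operator K.
Proof.
move=> C0 h tL e e0; have [d d0 hd] := small_mul (exprn_gt0 2 e0) C0.
have [I [c hc]] := tL _ d0; exists I, c => u v u1 v1 uv.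
rewrite -(@ler_pXn2r _ 2)// ?nnegrE ?(ltW e0)// (le_trans (h _ _ u1 v1))// (le_trans _ hd)//.
by rewrite ler_wpM2l// hc.
Qed.

Lemma tb_operator_lipschitz K L (C : R) : 0 <= C ->
  (forall u v, `|K u - K v| <= C * `|L u - L v|) -> tb_operator L -> tb_operator K.
Proof.
move=> C0 h tL e e0; have [d d0 hd] := small_mul e0 C0.
have [I [c hc]] := tL _ d0; exists I, c => u v u1 v1 uv.
by rewrite (le_trans (h _ _))// (le_trans _ hd)// ler_wpM2l// hc.
Qed.

Lemma tb_operatorD K L : tb_operator K -> tb_operator L ->
  tb_operator (fun u => K u + L u).
Proof.
move=> tK tL e e0; have e20 : 0 < e / 2 by rewrite divr_gt0.
have [I [c hc]] := tK _ e20; have [J [d hd]] := tL _ e20.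
exists (I * J)%type, (fun u => (c u, d u)) => u v u1 v1 [uv uv'].
by rewrite opprD addrACA (splitr e) (le_trans (ler_normD _ _))// lerD ?hc ?hd.
Qed.

Lemma tb_operator0 : tb_operator (fun=> 0).
Proof. by move=> e e0; exists unit, (fun=> tt) => *; rewrite subrr normr0 ltW. Qed.

Lemma tb_operatorZ a K : tb_operator K -> tb_operator (fun u => a *: K u).
Proof.
apply: (@tb_operator_lipschitz _ _ `|a|) => // u v.
by rewrite -scalerBr normrZ.
Qed.

Lemma tb_operatorB K L : tb_operator K -> tb_operator L ->
  tb_operator (fun u => K u - L u).
Proof.
move=> tK tL; have := tb_operatorD tK (tb_operatorZ (- 1) tL).
by congr tb_operator; apply/funext => u; rewrite scaleN1r.
Qed.

Lemma tb_operator_sum (J : Type) (s : seq J) (K : J -> H -> H) :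
  (forall j, tb_operator (K j)) -> tb_operator (fun u => \sum_(j <- s) K j u).
Proof.
move=> tK; elim: s => [|j s IH].
  by under eq_fun do rewrite big_nil; exact: tb_operator0.
by under eq_fun do rewrite big_cons; exact: tb_operatorD.
Qed.

Lemma tb_operator_compl K L (C : R) : linear L -> 0 <= C ->
  (forall u, `|L u| <= C * `|u|) -> tb_operator K -> tb_operator (L \o K).
Proof.
move=> lL C0 hC; apply: (@tb_operator_lipschitz _ _ C) => // u v.
by rewrite /= -(linB lL) hC.
Qed.

Lemma tb_operator_compr K L (C : R) : linear K -> 0 <= C ->
  (forall u, `|L u| <= C * `|u|) -> tb_operator K -> tb_operator (K \o L).
Proof.
move=> lK C0 hC tK e e0.
have C10 : 0 < C + 1 by rewrite ltr_wpDl.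
have [d d0 hd] := small_mul e0 (ltW C10).
have [I [c hc]] := tK _ d0.
have Ci : 0 <= (C + 1)^-1 by rewrite invr_ge0 ltW.
have b1 u : `|u| <= 1 -> `|(C + 1)^-1 *: L u| <= 1.
  move=> u1; rewrite normrZ (ger0_norm Ci) mulrC ler_pdivrMr// mul1r.
  by rewrite (le_trans (hC u))// ler_wpDr// ler_piMr.
exists I, (fun u => c ((C + 1)^-1 *: L u)) => u v /b1 u1 /b1 v1 uv /=.
have := hc _ _ u1 v1 uv; rewrite !(linZ lK) -scalerBr normrZ.
rewrite (ger0_norm Ci) mulrC ler_pdivrMr// => h.
by rewrite (le_trans h)// mulrC.
Qed.

Lemma tb_operator_approx K :
  (forall e : R, 0 < e -> exists2 L, tb_operator L &
     forall u, `|u| <= 1 -> `|K u - L u| <= e) -> tb_operator K.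
Proof.
move=> h e e0; have e30 : 0 < e / 3 by rewrite divr_gt0.
have [L tL KL] := h _ e30; have [I [c hc]] := tL _ e30.
exists I, c => u v u1 v1 uv.
have -> : K u - K v = (K u - L u) + (L u - L v) - (K v - L v).
  by rewrite addrA subrK opprB addrA subrK.
have := hc _ _ u1 v1 uv; have := KL u u1; have := KL v v1.
have := ler_normB ((K u - L u) + (L u - L v)) (K v - L v).
have := ler_normD (K u - L u) (L u - L v).
lra.
Qed.

End totally_bounded_operators.

(** * Orthonormal families and finite rank *)

Section orthonormal_families.
Context (R : realType) (H : normedModType R) (ip : H -> H -> R).
Hypothesis ipP : inner_product ip.

Definition orthonormal_family n (e : 'I_n -> H) := forall i j, ip (e i) (e j) = (i == j)%:R.

Lemma orthonormal_norm n (e : 'I_n -> H) i : orthonormal_family e -> `|e i| = 1.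
Proof.
move=> /(_ i i); rewrite (ipE ipP) eqxx => /eqP; rewrite sqrf_eq1 => /orP[/eqP//|/eqP h].
by have := normr_ge0 (e i); rewrite h oppr_ge0 ler10.
Qed.

(** Distinct orthonormal vectors are at distance [sqrt 2 > 1]. Fixed by [K], they must lie in
    different pieces of the partition for [e = 1]. *)
Lemma tb_operator_orthonormal (K : H -> H) : tb_operator K ->
  exists M, forall n (e : 'I_n -> H), orthonormal_family e -> (forall i, K (e i) = e i) ->
    (n <= M)%N.
Proof.
move=> /(_ _ ltr01)[I [c hc]]; exists #|I| => n e oe Ke.
rewrite -[n]card_ord; apply: (leq_card (c \o e)) => i j /= ij.
apply: contrapT => /eqP nij.
have := hc (e i) (e j); rewrite !Ke !(orthonormal_norm _ oe) => /(_ (lexx _) (lexx _) ij).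
rewrite -(@ler_pXn2r _ 2)// ?nnegrE// expr1n (normB_sqr ipP) oe (negPf nij).
rewrite !(orthonormal_norm _ oe) mulr0 subr0 expr1n; lra.
Qed.

Lemma orthonormal_extend n (e : 'I_n -> H) u : orthonormal_family e ->
  (forall i, ip u (e i) = 0) -> `|u| = 1 ->
  orthonormal_family (fun i : 'I_n.+1 => if unlift ord_max i is Some j then e j else u).
Proof.
move=> oe ue u1 i j.
case: unliftP => [i' ->|->]; case: unliftP => [j' ->|->].
- by rewrite oe (inj_eq (@lift_inj _ _)).
- by rewrite (ipC ipP) ue eq_sym (negPf (neq_lift _ _)).
- by rewrite ue (negPf (neq_lift _ _)).
- by rewrite (ipE ipP) u1 expr1n eqxx.
Qed.

(** The bound provides an orthonormal family of maximal length in [N]; a nonzero remainder of the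
    expansion, once normalized, would extend it. *)
Lemma orthonormal_spanning (N : set H) M :
  (forall a u v, N u -> N v -> N (a *: u + v)) ->
  (forall n (e : 'I_n -> H), orthonormal_family e -> (forall i, N (e i)) -> (n <= M)%N) ->
  exists n (e : 'I_n -> H), [/\ orthonormal_family e, forall i, N (e i) &
    forall u, N u -> u = \sum_(i < n) ip u (e i) *: e i].
Proof.
move=> Nlin hM.
pose Q n := `[< exists e : 'I_n -> H, orthonormal_family e /\ forall i, N (e i) >].
have Q0 : exists n, Q n by exists 0%N; apply/asboolP; exists (fun=> 0); split=> -[].
have QM n : Q n -> (n <= M)%N by move=> /asboolP[e [oe Ne]]; exact: hM oe Ne.
have [n /asboolP[e [oe Ne]] nmax] := ex_maxnP Q0 QM.
exists n, e; split => // u Nu.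
set w := \sum_(i < n) _; apply/eqP; rewrite -subr_eq0; apply/eqP; apply: contrapT => /eqP uw.
have wn0 : 0 < `|u - w| by rewrite normr_gt0.
have N0 : N 0 by rewrite -(addNr u) -scaleN1r; exact: Nlin.
have Nw : N w.
  rewrite /w; elim/big_ind: _ => // [x y Nx Ny|i _]; first by rewrite -[x]scale1r; exact: Nlin.
  by rewrite -[_ *: _]addr0; exact: Nlin.
pose z := `|u - w|^-1 *: (u - w).
suff /nmax : Q n.+1 by rewrite ltnn.
apply/asboolP; exists (fun i : 'I_n.+1 => if unlift ord_max i is Some j then e j else z).
split; last first.
  move=> i; case: unlift => [j|]; first exact: Ne.
  rewrite /z -[_ *: _]addr0; apply: (Nlin) => //.
  by rewrite addrC -scaleN1r; exact: Nlin.
apply: orthonormal_extend => // [i|].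
  suff -> : ip z (e i) = `|u - w|^-1 * (ip u (e i) - ip w (e i)).
    rewrite [ip w _](ip_suml ipP) (bigD1 i)//= (ipZl ipP) oe eqxx mulr1.
    rewrite big1 ?addr0 ?subrr ?mulr0// => j ji.
    by rewrite (ipZl ipP) oe (negPf ji) mulr0.
  by rewrite (ipZl ipP) (ipBl ipP).
by rewrite /z normrZ normfV normr_id mulVf// gt_eqF.
Qed.

(** With [C] the coordinates of the family and [G] the Gram matrix of the spanning vectors,
    [C G C^T = 1]; the identity thus factors through dimension [m]. *)
Lemma finite_dim_orthonormal (N : set H) : finite_dim N ->
  exists M, forall n (e : 'I_n -> H), orthonormal_family e -> (forall i, N (e i)) -> (n <= M)%N.
Proof.
move=> [m [b hb]]; exists m => n e oe Ne.
have /choice[c hc] i : exists c : 'I_m -> R, e i = \sum_(j < m) c j *: b j by exact: hb.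
pose C := \matrix_(i < n, j < m) c i j.
pose G := \matrix_(i < m, j < m) ip (b i) (b j).
have : C *m G *m C^T = 1%:M.
  apply/matrixP => i j; rewrite !mxE -oe [in RHS]hc [in RHS](hc j) (ip_suml ipP).
  under [RHS]eq_bigr do rewrite (ip_sumr ipP).
  rewrite exchange_big /=; apply: eq_bigr => k _.
  rewrite !mxE mulr_suml; apply: eq_bigr => l _.
  by rewrite !mxE (ipZl ipP) (ipZr ipP) mulrAC mulrA.
move=> /(congr1 mxrank); rewrite mxrank1 => <-.
by rewrite -mulmxA (leq_trans (mxrankM_maxl _ _))// rank_leq_col.
Qed.

Lemma finite_rank_tb_operator n (e : 'I_n -> H) (K : H -> H) (C : R) : linear K -> 0 <= C ->
  (forall u, `|K u| <= C * `|u|) -> orthonormal_family e ->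
  (forall u, K u = \sum_(i < n) ip (K u) (e i) *: e i) -> tb_operator K.
Proof.
move=> lK C0 KC oe Ke.
have -> : K = fun u => \sum_(i < n) ip (K u) (e i) *: e i by apply/funext.
apply: tb_operator_sum => i d d0.
have hb u : `|u| <= 1 -> `|ip (K u) (e i)| <= C.
  move=> u1; rewrite (le_trans (cauchy_schwarz ipP _ _))// (orthonormal_norm _ oe) mulr1.
  by rewrite (le_trans (KC u))// ler_piMr.
(* Shifting by [C] makes the coordinate nonnegative, and the integer part of [x u] is the number of
   its cell of width [d]. *)
pose x u := (ip (K u) (e i) + C) / d.
have x0 u : `|u| <= 1 -> 0 <= x u.
  move=> /hb; rewrite ler_norml => /andP[h _].
  by rewrite /x divr_ge0 ?(ltW d0)// -lerBlDr sub0r.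
have xC u : `|u| <= 1 -> (Num.truncn (x u) < (Num.truncn (2 * C / d)).+1)%N.
  move=> u1; rewrite ltnS; apply: le_truncn.
  rewrite ler_pM2r ?invr_gt0//; have := le_trans (ler_norm _) (hb u u1); lra.
exists 'I_(Num.truncn (2 * C / d)).+1, (fun u => inord (Num.truncn (x u))).
move=> u v u1 v1 /(congr1 val) /=; rewrite !inordK ?xC// => uv.
rewrite -scalerBl normrZ (orthonormal_norm _ oe) mulr1.
have -> : ip (K u) (e i) - ip (K v) (e i) = (x u - x v) * d.
  by rewrite /x; field; rewrite gt_eqF.
rewrite normrM (gtr0_norm d0) -[leRHS]mul1r ler_wpM2r ?(ltW d0)//.
have /andP[h1 h2] := truncn_itv (x0 u u1); have /andP[h3 h4] := truncn_itv (x0 v v1).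
rewrite uv in h1 h2; rewrite ler_norml; move: h1 h2 h3 h4; rewrite -natr1.
move: (_%:R) => y *; apply/andP; split; lra.
Qed.

End orthonormal_families.

(** * The functional calculus and the essential spectrum *)

Section ramp.
Context (R : realType).

Definition ramp (s d t : R) : R := Num.max 0 (Num.min 1 ((t - s) / d)).

Lemma ramp01 s d t : 0 <= ramp s d t <= 1.
Proof. by rewrite /ramp le_max lexx /= ge_max ler01 ge_min lexx. Qed.

Lemma ramp0 s d t : 0 < d -> t <= s -> ramp s d t = 0.
Proof.
move=> d0 h; rewrite /ramp max_l// ge_min; apply/orP; right.
by rewrite pmulr_lle0 ?invr_gt0// subr_le0.
Qed.

Lemma ramp1 s d t : 0 < d -> s + d <= t -> ramp s d t = 1.
Proof.
move=> d0 h; rewrite /ramp min_l ?max_r//.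
by rewrite ler_pdivlMr// mul1r lerBrDl.
Qed.

Lemma continuous_ramp s d : continuous (ramp s d).
Proof.
move=> t.
apply: (@continuous_max R _ (fun=> 0) (fun t => Num.min 1 ((t - s) / d))).
  exact: cvg_cst.
apply: (@continuous_min R _ (fun=> 1) (fun t => (t - s) / d)); first exact: cvg_cst.
apply: cvgM; last exact: cvg_cst.
by apply: cvgB; [exact: cvg_id|exact: cvg_cst].
Qed.

Lemma C0_plateau (w d : R) : 0 < d -> C0 (plateau w d).
Proof.
move=> d0; apply/Cc_C0/(CcP (M := `|w| + 2 * d)); first exact: continuous_plateau.
move=> t ht; rewrite plateau0//.
have := ler_normD (t - w) w; rewrite subrK; lra.
Qed.

Lemma plateau_neq0 (w d t : R) : 0 < d -> plateau w d t != 0 -> `|t - w| <= 2 * d.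
Proof.
move=> d0; apply: contra_neqT; rewrite -ltNge => /ltW; exact: plateau0.
Qed.

Lemma C0_mul_id (f : R -> R) (w M : R) : C0 f ->
  (forall t, f t != 0 -> `|t - w| <= M) -> C0 (fun t => t * f t).
Proof.
move=> f0 fM; apply/Cc_C0/(CcP (M := `|w| + M)) => [t|t ht].
  by apply: cvgM; [exact: cvg_id|exact: C0_continuous].
have [->|/fM h] := eqVneq (f t) 0; first by rewrite mulr0.
have := ler_normD (t - w) w; rewrite subrK; lra.
Qed.

Lemma C0_ramp (f : R -> R) s d : C0 f -> C0 (fun t => f t * ramp s d t).
Proof.
move=> hf; apply: (C0_mulr (c := 1) hf (@continuous_ramp s d)) => t.
by have /andP[h1 h2] := ramp01 s d t; rewrite ger0_norm.
Qed.

Lemma C0_1plateau (f : R -> R) w d : C0 f -> C0 (fun t => f t * (1 - plateau w d t)).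
Proof.
move=> hf; apply: (C0_mulr (c := 1) hf) => t.
  by apply: cvgB; [exact: cvg_cst|exact: continuous_plateau].
have /andP[h1 h2] := plateau01 w d t; rewrite ger0_norm; lra.
Qed.

Lemma C0_1ramp (f : R -> R) s d : C0 f -> C0 (fun t => f t * (1 - ramp s d t)).
Proof.
move=> hf; apply: (C0_mulr (c := 1) hf) => t.
  by apply: cvgB; [exact: cvg_cst|exact: continuous_ramp].
have /andP[h1 h2] := ramp01 s d t; rewrite ger0_norm; lra.
Qed.

(* Inverts [t - w] away from [w]; at [t = w] the division by 0 gives 0. *)
Definition slope_inv (k : R -> R) (w t : R) : R := (1 - k t) / (t - w).

Lemma C0_slope_inv (k : R -> R) (w d : R) : C0 k -> 0 < d ->
  (forall t, `|t - w| <= d -> k t = 1) -> C0 (slope_inv k w).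
Proof.
move=> k0 d0 k1; have [C C_ge0 kC] := C0_bounded k0.
apply: (@C0_decay _ _ w (1 + C)) => [t|t].
  have [->|tw] := eqVneq t w.
    rewrite /continuous_at /slope_inv subrr invr0 mulr0; apply: cvg_near_cst.
    apply/nbhs_ballP; exists d => //= s /=; rewrite distrC => /ltW/k1 ->.
    by rewrite subrr mul0r.
  apply: cvgM.
    by apply: cvgB; [exact: cvg_cst|exact: C0_continuous].
  apply: cvgV; first by rewrite subr_eq0.
  by apply: cvgB; [exact: cvg_id|exact: cvg_cst].
rewrite -normrM /slope_inv; have [->|tw] := eqVneq t w.
  by rewrite subrr mulr0 normr0 addr_ge0.
by rewrite divfK ?subr_eq0// (le_trans (ler_normB _ _))// normr1 lerD2l.
Qed.

End ramp.

(** * What the calculus says about the spectrum *)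

Section calculus.
Context (R : realType) (H : normedModType R) (ip : H -> H -> R).
Hypothesis ipP : inner_product ip.
Context (V : set H) (A : set (H * H)) (Phi : (R -> R) -> H -> H).
Hypothesis calc : C0_calculus ip V A Phi.
Hypothesis Vlin : forall a u v, V u -> V v -> V (a *: u + v).
Hypothesis AV : forall u v, A (u, v) -> V u /\ V v.
Hypothesis Alin : forall a u v u' v', A (u, v) -> A (u', v') ->
  A (a *: u + u', a *: v + v').
Hypothesis Asym : forall u v u' v', A (u, v) -> A (u', v') -> ip v u' = ip u v'.
Implicit Types (f g h : R -> R) (u v x y : H).

Let re := re_res (0 : R) 1.
Let im := im_res (0 : R) 1.
Let re0 : C0 re. Proof. by apply: C0_re_res; rewrite oner_eq0. Qed.
Let im0 : C0 im. Proof. by apply: C0_im_res; rewrite oner_eq0. Qed.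

Let PhiL f : C0 f -> linear (Phi f). Proof. exact: calc_linear calc f. Qed.

Lemma calc_ext f g x : f =1 g -> Phi f x = Phi g x.
Proof. by move=> /funext ->. Qed.

Lemma calcM f g x : C0 f -> C0 g -> Phi f (Phi g x) = Phi (fun t => f t * g t) x.
Proof. by move=> hf hg; rewrite (calc_mul calc). Qed.

Lemma calcZ a f x : C0 f -> Phi (fun t => a * f t) x = a *: Phi f x.
Proof.
move=> hf; have := calc_lin calc a x hf (@C0_0 R).
have -> : Phi (fun=> 0) x = 0.
  apply/normr0_eq0/eqP; rewrite eq_le normr_ge0 andbT.
  have /(_ x) : forall u, `|Phi (fun=> 0) u| <= 0 * `|u|.
    by apply: (calc_contr calc (@C0_0 R)) => t; rewrite normr0.
  by rewrite mul0r.
by rewrite addr0 => <-; apply: calc_ext => t; rewrite addr0.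
Qed.

Lemma calcD f g x : C0 f -> C0 g -> Phi (fun t => f t + g t) x = Phi f x + Phi g x.
Proof.
move=> hf hg; have := calc_lin calc 1 x hf hg; rewrite scale1r => <-.
by apply: calc_ext => t; rewrite mul1r.
Qed.

Lemma calcB f g x : C0 f -> C0 g -> Phi (fun t => f t - g t) x = Phi f x - Phi g x.
Proof.
move=> hf hg; have := calc_lin calc (- 1) x hg hf; rewrite scaleN1r addrC => <-.
by apply: calc_ext => t; rewrite mulN1r addrC.
Qed.

Lemma calc0 f x : (forall t, f t = 0) -> Phi f x = 0.
Proof.
move=> f0; have -> : f = fun t => 0 * 0 by apply/funext => t; rewrite f0 mul0r.
by rewrite (calcZ _ _ (@C0_0 R)) scale0r.
Qed.

Lemma calc_resolvent_i x : V x ->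
  A (Phi re x, x - Phi im x) /\ A (Phi im x, Phi re x).
Proof.
move=> Vx; have := calc_resolvent calc 0 (b := 1) (oner_neq0 _) Vx.
by rewrite -/(re_res 0 1) -/(im_res 0 1) /= !scale0r !scale1r !addr0.
Qed.

(* [f] and [c + h] represent the values [f] and [t f] of the calculus. *)
Lemma calc_graph f h c x : C0 f -> C0 h -> (forall t, t * f t = c + h t) ->
  V x -> A (Phi f x, c *: x + Phi h x).
Proof.
move=> f0 h0 fh Vx.
have den t : t ^+ 2 + 1 != 0 :> R by rewrite gt_eqF// ltr_wpDl ?sqr_ge0.
have Vf : V (Phi f x) by exact: calc_range calc _ _ f0.
have Vh : V (Phi h x) by exact: calc_range calc _ _ h0.
have [Ax1 _] := calc_resolvent_i Vx.
have [_ Af2] := calc_resolvent_i Vf.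
have [Ah1 _] := calc_resolvent_i Vh.
have imf := C0M im0 f0; have reh := C0M re0 h0; have ref := C0M re0 f0; have imh := C0M im0 h0.
(* From [re t * t + im t = 1]: multiply by [f t] and insert [t * f t = c + h t]. Each of the three
   terms lies in the range of [re] or [im], where the action of A is known. *)
have -> : Phi f x = c *: Phi re x + (1 *: Phi im (Phi f x) + Phi re (Phi h x)).
  rewrite scale1r !calcM// -calcD// -(calc_lin calc)//; last exact: C0D.
  apply: calc_ext => t; rewrite /re /im /re_res /im_res subr0 expr1n.
  have -> : h t = t * f t - c by rewrite fh addrAC subrr add0r.
  by field; rewrite den.
have -> : c *: x + Phi h x =
    c *: (x - Phi im x) + (1 *: Phi re (Phi f x) + (Phi h x - Phi im (Phi h x))).
  suff : Phi (fun t => c * im t + (im t * h t - re t * f t)) x = 0.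
    rewrite (calc_lin calc)//; last first.
      have := C0_lin (- 1) ref imh; congr (C0 _); apply/funext => t; by rewrite mulN1r addrC.
    rewrite (calcB _ imh ref) -(calcM x im0 h0) -(calcM x re0 f0) => /eqP.
    rewrite addr_eq0 opprB => /eqP e; rewrite scalerBr e scale1r opprB -addrA.
    by congr (_ + _); rewrite addrA subrK addrC subrK.
  apply: calc0 => t; rewrite /re /im /re_res /im_res subr0 expr1n.
  have -> : h t = t * f t - c by rewrite fh addrAC subrr add0r.
  by field; rewrite den.
exact: Alin Ax1 (Alin 1 Af2 Ah1).
Qed.

(** The difference [d] of the two sides is orthogonal to itself: [Phi f] moves onto [d], and the
    symmetry of [A] is applied to [(u, v)] and the graph point over [Phi f d]. *)
Lemma calc_graph_sym f h c u v : C0 f -> C0 h -> (forall t, t * f t = c + h t) ->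
  A (u, v) -> Phi f v = c *: u + Phi h u.
Proof.
move=> f0 h0 fh Auv; have [Vu Vv] := AV Auv.
have Vf : V (Phi f v) by exact: calc_range calc _ _ f0.
have Vh : V (Phi h u) by exact: calc_range calc _ _ h0.
apply/eqP; rewrite -subr_eq0; apply/eqP; set d := _ - _.
have Vd : V d.
  rewrite /d addrC -scaleN1r; apply: Vlin => //; exact: Vlin.
apply/normr0_eq0/eqP; rewrite -sqrf_eq0 -(ipE ipP) {1}/d (ipBl ipP) (ipDl ipP) (ipZl ipP).
rewrite (calc_sym calc)// (Asym Auv (calc_graph f0 h0 fh Vd)) (ipDr ipP) (ipZr ipP).
by rewrite (calc_sym calc _ _ h0) subrr.
Qed.

Lemma calc_range_mul f g x : C0 f -> C0 g -> (forall t, f t != 0 -> g t = 1) ->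
  Phi f x = Phi g (Phi f x).
Proof.
move=> f0 g0 fg; rewrite calcM//; apply: calc_ext => t.
by have [->|/fg ->] := eqVneq (f t) 0; rewrite ?mulr0 ?mul1r.
Qed.

(* On the range of functions supported within distance [d] of [w], the
   operator minus [w] has norm at most [2 d]. *)
Lemma calc_vanish_near w : resolvent_set V A w ->
  exists2 d : R, 0 < d & forall f, C0 f -> (forall t, f t != 0 -> `|t - w| <= d) ->
    forall x, Phi f x = 0.
Proof.
move=> [_ [c hc]].
(* The factor 4 makes [2 |c| d] at most 1/2, so that [|y| <= |y| / 2] at the end. *)
have c0 : 0 <= `|c| *+ 4 by rewrite mulrn_wge0.
have [d d0 hd] := small_mul ltr01 c0.
exists d => // f f0 fd x; set y := Phi f x.
have Vy : V y by exact: calc_range calc _ _ f0.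
pose k := plateau w d; have k0 : C0 k by exact: C0_plateau.
have yk : y = Phi k y by apply: calc_range_mul => // t /fd; exact: plateau1.
have tk0 : C0 (fun t => t * k t) by exact: C0_mul_id k0 (fun t => plateau_neq0 d0).
have := calc_graph k0 tk0 (c := 0) (fun t => esym (add0r _)) Vy.
rewrite scale0r add0r -yk => /hc /=.
have -> : Phi (fun t => t * k t) y - w *: y = Phi (fun t => t * k t - w * k t) y.
  by rewrite calcB ?calcZ -?yk//; exact: C0Z.
move=> h; apply/eqP; rewrite -normr_le0.
have twk : C0 (fun t => t * k t - w * k t).
  have := C0_lin (- w) k0 tk0; congr (C0 _); apply/funext => t; by rewrite mulNr addrC.
have /(_ y) h2 : forall u, `|Phi (fun t => t * k t - w * k t) u| <= (2 * d) * `|u|.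
  apply: (calc_contr calc twk) => t; rewrite -mulrBl normrM.
  have /andP[k_ge0 k1] := plateau01 w d t; rewrite (ger0_norm k_ge0).
  have [->|/(plateau_neq0 d0) h3] := eqVneq (plateau w d t) 0; first by rewrite mulr0 mulr_ge0// ltW.
  by rewrite -[leRHS]mulr1 ler_pM.
have h4 : `|y| <= `|c| * (2 * d * `|y|).
  rewrite (le_trans h)// (@le_trans _ _ (`|c| * `|Phi (fun t => t * k t - w * k t) y|))//.
    by rewrite ler_wpM2r// ler_norm.
  by rewrite ler_wpM2l.
have h5 : `|c| * (2 * d * `|y|) = (`|c| *+ 4 * d) * `|y| / 2 by rewrite -mulr_natr; field.
have h6 : `|c| *+ 4 * d * `|y| <= 1 * `|y| by rewrite ler_wpM2r.
by move: h4; rewrite h5; move: h6; lra.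
Qed.

(** Compactness of the segment gives one radius for all its points; functions are then cut into
    pieces of that size, by induction on their number. *)
Lemma calc_vanish_itv a b : (forall t, a <= t <= b -> resolvent_set V A t) ->
  forall f, C0 f -> (forall t, f t != 0 -> a <= t <= b) -> forall x, Phi f x = 0.
Proof.
move=> rab.
have [d d0 hd] : exists2 d : R, 0 < d & forall w, a <= w <= b ->
    forall f, C0 f -> (forall t, f t != 0 -> `|t - w| <= d) -> forall x, Phi f x = 0.
  have := @segment_compact R a b; rewrite compact_near_coveringP => /(_ R (0^'+)
    (fun d w => forall f, C0 f -> (forall t, f t != 0 -> `|t - w| <= d) -> forall x, Phi f x = 0)).
  case=> [w /=|d /= d0 hd]; last first.
    have d20 : 0 < d / 2 by rewrite divr_gt0.
    exists (d / 2) => // w wab.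
    have hball : `|0 - d / 2| < d.
      by rewrite sub0r normrN gtr0_norm// ltr_pdivrMr// ltr_pMr// ltr1n.
    by apply: (hd _ hball d20) => /=; rewrite in_itv.
  rewrite in_itv /= => /rab/calc_vanish_near[d d0 hd].
  have d20 : 0 < d / 2 by rewrite divr_gt0.
  exists (ball w (d / 2), [set e | e <= d / 2]) => /=.
    split; first exact: nbhsx_ballx.
    exact: nbhs_right_le.
  move=> [w' e] /= [ww' ed] f f0 fe; apply: hd => // t /fe te.
  have -> : t - w = (t - w') - (w - w') by ring.
  rewrite (le_trans (ler_normB _ _))// (splitr d) lerD//; first exact: le_trans te ed.
  by move: ww'; rewrite -ball_normE /= => /ltW.
suff key n a' b' : a <= a' -> b' <= b -> b' - a' <= n%:R * d -> forall f, C0 f ->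
    (forall t, f t != 0 -> a' <= t <= b') -> forall x, Phi f x = 0.
  move=> f f0 fab; apply: (key (Num.truncn ((b - a) / d)).+1 a b) => //.
  by rewrite -ler_pdivrMr// ltW// truncnS_gt.
elim: n a' => [|n IH] a' aa' b'b hab f f0 fab x.
  rewrite mul0r subr_le0 in hab.
  have [[t ft]|nf] := pselect (exists t, f t != 0); last first.
    by apply: calc0 => t; apply/eqP; apply: contrapT => /negP ft; apply: nf; exists t.
  have /andP[at1 tb] := fab t ft.
  apply: (hd a') => // [|s /fab /andP[h1 h2]]; first by rewrite aa' /= (le_trans at1)// (le_trans tb).
  have -> : s = a' by apply/le_anti; rewrite h1 (le_trans h2).
  by rewrite subrr normr0 ltW.
have [hlt|hle] := leP (b' - a') (2 * d).
  have [ab'|ba'] := leP a' b'; last first.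
    apply: calc0 => t; apply/eqP; apply: contrapT => /negP/fab /andP[h1 h2].
    by have := le_lt_trans (le_trans h1 h2) ba'; rewrite ltxx.
  apply: (hd ((a' + b') / 2)) => // [|t /fab /andP[h1 h2]]; first by apply/andP; split; lra.
  by rewrite ler_norml; apply/andP; split; lra.
(* The ramp rises on [[a' + d, a' + 2 d]]. The left piece is within [d] of [a' + d]; the right one
   lives on [[a' + d, b']], which is shorter by [d]. *)
rewrite (@calc_ext _ (fun t => f t * (1 - ramp (a' + d) d t) + f t * ramp (a' + d) d t)); last first.
  by move=> t; ring.
rewrite calcD; [|exact: C0_1ramp|exact: C0_ramp].
rewrite (hd (a' + d)) ?add0r//; last 3 first.
- by apply/andP; split; lra.
- exact: C0_1ramp.
- move=> t ht; have /fab /andP[h1 h2] : f t != 0 by apply: contra_neq ht => ->; rewrite mul0r.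
  have h3 : t <= a' + d + d.
    rewrite leNgt; apply: contra_neqN ht => /ltW h3.
    by rewrite ramp1 ?subrr ?mulr0.
  by rewrite ler_norml; apply/andP; split; lra.
apply: (IH (a' + d)) => //; first by lra.
- by move: hab; rewrite -natr1; lra.
- exact: C0_ramp.
- move=> t ht; have /fab /andP[h1 ->] : f t != 0 by apply: contra_neq ht => ->; rewrite mul0r.
  rewrite andbT leNgt; apply: contra_neqN ht => /ltW h3.
  by rewrite ramp0 ?mulr0.
Qed.

Section cutoff_inverse.
Context (k : R -> R) (w d : R).
Hypotheses (k0 : C0 k) (d0 : 0 < d) (k1 : forall t, `|t - w| <= d -> k t = 1).

Let g0 := C0_slope_inv k0 d0 k1.
Let hk0 : C0 (fun t => - k t + w * slope_inv k w t).
Proof.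
have := C0_lin (-1) k0 (C0Z w g0); congr (C0 _); apply/funext => t.
by rewrite mulN1r.
Qed.

Let tg t : t * slope_inv k w t = 1 + (- k t + w * slope_inv k w t).
Proof.
rewrite /slope_inv; have [->|tw] := eqVneq t w.
  by rewrite k1 ?subrr ?normr0 ?ltW// !mul0r mulr0 addr0 subrr.
by field; rewrite subr_eq0.
Qed.

Let h_eval x : Phi (fun t => - k t + w * slope_inv k w t) x =
  - Phi k x + w *: Phi (slope_inv k w) x.
Proof.
rewrite -scaleN1r -calcZ// -(calc_lin calc)//; last exact: C0Z.
by apply: calc_ext => t; rewrite mulN1r.
Qed.

(** [Phi (slope_inv k w)] inverts [A - w] up to the error [Phi k], here from the right and in the
    next lemma from the left. When the error vanishes, [w] is a resolvent point. *)
Lemma calc_cutoff_graph x : V x ->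
  A (Phi (slope_inv k w) x, x - Phi k x + w *: Phi (slope_inv k w) x).
Proof. by move=> /(calc_graph g0 hk0 tg); rewrite h_eval scale1r addrA. Qed.

Lemma calc_cutoff_sym u v : A (u, v) ->
  u = Phi (slope_inv k w) (v - w *: u) + Phi k u.
Proof.
move=> /(calc_graph_sym g0 hk0 tg); rewrite h_eval scale1r.
rewrite (linB (PhiL g0)) (linZ (PhiL g0)) => ->.
by rewrite addrA addrK subrK.
Qed.

Lemma calc_cutoff_resolvent : (forall x, V x -> Phi k x = 0) -> resolvent_set V A w.
Proof.
move=> hk; split=> [x Vx|].
  exists (Phi (slope_inv k w) x, x - Phi k x + w *: Phi (slope_inv k w) x).
    exact: calc_cutoff_graph.
  by rewrite /= addrK hk ?subr0.
have [C C_ge0 hC] := C0_bounded g0; exists C => -[u v] Auv /=.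
rewrite {1}(calc_cutoff_sym Auv) (hk u) ?addr0; last by case: (AV Auv).
exact: (calc_contr calc g0).
Qed.

End cutoff_inverse.

(** For a cutoff [f] inside the isolation interval, [(t - w) f] of the operator is 0: the parts away
    from [w] meet only resolvent points, and the part within [2 d] of [w] has norm at most [2 d].
    Hence [Phi (f * f)] maps into the finite-dimensional eigenspace. *)
Lemma discrete_calc_tb w : discrete_spectrum V A w ->
  exists f, [/\ C0 f, f w = 1 & tb_operator (Phi f)].
Proof.
move=> [_ finN [e e0 iso]].
have e40 : 0 < e / 4 by rewrite divr_gt0.
pose f := plateau w (e / 4); have f0 : C0 f by exact: C0_plateau.
have f1 : f w = 1 by rewrite /f plateau1// subrr normr0 ltW.
have f01 t : 0 <= f t <= 1 by exact: plateau01.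
have fe t : f t != 0 -> `|t - w| <= e / 2.
  by move=> /(plateau_neq0 e40); rewrite (_ : 2 * (e / 4) = e / 2)//; field.
have tf0 : C0 (fun t => t * f t) by exact: C0_mul_id f0 fe.
have twf : C0 (fun t => t * f t - w * f t).
  have := C0_lin (- w) f0 tf0; congr (C0 _); apply/funext => t; by rewrite mulNr addrC.
have res t : `|t - w| < e -> t != w -> resolvent_set V A t.
  move=> h1 /eqP h2; apply: contrapT => h3; exact: h2 (iso t h3 h1).
have eig0 x : Phi (fun t => t * f t - w * f t) x = 0.
  apply: eps_eq0 => eta eta0.
  have [d d0 hd] := small_mul eta0 (mulr_ge0 (ler0n R 2) (normr_ge0 x)).
  pose k t := t * f t - w * f t.
  have kr0 : C0 (fun t => k t * ramp (w + d) d t) by exact: C0_ramp.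
  have kl0 : C0 (fun t => k t * (1 - ramp (w - 2 * d) d t)) by exact: C0_1ramp.
  have fk t : k t != 0 -> `|t - w| <= e / 2.
    move=> kt; apply: fe; apply: contra_neq kt => ft; rewrite /k ft; ring.
  have kr : Phi (fun t => k t * ramp (w + d) d t) x = 0.
    apply: (calc_vanish_itv (a := w + d) (b := w + e / 2)) => // [t /andP[h1 h2]|t ht].
      apply: res; last by rewrite gt_eqF// (lt_le_trans _ h1)// ltrDl.
      by rewrite ltr_norml; apply/andP; split; lra.
    have /fk : k t != 0 by apply: contra_neq ht => ->; rewrite mul0r.
    rewrite ler_norml => /andP[h1 h2].
    have h3 : w + d <= t by rewrite leNgt; apply: contra_neqN ht => /ltW h; rewrite ramp0 ?mulr0.
    by apply/andP; split; lra.
  have kl : Phi (fun t => k t * (1 - ramp (w - 2 * d) d t)) x = 0.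
    apply: (calc_vanish_itv (a := w - e / 2) (b := w - d)) => // [t /andP[h1 h2]|t ht].
      apply: res; last by rewrite lt_eqF// (le_lt_trans h2)// gtrBl.
      by rewrite ltr_norml; apply/andP; split; lra.
    have /fk : k t != 0 by apply: contra_neq ht => ->; rewrite mul0r.
    rewrite ler_norml => /andP[h1 h2].
    have h3 : t <= w - d.
      rewrite leNgt; apply: contra_neqN ht => /ltW h.
      rewrite ramp1 ?subrr ?mulr0//; lra.
    by apply/andP; split; lra.
  have krl0 : C0 (fun t => k t * ramp (w + d) d t + k t * (1 - ramp (w - 2 * d) d t)).
    exact: C0D.
  have -> : Phi (fun t => t * f t - w * f t) x = Phi (fun t => k t -
     (k t * ramp (w + d) d t + k t * (1 - ramp (w - 2 * d) d t))) x.
    by rewrite [RHS](calcB _ twf krl0) (calcD _ kr0 kl0) kr kl addr0 subr0.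
  have kk0 : C0 (fun t => k t - (k t * ramp (w + d) d t + k t * (1 - ramp (w - 2 * d) d t))).
    by have := C0_lin (- 1) krl0 twf; congr (C0 _); apply/funext => t; rewrite mulN1r addrC.
  apply: (@le_trans _ _ (2 * d * `|x|)); last by rewrite mulrAC.
  apply: (calc_contr calc kk0) => t.
  have [r0 r1] := andP (ramp01 (w + d) d t); have [l0 l1] := andP (ramp01 (w - 2 * d) d t).
  have [h0 h1] := andP (f01 t).
  (* What is left is localized by a difference of two ramps that vanishes for [|t - w| > 2 d]. *)
  have -> : k t - (k t * ramp (w + d) d t + k t * (1 - ramp (w - 2 * d) d t)) =
    (t - w) * (f t * (ramp (w - 2 * d) d t - ramp (w + d) d t)) by rewrite /k; ring.
  rewrite normrM.
  have [tw|tw] := leP `|t - w| (2 * d).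
    rewrite -[leRHS]mulr1 ler_pM// normrM -[leRHS]mulr1 (ger0_norm h0) ler_pM//.
    by rewrite ler_norml; apply/andP; split; lra.
  suff -> : ramp (w - 2 * d) d t = ramp (w + d) d t.
    by rewrite subrr mulr0 normr0 mulr0 mulr_ge0// ltW.
  move: tw; rewrite ltr_normr => /orP[h|h].
    by rewrite !ramp1//; lra.
  by rewrite !ramp0//; lra.
(* The square is used because [calc_graph] takes its argument in [V], where [Phi f x] lies for every
   [x]. *)
have eig x : Defs.eigenspace A w (Phi (fun t => f t * f t) x).
  have Vf : V (Phi f x) by exact: calc_range calc _ _ f0.
  have := calc_graph f0 tf0 (c := 0) (fun t => esym (add0r _)) Vf.
  rewrite scale0r add0r /Defs.eigenspace /= -(calcM x f0 f0) (_ : Phi (fun t => t * f t) _ = w *: Phi f (Phi f x))//.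
  by apply/eqP; rewrite -subr_eq0 -calcZ// -calcB ?eig0//; exact: C0Z.
have ff0 := C0M f0 f0.
exists (fun t => f t * f t); split=> //; first by rewrite f1 mulr1.
have [M hM] := finite_dim_orthonormal ipP finN.
have Nlin a u v : Defs.eigenspace A w u -> Defs.eigenspace A w v -> Defs.eigenspace A w (a *: u + v).
  rewrite /Defs.eigenspace /= => hu hv; have := Alin a hu hv.
  by rewrite scalerDr !scalerA mulrC.
have [n [b [ob Nb bspan]]] := orthonormal_spanning ipP Nlin hM.
apply: (finite_rank_tb_operator ipP (C := 1) (PhiL ff0) _ _ ob) => //.
- apply: (calc_contr calc ff0) => t; have [h0 h1] := andP (f01 t).
  by rewrite ger0_norm ?mulr_ge0// -[leRHS]mulr1 ler_pM.
- by move=> u; apply: bspan.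
Qed.

Section tb_calculus.
Context (w : R) (phi : R -> R).
Hypotheses (phi0 : C0 phi) (phiw : phi w != 0) (tphi : tb_operator (Phi phi)).

(** Near [w] the function [phi] has no zero, so [f = phi * (f / phi)] with [f / phi] continuous of
    compact support, and [Phi f] factors through [Phi phi]. *)
Lemma tb_calculus_localize : exists2 e : R, 0 < e & forall f, C0 f ->
  (forall t, f t != 0 -> `|t - w| <= 2 * e) -> tb_operator (Phi f).
Proof.
have : \forall t \near w, phi t != 0.
  have := @C0_continuous _ _ phi0 w; move/cvgrPdist_lt => /(_ `|phi w|).
  rewrite normr_gt0 => /(_ phiw); apply: filterS => t /= h.
  by apply: contraTneq h => ->; rewrite subr0 ltxx.
move=> /nbhs_ballP[e /= e0 he].
exists (e / 4) => [|f f0 fe]; first by rewrite divr_gt0.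
have fe' t : e / 2 < `|t - w| -> f t = 0.
  move=> h; apply/eqP; apply: contraTT h => /fe; rewrite -leNgt => h.
  by apply: le_trans h _; rewrite le_eqVlt; apply/orP; left; apply/eqP; field.
have g0 : C0 (fun t => f t / phi t).
  apply/Cc_C0/(CcP (M := `|w| + e)) => [t|t ht]; last first.
    rewrite fe' ?mul0r//; have := ler_normD (t - w) w; rewrite subrK; lra.
  have [tw|tw] := ltP `|t - w| e.
    apply: cvgM; first exact: C0_continuous.
    apply: cvgV; last exact: C0_continuous.
    by apply: he; rewrite -ball_normE /= distrC.
  have ft s : `|s - t| < e / 2 -> f s = 0.
    move=> h; apply: fe'.
    have := ler_normD (t - s) (s - w); rewrite addrA subrK distrC in h *; lra.
  rewrite /continuous_at ft ?subrr ?normr0 ?divr_gt0// mul0r; apply: cvg_near_cst.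
  apply/nbhs_ballP; exists (e / 2) => [|s /=]; first by rewrite /= divr_gt0.
  by rewrite distrC => /ft ->; rewrite mul0r.
have -> : Phi f = Phi phi \o Phi (fun t => f t / phi t).
  apply/funext => x; rewrite /= calcM//; apply: calc_ext => t.
  have [ft|ft] := eqVneq (f t) 0; first by rewrite ft mul0r mulr0.
  rewrite mulrC divfK//; apply: he; rewrite -ball_normE /= distrC.
  have := fe t ft; have : 2 * (e / 4) < e by lra.
  by move=> h1 h2; exact: le_lt_trans h2 h1.
have [C C_ge0 hC] := C0_bounded g0.
apply: (tb_operator_compr (C := C)) => //; first exact: PhiL.
exact: (calc_contr calc g0).
Qed.

(* Otherwise functions supported in a sequence of annuli shrinking to [w]
   would produce arbitrarily many orthonormal vectors fixed by a compact
   operator. *)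
Lemma tb_calculus_vanish : exists2 d : R, 0 < d & forall f, C0 f -> f w = 0 ->
  (forall t, f t != 0 -> `|t - w| <= d) -> forall x, Phi f x = 0.
Proof.
have [e e0 he] := tb_calculus_localize.
pose k := plateau w e; have k0 : C0 k by exact: C0_plateau.
have tk : tb_operator (Phi k) by apply: he => // t; exact: plateau_neq0.
have [M hM] := tb_operator_orthonormal ipP tk.
apply: contrapT => nex.
have bad (d : R) : 0 < d -> exists f x, [/\ C0 f, f w = 0,
    forall t, f t != 0 -> `|t - w| <= d & Phi f x != 0].
  move=> d0; apply: contrapT => nb; apply: nex; exists d => // f f0 fw fd x.
  by apply/eqP; apply: contrapT => /negP fx; apply: nb; exists f, x.
(* The radius is quantified inside the induction: the earlier vectors are taken within the smaller
   radius [d2], where the function of the new vector vanishes, which gives orthogonality. *)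
suff key n (d : R) : 0 < d -> d <= e -> exists v : 'I_n -> H, orthonormal_family ip v /\
    forall i, exists f x, [/\ C0 f, forall t, f t != 0 -> `|t - w| <= d & v i = Phi f x].
  have [v [ov hv]] := key M.+1 e e0 (lexx _).
  suff /(hM _ _ ov) : forall i, Phi k (v i) = v i by rewrite ltnn.
  move=> i; have [f [x [f0 fe ->]]] := hv i.
  by rewrite -calc_range_mul// => t /fe; exact: plateau1.
elim: n d => [|n IH] d d0 de; first by exists (fun=> 0); split=> -[].
have [f [x [f0 fw fd fx]]] := bad d d0.
have nfx : 0 < `|Phi f x| by rewrite normr_gt0.
have [eta eta0 heta] : exists2 eta : R, 0 < eta & eta * `|x| < `|Phi f x|.
  exists (`|Phi f x| / (`|x| + 1)); first by rewrite divr_gt0// ltr_wpDl.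
  by rewrite mulrAC ltr_pdivrMr ?ltr_wpDl// ltr_pM2l// ltrDl.
have := @C0_continuous _ _ f0 w; move/cvgrPdist_lt => /(_ _ eta0) /nbhs_ballP[d1 /= d10 hd1].
(* Within [2 d2] of [w] one has [|f| < eta], so the part of [f] removed there contributes at most
   [eta * |x| < |Phi f x|], and [Phi g x] stays nonzero. *)
pose d2 := Num.min (d1 / 4) d.
have d20 : 0 < d2 by rewrite lt_min divr_gt0.
pose g t := f t * (1 - plateau w d2 t); have g0 : C0 g by exact: C0_1plateau.
have gx : Phi g x != 0.
  apply: contraTneq heta => gx; rewrite -leNgt.
  have fp0 : C0 (fun t => f t * plateau w d2 t) by apply: C0M => //; exact: C0_plateau.
  have -> : Phi f x = Phi (fun t => f t * plateau w d2 t) x.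
    rewrite -[RHS]addr0 -gx -calcD//; apply: calc_ext => t; rewrite /g; ring.
  apply: (calc_contr calc fp0) => t; rewrite normrM.
  have [b0 b1] := andP (plateau01 w d2 t); rewrite (ger0_norm b0).
  have [->|/(plateau_neq0 d20) ht] := eqVneq (plateau w d2 t) 0; first by rewrite mulr0 ltW.
  rewrite -[leRHS]mulr1 ler_pM// ltW//.
  have /hd1 /= : ball w d1 t.
    rewrite -ball_normE /= distrC (le_lt_trans ht)//.
    have : d2 <= d1 / 4 by rewrite ge_min lexx.
    lra.
  by rewrite fw sub0r normrN.
have d2e : d2 <= e by rewrite (le_trans _ de)// ge_min lexx orbT.
have [v [ov hv]] := IH d2 d20 d2e.
pose z := `|Phi g x|^-1 *: Phi g x.
exists (fun i : 'I_n.+1 => if unlift ord_max i is Some j then v j else z); split.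
  apply: (orthonormal_extend ipP ov) => [i|].
    have [h [y [h0 hd ->]]] := hv i.
    rewrite /z (ipZl ipP) (calc_sym calc _ _ g0) calcM//.
    rewrite [Phi (fun t => g t * h t) y]calc0 ?(ip0r ipP) ?mulr0// => t.
    have [->|/hd ht] := eqVneq (h t) 0; first by rewrite mulr0.
    by rewrite /g plateau1// subrr mulr0 mul0r.
  by rewrite /z normrZ normfV normr_id mulVf// normr_eq0.
move=> i; case: unliftP => [j _|_].
  have [h [y [h0 hd ->]]] := hv j; exists h, y; split=> // t /hd ht.
  by rewrite (le_trans ht)// ge_min lexx orbT.
exists (fun t => `|Phi g x|^-1 * g t), x; split; first exact: C0Z.
  move=> t ht; apply: fd; apply: contra_neq ht => ft.
  by rewrite /g ft mul0r mulr0.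
by rewrite calcZ.
Qed.

(** By [tb_calculus_vanish], [(t - w) k] of the operator vanishes for a narrow cutoff [k], so
    [Phi k] produces eigenvectors unless it is 0 on [V], which would make [w] a resolvent point. A
    tb operator fixes the eigenspace. Cutoffs around nearby [t != w] give 0, so those points are
    resolvent points. *)
Lemma tb_calc_discrete : spectrum V A w -> discrete_spectrum V A w.
Proof.
move=> sw.
have [e e0 he] := tb_calculus_localize; have [d d0 hd] := tb_calculus_vanish.
have d20 : 0 < d / 2 by rewrite divr_gt0.
have Nlin a u v : Defs.eigenspace A w u -> Defs.eigenspace A w v -> Defs.eigenspace A w (a *: u + v).
  rewrite /Defs.eigenspace /= => hu hv; have := Alin a hu hv.
  by rewrite scalerDr !scalerA mulrC.
split.
- apply: contrapT => noeig; apply: sw.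
  pose k := plateau w (d / 2); have k0 : C0 k by exact: C0_plateau.
  apply: (calc_cutoff_resolvent k0 d20) => [t|x Vx]; first exact: plateau1.
  apply/eqP; apply: contrapT => /negP kx; apply: noeig; exists (Phi k x) => //.
  have kd t : k t != 0 -> `|t - w| <= d.
    by move=> /(plateau_neq0 d20); rewrite mulrC divfK.
  have tk0 : C0 (fun t => t * k t) by exact: C0_mul_id k0 kd.
  have := calc_graph k0 tk0 (c := 0) (fun t => esym (add0r _)) Vx.
  rewrite scale0r add0r /Defs.eigenspace /= (_ : Phi (fun t => t * k t) _ = w *: Phi k x)//.
  apply/eqP; rewrite -subr_eq0 -calcZ// -calcB//; last exact: C0Z.
  apply/eqP/hd; first by have := C0_lin (- w) k0 tk0; congr (C0 _);
    apply/funext => t; rewrite mulNr addrC.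
    by rewrite subrr.
  move=> t ht; apply: kd; apply: contra_neq ht => ->; ring.
- pose k := plateau w e; have k0 : C0 k by exact: C0_plateau.
  have tk : tb_operator (Phi k) by apply: he => // t; exact: plateau_neq0.
  have kN u : Defs.eigenspace A w u -> Phi k u = u.
    move=> Nu; have := calc_cutoff_sym k0 e0 (fun t => @plateau1 R w e t e0) Nu.
    rewrite subrr (lin0 (PhiL _)) ?add0r; first by [].
    by apply: (C0_slope_inv k0 e0) => t; exact: plateau1.
  have [M hM] := tb_operator_orthonormal ipP tk.
  have [|n [b [_ _ bspan]]] := orthonormal_spanning ipP Nlin (M := M).
    by move=> n v ov Nv; apply: hM ov _ => i; exact: kN.
  by exists n, b => u /bspan {1}->; exists (fun i => ip u (b i)).
exists (d / 2) => // t st tw; apply: contrapT => /eqP tnw; apply: st.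
have tw0 : 0 < `|t - w| by rewrite normr_gt0 subr_eq0.
(* The support, within [2 r] of [t], must miss [w] and stay within [d] of [w]. *)
pose r := Num.min (`|t - w| / 4) (d / 4).
have r0 : 0 < r by rewrite lt_min !divr_gt0.
have r1 : r <= `|t - w| / 4 by rewrite ge_min lexx.
have r2 : r <= d / 4 by rewrite ge_min lexx orbT.
have k0 : C0 (plateau t r) by exact: C0_plateau.
apply: (calc_cutoff_resolvent k0 r0) => [s|x _]; first exact: plateau1.
apply: hd => //.
  by rewrite plateau0// distrC; lra.
move=> s /(plateau_neq0 r0) hs.
by have := ler_normD (s - t) (t - w); rewrite addrA subrK; lra.
Qed.

End tb_calculus.

Theorem ess_spectrum_calculus w : ~ ess_spectrum V A w <->
  exists f, [/\ C0 f, f w != 0 & tb_operator (Phi f)].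
Proof.
split=> [hw|[f [f0 fw tf]] [sw]]; last by apply; exact: tb_calc_discrete tf sw.
have [sw|] := pselect (spectrum V A w).
  have [dw|nd] := pselect (discrete_spectrum V A w); last by case: hw.
  by have [f [f0 fw tf]] := discrete_calc_tb dw; exists f; rewrite fw oner_neq0.
move/contrapT => /calc_vanish_near[d d0 hd].
have d20 : 0 < d / 2 by rewrite divr_gt0.
exists (plateau w (d / 2)); split; first exact: C0_plateau.
  by rewrite plateau1 ?oner_neq0// subrr normr0 ltW.
have -> : Phi (plateau w (d / 2)) = fun=> 0; last exact: tb_operator0.
apply/funext => x; apply: hd; first exact: C0_plateau.
by move=> t /(plateau_neq0 d20); rewrite mulrC divfK.
Qed.

End calculus.

(** * Comparison of two resolvents *)

(* [T] is [(A + 1)^-1] on [V], extended by 0 on the orthogonal complement. *)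
Record resolvent_at_m1 (R : realType) (H : normedModType R) (ip : H -> H -> R)
    (V : set H) (A : set (H * H)) (T : H -> H) : Prop := {
  res_lin : linear T ;
  res_sym : forall u v, ip (T u) v = ip u (T v) ;
  res_ge0 : forall u, 0 <= ip (T u) u ;
  res_le1 : forall u, ip (T u) u <= `|u| ^+ 2 ;
  res_space_lin : forall a u v, V u -> V v -> V (a *: u + v) ;
  res_space_closed : forall x l, (forall n, V (x n)) -> seqlim x l -> V l ;
  res_space_dec : forall x, exists2 p, V p & forall v, V v -> ip (x - p) v = 0 ;
  res_range : forall u, V (T u) ;
  res_orth : forall u, (forall v, V v -> ip u v = 0) -> T u = 0 ;
  res_graph : forall u, V u -> A (T u, u - T u) ;
  res_graphE : forall u v, A (u, v) -> u = T (u + v) ;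
  graph_lin : forall a u v u' v', A (u, v) -> A (u', v') ->
    A (a *: u + u', a *: v + v') ;
  graph_space : forall u v, A (u, v) -> V u /\ V v }.

Section resolvent.
Context (R : realType) (H : normedModType R) (ip : H -> H -> R).
Hypotheses (ipP : inner_product ip) (cH : cauchy_complete H).
Context (V : set H) (A : set (H * H)) (T : H -> H).
Hypothesis AT : resolvent_at_m1 ip V A T.

Lemma res_norm_le u : `|T u| <= 1 * `|u|.
Proof.
apply: (norm_le_quadratic ipP (res_lin AT) ler01 (res_sym AT)) => {}u.
by rewrite ger0_norm ?mul1r ?(res_le1 AT)// (res_ge0 AT).
Qed.

Lemma graph_sym u v u' v' : A (u, v) -> A (u', v') -> ip v u' = ip u v'.
Proof.
move=> /(res_graphE AT) hu /(res_graphE AT) hu'.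
have : ip (u + v) u' = ip u (u' + v').
  by rewrite [in LHS]hu' [in RHS]hu (res_sym AT).
by rewrite (ipDl ipP) (ipDr ipP) => /addrI.
Qed.

Lemma fun_calcP : C0_calculus ip V A (fun_calc ip V A).
Proof.
apply: (@xgetPex _ (fun _ _ => 0) (C0_calculus ip V A)).
exists (fun f => psi T (pull (@inv_sub1 R) f)).
case: AT => *; exact: C0_calculus_exists.
Qed.

Section calculus.
Context (Phi : (R -> R) -> H -> H).
Hypothesis calc : C0_calculus ip V A Phi.

Let re := re_res (0 : R) 1.
Let im := im_res (0 : R) 1.
Let re0 : C0 re. Proof. by apply: C0_re_res; rewrite oner_eq0. Qed.
Let im0 : C0 im. Proof. by apply: C0_im_res; rewrite oner_eq0. Qed.
Let lre : linear (Phi re). Proof. exact: calc_linear calc _ re0. Qed.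
Let lim : linear (Phi im). Proof. exact: calc_linear calc _ im0. Qed.
Let lT := res_lin AT.

(** The two parts of [(A - i)^-1 = T (1 + (1 + i) (A - i)^-1)]. On [V] it is read off the graph; on
    the orthogonal complement all terms vanish. *)
Lemma res_calc x :
  Phi re x = T (x + Phi re x - Phi im x) /\ Phi im x = T (Phi re x + Phi im x).
Proof.
have [p Vp hp] := res_space_dec AT x.
have key y : V y -> Phi re y = T (y + Phi re y - Phi im y) /\ Phi im y = T (Phi re y + Phi im y).
  move=> Vy; have [/(res_graphE AT) h1 /(res_graphE AT) h2] := calc_resolvent_i calc Vy.
  split; first by rewrite [LHS]h1 addrCA addrA.
  by rewrite [LHS]h2 addrC.
have orth : Phi re (x - p) = 0 /\ Phi im (x - p) = 0.
  by split; apply: (calc_orth calc).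
have [re_xp im_xp] := orth; have T_xp := res_orth AT hp.
have [k1 k2] := key p Vp.
have e1 : Phi re x = Phi re p by apply/eqP; rewrite -subr_eq0 -(linB lre) re_xp.
have e2 : Phi im x = Phi im p by apply/eqP; rewrite -subr_eq0 -(linB lim) im_xp.
rewrite e1 e2 -k2; split => //.
rewrite [LHS]k1; apply/eqP; rewrite -subr_eq0 -(linB lT).
rewrite -(addrA p) -(addrA x) opprD addrACA subrr addr0.
by rewrite -opprB (linN lT) T_xp oppr0.
Qed.

(** The adjoint identity, with T on the right: all operators involved are symmetric. *)
Lemma calc_res x :
  Phi re x = T x + Phi re (T x) - Phi im (T x) /\ Phi im x = Phi re (T x) + Phi im (T x).
Proof.
split; apply: (ip_inj ipP) => y.
  have [h _] := res_calc y.
  rewrite (calc_sym calc _ _ re0) h -(res_sym AT) (ipBr ipP) (ipDr ipP).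
  by rewrite -(calc_sym calc _ _ re0) -(calc_sym calc _ _ im0) (ipBl ipP) (ipDl ipP).
have [_ h] := res_calc y.
rewrite (calc_sym calc _ _ im0) h -(res_sym AT) (ipDr ipP).
by rewrite -(calc_sym calc _ _ re0) -(calc_sym calc _ _ im0) (ipDl ipP).
Qed.

(** The identity [1 = re t * t + im t] at the graph point [(T x, x - T x)]; it recovers T from
    functions in [C0]. *)
Lemma res_from_calc x : V x -> T x = Phi re (x - T x) + Phi im (T x).
Proof.
move=> /(res_graph AT) hA.
have nim0 : C0 (fun t => - 1 * im t) by exact: C0Z.
have den t : t ^+ 2 + 1 != 0 :> R by rewrite gt_eqF// ltr_wpDl ?sqr_ge0.
have := calc_graph_sym ipP calc (res_space_lin AT) (graph_space AT) (graph_lin AT)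
  graph_sym re0 nim0 (c := 1) _ hA.
rewrite scale1r (calcZ calc)// scaleN1r => -> => [|t]; first by rewrite subrK.
by rewrite /re /im /re_res /im_res subr0 expr1n; field; rewrite den.
Qed.

(* Compactness of [S e^-L] passes to [S f(L)]: write [f = e^-|t| * (f e^|t|)]
   for [f] of compact support. *)
Lemma tb_heat (S : H -> H) (c : R) : linear S -> 0 <= c -> (forall u, `|S u| <= c * `|u|) ->
  tb_operator (S \o Phi (fun t => expR (- `|t|))) ->
  forall f, C0 f -> tb_operator (S \o Phi f).
Proof.
move=> lS c0 Sc th.
have ce : continuous (fun t : R => expR (- `|t|)).
  move=> t; apply: (@continuous_comp R R R (fun t => - `|t|) (@expR R)).
    by apply: cvgN; exact: norm_continuous.
  exact: continuous_expR.
have e0 : C0 (fun t : R => expR (- `|t|)).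
  apply: (C0_decay (a := 0) (C := 1)) => // t.
  rewrite subr0 ger0_norm ?expR_ge0// expRN mulrC ler_pdivrMr ?expR_gt0// mul1r.
  by rewrite (le_trans _ (expR_ge1Dx _))// lerDr.
have hCc f : Cc [set: R] f -> tb_operator (S \o Phi f).
  move=> fc; have [M M0 fM] := Cc_vanish fc; have [cf _ _] := fc.
  have g0 : C0 (fun t => f t * expR `|t|).
    apply/Cc_C0/(CcP (M := M)) => [t|t /fM ->]; last by rewrite mul0r.
    apply: cvgM; first exact: cf.
    by apply: (@continuous_comp R R R (fun t => `|t|) (@expR R)); [exact: norm_continuous|exact: continuous_expR].
  have -> : S \o Phi f = (S \o Phi (fun t => expR (- `|t|))) \o Phi (fun t => f t * expR `|t|).
    apply/funext => x /=; rewrite (calcM calc)//; congr S; apply: calc_ext => t.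
    by rewrite mulrC -mulrA -expRD subrr expR0 mulr1.
  have [C C_ge0 hC] := C0_bounded g0.
  apply: (tb_operator_compr (C := C)) => //; last exact: (calc_contr calc g0).
  by move=> a u v /=; rewrite (calc_linear calc e0) lS.
move=> f f0; apply: tb_operator_approx => d d0.
have [d' d'0 hd'] := small_mul d0 c0.
have [g gc fg] := f0 _ d'0; have g0 := Cc_C0 gc.
exists (S \o Phi g) => [|u u1 /=]; first exact: hCc.
rewrite -(linB lS) -(calcB calc)// (le_trans (Sc _))// (le_trans _ hd')// ler_wpM2l//.
have fg0 : C0 (fun t => f t - g t).
  by have := C0_lin (- 1) g0 f0; congr (C0 _); apply/funext => t; rewrite mulN1r addrC.
by rewrite (le_trans (calc_contr calc fg0 fg u))// ler_piMr// ltW.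
Qed.

Lemma tb_heat_res (S : H -> H) (c : R) : linear S -> 0 <= c -> (forall u, `|S u| <= c * `|u|) ->
  tb_operator (S \o Phi (fun t => expR (- `|t|))) -> (forall x, V x) ->
  tb_operator (S \o T).
Proof.
move=> lS c0 Sc th VT; have tS := tb_heat lS c0 Sc th.
have -> : S \o T = fun x => (S \o Phi re) (x - T x) + (S \o Phi im) (T x).
  by apply/funext => x /=; rewrite {1}res_from_calc// (linD lS).
apply: tb_operatorD.
  apply: (tb_operator_compr (K := S \o Phi re) (C := 2)) => //.
  - by move=> a u v /=; rewrite lre lS.
  - move=> u; rewrite (le_trans (ler_normB _ _))//.
    have := res_norm_le u; lra.
  - exact: tS.
apply: (tb_operator_compr (K := S \o Phi im) (C := 1)) => //.
- by move=> a u v /=; rewrite lim lS.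
- exact: res_norm_le.
- exact: tS.
Qed.

End calculus.
End resolvent.

(** * Functions whose values at the two operators differ compactly *)

Section comparison.
Context (R : realType) (H : normedModType R) (ip : H -> H -> R).
Hypotheses (ipP : inner_product ip) (cH : cauchy_complete H).
Context (V1 V2 : set H) (A1 A2 : set (H * H)) (T1 T2 : H -> H).
Hypotheses (AT1 : resolvent_at_m1 ip V1 A1 T1) (AT2 : resolvent_at_m1 ip V2 A2 T2).
Context (Phi1 Phi2 : (R -> R) -> H -> H).
Hypotheses (calc1 : C0_calculus ip V1 A1 Phi1) (calc2 : C0_calculus ip V2 A2 Phi2).
Hypothesis tT : tb_operator (fun u => T2 u - T1 u).

Let re := re_res (0 : R) 1.
Let im := im_res (0 : R) 1.
Let re0 : C0 re. Proof. by apply: C0_re_res; rewrite oner_eq0. Qed.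
Let im0 : C0 im. Proof. by apply: C0_im_res; rewrite oner_eq0. Qed.

Let al (Phi : (R -> R) -> H -> H) x := x + Phi re x - Phi im x.
Let be (Phi : (R -> R) -> H -> H) x := Phi re x + Phi im x.

Let den_gt0 (t : R) : 0 < t ^+ 2 + 1.
Proof. by rewrite ltr_wpDl ?sqr_ge0. Qed.

Let re_le1 t : `|re t| <= 1.
Proof.
rewrite /re /re_res subr0 expr1n normrM normfV (gtr0_norm (den_gt0 t)).
rewrite ler_pdivrMr// mul1r -(real_normK (num_real t)).
have := sqr_ge0 (`|t| - 1); move: `|t| => x; nra.
Qed.

Let im_le1 t : `|im t| <= 1.
Proof.
rewrite /im /im_res subr0 expr1n normrM normfV (gtr0_norm (den_gt0 t)) normr1 mul1r.
by rewrite invf_le1// lerDr sqr_ge0.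
Qed.

Let al_lin V A Phi : C0_calculus ip V A Phi -> linear (al Phi).
Proof.
move=> calc a u v; rewrite /al (calc_linear calc re0) (calc_linear calc im0).
ip_ring ipP.
Qed.

Let be_lin V A Phi : C0_calculus ip V A Phi -> linear (be Phi).
Proof.
move=> calc a u v; rewrite /be (calc_linear calc re0) (calc_linear calc im0).
ip_ring ipP.
Qed.

Let re_bnd V A Phi x : C0_calculus ip V A Phi -> `|Phi re x| <= `|x|.
Proof. by move=> calc; rewrite -[leRHS]mul1r; exact: (calc_contr calc re0). Qed.

Let im_bnd V A Phi x : C0_calculus ip V A Phi -> `|Phi im x| <= `|x|.
Proof. by move=> calc; rewrite -[leRHS]mul1r; exact: (calc_contr calc im0). Qed.

Let al_bnd V A Phi x : C0_calculus ip V A Phi -> `|al Phi x| <= 3 * `|x|.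
Proof.
move=> calc; rewrite /al (le_trans (ler_normB _ _))//.
have := re_bnd x calc; have := im_bnd x calc; have := ler_normD x (Phi re x); lra.
Qed.

Let be_bnd V A Phi x : C0_calculus ip V A Phi -> `|be Phi x| <= 2 * `|x|.
Proof.
move=> calc; rewrite /be (le_trans (ler_normD _ _))//.
have := re_bnd x calc; have := im_bnd x calc; lra.
Qed.

Let D x := T2 x - T1 x.

Let D_lin : linear D.
Proof.
move=> a u v; rewrite /D (res_lin AT1) (res_lin AT2).
by rewrite opprD addrACA -scalerBr.
Qed.

(* Second resolvent identity
     (A2 - i)^-1 - (A1 - i)^-1 = (1 + (1 + i)(A1 - i)^-1) D (1 + (1 + i)(A2 - i)^-1)
   with [al], [be] the real and imaginary parts of [1 + (1 + i)(A - i)^-1]. *)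
Let re_diff x : Phi2 re x - Phi1 re x =
  al Phi1 (D (al Phi2 x)) - be Phi1 (D (be Phi2 x)).
Proof.
have [h1 h2] := res_calc AT2 calc2 x.
rewrite -/re -/im in h1 h2.
have r1 y := (calc_res ipP AT1 calc1 y).1; have r2 y := (calc_res ipP AT1 calc1 y).2.
rewrite -/re -/im in r1 r2.
rewrite /D (linB (al_lin calc1)) (linB (be_lin calc1)).
rewrite [T2 (al _ _)](esym h1) [T2 (be _ _)](esym h2).
rewrite [al Phi1 (T1 _)](esym (r1 _)) [be Phi1 (T1 _)](esym (r2 _)).
rewrite /al /be !(linD (calc_linear calc1 re0)) !(linD (calc_linear calc1 im0)).
rewrite ?(linN (calc_linear calc1 re0)) ?(linN (calc_linear calc1 im0)).
ip_ring ipP.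
Qed.

Let im_diff x : Phi2 im x - Phi1 im x =
  al Phi1 (D (be Phi2 x)) + be Phi1 (D (al Phi2 x)).
Proof.
have [h1 h2] := res_calc AT2 calc2 x.
rewrite -/re -/im in h1 h2.
have r1 y := (calc_res ipP AT1 calc1 y).1; have r2 y := (calc_res ipP AT1 calc1 y).2.
rewrite -/re -/im in r1 r2.
rewrite /D !(linB (al_lin calc1)) !(linB (be_lin calc1)).
rewrite [T2 (al _ _)](esym h1) [T2 (be _ _)](esym h2).
rewrite [al Phi1 (T1 _)](esym (r1 _)) [be Phi1 (T1 _)](esym (r2 _)).
rewrite /al /be !(linD (calc_linear calc1 re0)) !(linD (calc_linear calc1 im0)).
rewrite ?(linN (calc_linear calc1 re0)) ?(linN (calc_linear calc1 im0)).
ip_ring ipP.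
Qed.

Let tb_sandwich (L M : H -> H) (c d : R) : linear L -> linear M -> 0 <= c -> 0 <= d ->
  (forall x, `|L x| <= c * `|x|) -> (forall x, `|M x| <= d * `|x|) ->
  tb_operator (fun x => L (D (M x))).
Proof.
move=> lL lM c0 d0 hL hM.
apply: (tb_operator_compl lL c0 hL).
exact: (tb_operator_compr D_lin d0 hM).
Qed.

Definition compact_diff (f : R -> R) := C0 f /\ tb_operator (fun u => Phi2 f u - Phi1 f u).

Let n2 : 0 <= 2 :> R. Proof. by []. Qed.
Let n3 : 0 <= 3 :> R. Proof. by []. Qed.

Lemma compact_diff_re : compact_diff re.
Proof.
split=> //; under [X in tb_operator X]funext do rewrite re_diff.
apply: tb_operatorB.
  exact: (tb_sandwich (al_lin calc1) (al_lin calc2) n3 n3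
    (fun x => al_bnd x calc1) (fun x => al_bnd x calc2)).
exact: (tb_sandwich (be_lin calc1) (be_lin calc2) n2 n2
  (fun x => be_bnd x calc1) (fun x => be_bnd x calc2)).
Qed.

Lemma compact_diff_im : compact_diff im.
Proof.
split=> //; under [X in tb_operator X]funext do rewrite im_diff.
apply: tb_operatorD.
  exact: (tb_sandwich (al_lin calc1) (be_lin calc2) n3 n2
    (fun x => al_bnd x calc1) (fun x => be_bnd x calc2)).
exact: (tb_sandwich (be_lin calc1) (al_lin calc2) n2 n3
  (fun x => be_bnd x calc1) (fun x => al_bnd x calc2)).
Qed.

Lemma compact_diff_lin a f g : compact_diff f -> compact_diff g ->
  compact_diff (fun t => a * f t + g t).
Proof.
move=> [f0 tf] [g0 tg]; split; first exact: C0_lin.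
have := tb_operatorD (tb_operatorZ a tf) tg.
congr tb_operator; apply/funext => u.
rewrite (calc_lin calc1)// (calc_lin calc2)//; ip_ring ipP.
Qed.

(** Telescoping: [f2 g2 - f1 g1 = (f2 - f1) g2 + f1 (g2 - g1)], a compact factor in each term. *)
Lemma compact_diffM f g : compact_diff f -> compact_diff g ->
  compact_diff (fun t => f t * g t).
Proof.
move=> [f0 tf] [g0 tg]; split; first exact: C0M.
have [C C_ge0 fC] := C0_bounded f0; have [D' D_ge0 gD] := C0_bounded g0.
have ldf : linear (fun u => Phi2 f u - Phi1 f u).
  move=> a u v; rewrite (calc_linear calc1 f0) (calc_linear calc2 f0); ip_ring ipP.
have t1 := tb_operator_compr ldf D_ge0 (calc_contr calc2 g0 gD) tf.
have t2 := tb_operator_compl (calc_linear calc1 f0) C_ge0 (calc_contr calc1 f0 fC) tg.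
have := tb_operatorD t1 t2; congr tb_operator; apply/funext => u /=.
rewrite (calc_mul calc1)// (calc_mul calc2)// (linB (calc_linear calc1 f0)).
ip_ring ipP.
Qed.

Lemma compact_diff_approx f : C0 f -> (forall e : R, 0 < e -> exists2 g, compact_diff g &
  forall t, `|f t - g t| <= e) -> compact_diff f.
Proof.
move=> f0 h; split=> //; apply: tb_operator_approx => e e0.
have e20 : 0 < e / 2 by rewrite divr_gt0.
have [g [g0 tg] fg] := h _ e20; exists (fun u => Phi2 g u - Phi1 g u) => // u u1.
have fg0 : C0 (fun t => f t - g t).
  by have := C0_lin (- 1) g0 f0; congr (C0 _); apply/funext => t; rewrite mulN1r addrC.
have -> : Phi2 f u - Phi1 f u - (Phi2 g u - Phi1 g u) =
    Phi2 (fun t => f t - g t) u - Phi1 (fun t => f t - g t) u.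
  rewrite (calcB calc1)// (calcB calc2)//; ip_ring ipP.
rewrite (le_trans (ler_normB _ _))// (splitr e) lerD//.
  by rewrite (le_trans (calc_contr calc2 fg0 fg u))// ler_piMr// ltW.
by rewrite (le_trans (calc_contr calc1 fg0 fg u))// ler_piMr// ltW.
Qed.

Lemma compact_diff0 : compact_diff (fun=> 0).
Proof.
split; first exact: C0_0; under [X in tb_operator X]funext do rewrite
  (calc0 calc1)// (calc0 calc2)// subrr.
exact: tb_operator0.
Qed.

Lemma compact_diff_ext f g : f =1 g -> compact_diff f -> compact_diff g.
Proof. by move=> /funext ->. Qed.

(** The root at 0 excludes the constant term, since constants do not belong to [C0]. *)
Lemma compact_diff_poly (p : {poly R}) : root p 0 -> compact_diff (fun t => p.[im t]).
Proof.
move=> /factor_theorem[q ->]; rewrite subr0.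
have hX n : compact_diff (fun t => im t ^+ n.+1).
  elim: n => [|n IH].
    by apply: compact_diff_ext compact_diff_im => t; rewrite expr1.
  apply: compact_diff_ext (compact_diffM compact_diff_im IH) => t.
  by rewrite [RHS]exprS.
have : compact_diff (fun t => \sum_(i < size q) q`_i * im t ^+ i.+1).
  elim: (size q) => [|n IH].
    by apply: compact_diff_ext compact_diff0 => t; rewrite big_ord0.
  apply: compact_diff_ext (compact_diff_lin q`_n (hX n) IH) => t.
  by rewrite big_ord_recr /= addrC.
apply: compact_diff_ext => t; rewrite hornerM hornerX horner_coef mulr_suml.
by apply: eq_bigr => i _; rewrite exprSr mulrA.
Qed.

(** The moment estimate of the operator case, with a number [x] in place of T. *)
Lemma bernstein_approx (F : R -> R) : quad_modulus F -> forall e : R, 0 < e ->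
  exists n, forall x, 0 <= x <= 1 -> `|F x - (bern F n).[x]| <= e.
Proof.
move=> hF e e0; have e20 : 0 < e / 2 by rewrite divr_gt0.
have [C C_ge0 hC] := hF _ e20; have [d d0 hd] := small_mul e20 C_ge0.
have [N hN] := exists_inv_lt d0; exists N => x /andP[x0 x1].
pose b (k : 'I_N.+2) := (bernstein R N.+1 k).[x].
have b0 k : 0 <= b k.
  rewrite /b /bernstein hornerZ hornerM !horner_exp hornerX hornerD hornerN hornerC.
  by rewrite hornerX mulr_ge0// mulr_ge0// exprn_ge0// subr_ge0.
have s0 : \sum_k b k = 1.
  have := congr1 (fun p => p.[x]) (sum_bernstein R N.+1).
  by rewrite horner_sum hornerE.
have s1 : \sum_(k < N.+2) k%:R / N.+1%:R * b k = x.
  have := congr1 (fun p => p.[x]) (sum_bernstein1 R N).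
  by rewrite horner_sum hornerX; under eq_bigr do rewrite hornerZ.
have s2 : \sum_(k < N.+2) (k%:R / N.+1%:R) ^+ 2 * b k = x ^+ 2 + N.+1%:R^-1 * (x * (1 - x)).
  have := congr1 (fun p => p.[x]) (sum_bernstein2 R N).
  by rewrite horner_sum !hornerE; under eq_bigr do rewrite hornerZ.
rewrite /bern horner_sum.
have -> : F x - \sum_(k < N.+2) (F (k%:R / N.+1%:R) *: bernstein R N.+1 k).[x] =
    \sum_(k < N.+2) (F x - F (k%:R / N.+1%:R)) * b k.
  under [RHS]eq_bigr do rewrite mulrBl.
  rewrite sumrB -mulr_sumr s0 mulr1; congr (_ - _).
  by apply: eq_bigr => k _; rewrite hornerZ.
rewrite (le_trans (ler_norm_sum _ _ _))//.
apply: (@le_trans _ _ (\sum_(k < N.+2) (e / 2 + C * (x - k%:R / N.+1%:R) ^+ 2) * b k)).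
  apply: ler_sum => k _; rewrite normrM (ger0_norm (b0 k)) ler_wpM2r//.
  by apply: hC; [rewrite x0|exact: bern_node].
have -> : \sum_(k < N.+2) (e / 2 + C * (x - k%:R / N.+1%:R) ^+ 2) * b k =
    (e / 2 + C * x ^+ 2) * (\sum_k b k) - 2 * C * x * (\sum_(k < N.+2) k%:R / N.+1%:R * b k)
      + C * \sum_(k < N.+2) (k%:R / N.+1%:R) ^+ 2 * b k.
  rewrite !mulr_sumr -sumrB -big_split /=; apply: eq_bigr => k _; ring.
rewrite s0 s1 s2.
have h1 : C * (N.+1%:R^-1 * (x * (1 - x))) <= C * d.
  rewrite ler_wpM2l// (le_trans _ (hN N (leqnn _)))// ler_piMr ?invr_ge0 ?ler0n//; nra.
rewrite (_ : _ + _ = e / 2 + C * (N.+1%:R^-1 * (x * (1 - x)))); last by ring.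
by rewrite [leRHS]splitr lerD2l (le_trans h1).
Qed.

(** An even function is a function of [im t = 1 / (t^2 + 1)], namely [F s = f (sqrt (1/s - 1))]. As
    [F 0 = 0], its Bernstein polynomials have no constant term. *)
Lemma compact_diff_even f : C0 f -> (forall t, f (- t) = f t) -> compact_diff f.
Proof.
move=> f0 fe; pose F := pull (fun s => Num.sqrt (inv_sub1 s)) f.
have hF : quad_modulus F := pull_quad_modulus (@blowup_sqrt R) f0.
have im_gt0 t : 0 < im t by rewrite /im /im_res subr0 expr1n divr_gt0.
have Fim t : F (im t) = f t.
  rewrite /F /pull leNgt im_gt0 /= /inv_sub1 /im /im_res subr0 expr1n div1r invrK addrK.
  by rewrite sqrtr_sqr; case: (ger0P t) => _; rewrite ?fe.
apply: compact_diff_approx => // e e0; have [n hn] := bernstein_approx hF e0.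
exists (fun t => (bern F n).[im t]).
  apply: compact_diff_poly; apply: root_bern0; by rewrite /F /pull lexx.
move=> t; rewrite -{1}Fim hn// ltW//=; have := im_le1 t.
by rewrite gtr0_norm.
Qed.

(** Dividing by [re t = t / (t^2 + 1)] would leave an even function with a possible singularity at
    0. Replacing [t^2] by [t^2 + eta] in the denominator removes it, at the cost of the error
    [f t * eta / (t^2 + eta)]. *)
Lemma compact_diff_odd f (M : R) : C0 f -> (forall t, M < `|t| -> f t = 0) ->
  (forall t, f (- t) = - f t) -> compact_diff f.
Proof.
move=> f0 fM fo; have [C C_ge0 fC] := C0_bounded f0.
have cf := C0_continuous f0.
have f00 : f 0 = 0 by have := fo 0; rewrite oppr0 => h; lra.
apply: compact_diff_approx => // e e0.
have [d d0 hd] : exists2 d : R, 0 < d & forall t, `|t| < d -> `|f t| <= e.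
  have := @C0_continuous _ _ f0 0; move/cvgrPdist_le => /(_ _ e0)/nbhs_ballP[d /= d0 hd].
  exists d => // t td; have := hd t; rewrite -ball_normE /= f00 !sub0r !normrN; exact.
(* Then [C eta <= e d^2], which bounds the error by [e] for [|t| >= d]; for [|t| < d] it is bounded
   by [|f t| <= e]. *)
pose eta := e * d ^+ 2 / (C + 1).
have C10 : 0 < C + 1 by rewrite ltr_wpDl.
have eta0 : 0 < eta by rewrite !mulr_gt0// ?exprn_gt0// invr_gt0.
have den' t : 0 < t ^+ 2 + eta by rewrite ltr_wpDl ?sqr_ge0.
pose k t := f t * (t * (t ^+ 2 + 1) / (t ^+ 2 + eta)).
have csq : continuous (fun t : R => t ^+ 2) by move=> t; apply: cvgM; exact: cvg_id.
have k0 : C0 k.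
  apply/Cc_C0/(CcP (M := M)) => [t|t /fM]; last by rewrite /k => ->; rewrite mul0r.
  apply: cvgM; first exact: cf.
  apply: cvgM.
    by apply: cvgM; [exact: cvg_id|apply: cvgD; [exact: csq|exact: cvg_cst]].
  apply: cvgV; first by rewrite gt_eqF.
  by apply: cvgD; [exact: csq|exact: cvg_cst].
have ke t : k (- t) = k t by rewrite /k fo sqrrN !mulNr mulrN opprK.
exists (fun t => re t * k t).
  exact: compact_diffM compact_diff_re (compact_diff_even k0 ke).
move=> t.
have -> : f t - re t * k t = f t * (eta / (t ^+ 2 + eta)).
  rewrite /re /re_res /k subr0 expr1n; field.
  by rewrite !gt_eqF.
have q0 : 0 <= eta / (t ^+ 2 + eta) by rewrite divr_ge0// ltW.
rewrite normrM (ger0_norm q0).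
have [td|td] := ltP `|t| d.
  rewrite -[leRHS]mulr1 ler_pM// ?hd// ler_pdivrMr// mul1r lerDr sqr_ge0//.
rewrite mulrA ler_pdivrMr//.
have h1 : `|f t| * eta <= C * eta by rewrite ler_wpM2r// ltW.
have h2 : C * eta <= e * d ^+ 2.
  rewrite /eta mulrA ler_pdivrMr// mulrC ler_wpM2l//; last by rewrite lerDl.
  by rewrite mulr_ge0 ?ltW// exprn_gt0.
have h3 : e * d ^+ 2 <= e * t ^+ 2.
  rewrite ler_wpM2l ?(ltW e0)// -(real_normK (num_real t)) ler_pXn2r// ?nnegrE// ltW//.
have h4 : 0 < e * eta by rewrite mulr_gt0.
by rewrite mulrDr; lra.
Qed.

(** After approximation by a function of compact support, the even and odd parts are treated
    separately. *)
Theorem compact_diff_C0 f : C0 f -> compact_diff f.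
Proof.
move=> f0; apply: compact_diff_approx => // e e0; have [g gc fg] := f0 _ e0.
exists g => //.
have [M M0 gM] := Cc_vanish gc; have g0 := Cc_C0 gc; have [cg _ _] := gc.
have gN0 : C0 (fun t => g (- t)).
  apply/Cc_C0/(CcP (M := M)) => [t|t ht]; last by rewrite gM// normrN.
  by apply: (@continuous_comp R R R -%R g); [exact: opp_continuous|exact: cg].
have ev0 := C0_lin 1 g0 gN0; have od0 := C0_lin (- 1) gN0 g0.
have hev := compact_diff_even ev0 (fun t => _).
have hod := compact_diff_odd (M := M) od0 _ _.
have := compact_diff_lin 2^-1 (hev _) (compact_diff_lin 2^-1 (hod _ _) compact_diff0).
move=> h; apply: compact_diff_ext (h _ _ _) => t /=.
- by field.
- by rewrite opprK mul1r mul1r addrC.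
- by move=> ht; rewrite gM ?normrN// gM// mulr0 addr0.
- by rewrite opprK; ring.
Qed.

Corollary ess_spectrum_invariant : ess_spectrum V2 A2 = ess_spectrum V1 A1.
Proof.
have e1 w := ess_spectrum_calculus ipP calc1 (res_space_lin AT1) (graph_space AT1)
  (graph_lin AT1) (graph_sym ipP AT1) w.
have e2 w := ess_spectrum_calculus ipP calc2 (res_space_lin AT2) (graph_space AT2)
  (graph_lin AT2) (graph_sym ipP AT2) w.
apply/seteqP; split=> w hw; apply: contrapT.
  move=> /e1[f [f0 fw tf]]; have /(_ _) : ~ ~ ess_spectrum V2 A2 w by apply.
  apply; apply/e2; exists f; split=> //.
  have := tb_operatorD (compact_diff_C0 f0).2 tf; congr tb_operator.
  by apply/funext => u; rewrite subrK.
move=> /e2[f [f0 fw tf]]; have /(_ _) : ~ ~ ess_spectrum V1 A1 w by apply.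
apply; apply/e1; exists f; split=> //.
have := tb_operatorB tf (compact_diff_C0 f0).2; congr tb_operator.
by apply/funext => u; rewrite subKr.
Qed.

End comparison.

(** * The space L^2 *)

Section L2_space.
Context d (T : measurableType d) (R : realType) (mu : {measure set T -> \bar R}).
Implicit Types (u v w : L2 mu) (f g : T -> R).

Definition L2_int (u v : L2 mu) : R := \int[mu]_x ((u x : R) * (v x : R)).

Let mL2 u : measurable_fun setT (u : T -> R) := Lspace_measurable u.
Hint Resolve mL2 : core.

Lemma L2_Lfun u : (u : T -> R) \in Lfun mu 2%:E.
Proof. exact: (LfunP (Lspace_repr u)). Qed.

Lemma L2_mul_integrable u v : mu.-integrable setT (EFin \o (fun x => (u x : R) * v x)).
Proof. exact/Lfun1_integrable/(Lfun2_mul_Lfun1 (L2_Lfun u) (L2_Lfun v)). Qed.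

Lemma Lnorm2_sqr f : ('N[mu]_2%:E[EFin \o f] `^ 2 = \int[mu]_x (f x ^+ 2)%:E)%E.
Proof.
rewrite poweR_Lnorm//; apply: eq_integral => x _ /=.
by rewrite powR_mulrn// real_normK// num_real.
Qed.

Lemma L2_norm_sqr u : ((`|u| ^+ 2)%:E = \int[mu]_x ((u x : R) ^+ 2)%:E)%E.
Proof.
rewrite -Lnorm2_sqr.
have h : (`|u|%:E = 'N[mu]_2%:E[EFin \o (u : T -> R)])%E.
  exact: (finite_norm_fine (Lspace_repr u)).
by rewrite -h poweR_EFin powR_mulrn.
Qed.

Lemma L2_of f : measurable_fun setT f -> (\int[mu]_x (f x ^+ 2)%:E < +oo)%E ->
  exists u : L2 mu, u = f %[ae mu].
Proof.
move=> mf foo.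
have fL : f \in Lfun mu 2%:E.
  apply/andP; split; first by rewrite inE.
  rewrite inE /finLfun /finite_norm /=.
  by apply: (@lty_poweRy _ _ 2) => //; rewrite Lnorm2_sqr.
exists (Lspace_class (Lfun_Sub (lee1n 2) fL)); exact: Lspace_classE.
Qed.

Lemma ae_eq_Rintegral f g : measurable_fun setT f -> measurable_fun setT g ->
  f = g %[ae mu] -> \int[mu]_x f x = \int[mu]_x g x.
Proof.
move=> mf mg fg; rewrite /Rintegral; congr fine.
apply: ae_eq_integral => //; try exact/measurable_EFinP.
by apply: filterS fg => x /= /[apply] ->.
Qed.

Lemma ae_Rintegral_le f g : mu.-integrable setT (EFin \o f) -> mu.-integrable setT (EFin \o g) ->
  (\forall x \ae mu, f x <= g x) -> \int[mu]_x f x <= \int[mu]_x g x.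
Proof.
move=> if_ ig fg.
have mf : measurable_fun setT f by exact/measurable_EFinP/(measurable_int _ if_).
have mg : measurable_fun setT g by exact/measurable_EFinP/(measurable_int _ ig).
have ifg : mu.-integrable setT (EFin \o (fun x => g x - f x)).
  have := integrableB measurableT ig if_; congr (mu.-integrable _ _); exact/funext.
rewrite -subr_ge0 -RintegralB//.
have -> : \int[mu]_x (g x - f x) = \int[mu]_x `|g x - f x|.
  apply: ae_eq_Rintegral; first exact: measurable_funB.
    by apply: measurableT_comp => //; exact: measurable_funB.
  by apply: filterS fg => x h _; rewrite ger0_norm ?subr_ge0.
by apply: Rintegral_ge0.
Qed.

Lemma L2_ae_mulD u v w : (fun x => ((u + v) x : R) * w x) = (fun x => (u x : R) * w x + (v x : R) * w x) %[ae mu].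
Proof. by apply: filterS (Lspace_addE u v) => x /[apply] ->; rewrite mulrDl. Qed.

Lemma L2_inner_product : inner_product L2_int.
Proof.
split.
- move=> u v w; rewrite /L2_int -RintegralD//; try exact: L2_mul_integrable.
  apply: ae_eq_Rintegral; [exact: measurable_funM| |exact: L2_ae_mulD].
  by apply: measurable_funD; exact: measurable_funM.
- move=> a u w; rewrite /L2_int -RintegralZl//; try exact: L2_mul_integrable.
  apply: ae_eq_Rintegral; first exact: measurable_funM.
    by apply: measurable_funM => //; exact: measurable_funM.
  by apply: filterS (Lspace_scaleE a u) => x /[apply] ->; rewrite mulrA.
- by move=> u v; rewrite /L2_int; congr fine; apply: eq_integral => x _; rewrite mulrC.
- move=> u; rewrite /L2_int /Rintegral.
  by have := L2_norm_sqr u => /(congr1 (@fine R)) /= ->; congr fine; apply: eq_integral.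
Qed.

Lemma L2_ext u v : (\forall x \ae mu, u x = v x :> R) -> u = v.
Proof. by move=> h; apply: Lspace_eqP; apply: filterS h => x ->. Qed.

Lemma L2_norm_le u v : (\forall x \ae mu, `|u x : R| <= `|v x : R|) -> `|u| <= `|v|.
Proof.
move=> h; rewrite -(@ler_pXn2r _ 2)// ?nnegrE// -lee_fin !L2_norm_sqr.
apply: ae_ge0_le_integral => //.
- by move=> x _; rewrite lee_fin sqr_ge0.
- exact/measurable_EFinP/measurable_funX.
- by move=> x _; rewrite lee_fin sqr_ge0.
- exact/measurable_EFinP/measurable_funX.
apply: filterS h => x h _; rewrite lee_fin.
by rewrite -(real_normK (num_real (u x))) -(real_normK (num_real (v x))) ler_pXn2r.
Qed.

Lemma L2_int_le u v u' v' : (\forall x \ae mu, (u x : R) * v x <= (u' x : R) * v' x) ->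
  L2_int u v <= L2_int u' v'.
Proof. by move=> h; apply: ae_Rintegral_le => //; exact: L2_mul_integrable. Qed.

Lemma L2_ae0 : \forall x \ae mu, (0 : L2 mu) x = 0 :> R.
Proof. by apply: filterS (Lspace_zeroE mu (lee1n 2)) => x /(_ I). Qed.

Lemma L2_aeD u v : \forall x \ae mu, (u + v) x = (u x : R) + v x :> R.
Proof. by apply: filterS (Lspace_addE u v) => x /(_ I). Qed.

Lemma L2_aeN u : \forall x \ae mu, (- u) x = - (u x : R) :> R.
Proof. by apply: filterS (Lspace_oppE u) => x /(_ I). Qed.

Lemma L2_aeB u v : \forall x \ae mu, (u - v) x = (u x : R) - v x :> R.
Proof. by near=> x; rewrite (near (L2_aeD u (- v)) x)// (near (L2_aeN v) x).
Unshelve. all: by end_near. Qed.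

Lemma L2_aeZ a u : \forall x \ae mu, (a *: u) x = a * (u x : R) :> R.
Proof. by apply: filterS (Lspace_scaleE a u) => x /(_ I). Qed.

Lemma L2_int_ge0 u v : (\forall x \ae mu, 0 <= (u x : R)) -> (\forall x \ae mu, 0 <= (v x : R)) ->
  0 <= L2_int u v.
Proof.
move=> u0 v0; rewrite -(ip0l L2_inner_product 0); apply: L2_int_le.
near=> x; rewrite (near L2_ae0 x)// mul0r mulr_ge0//.
  exact: (near u0 x).
exact: (near v0 x).
Unshelve. all: by end_near. Qed.

Lemma L2_dom f u : measurable_fun setT f -> (\forall x \ae mu, `|f x| <= `|u x : R|) ->
  exists2 v : L2 mu, \forall x \ae mu, v x = f x :> R & `|v| <= `|u|.
Proof.
move=> mf fu; have [|v vf] := L2_of mf.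
  apply: (@le_lt_trans _ _ ((`|u| ^+ 2)%:E)); last exact: ltry.
  rewrite L2_norm_sqr; apply: ae_ge0_le_integral => //.
  - by move=> x _; rewrite lee_fin sqr_ge0.
  - exact/measurable_EFinP/measurable_funX.
  - by move=> x _; rewrite lee_fin sqr_ge0.
  - exact/measurable_EFinP/measurable_funX.
  apply: filterS fu => x h _; rewrite lee_fin.
  by rewrite -(real_normK (num_real (u x))) -(real_normK (num_real (f x))) ler_pXn2r.
have vf' : \forall x \ae mu, v x = f x :> R by apply: filterS vf => x /(_ I).
exists v => //; apply: L2_norm_le; near=> x.
by rewrite (near vf' x)//; exact: (near fu x).
Unshelve. all: by end_near. Qed.

Lemma L2_markov u (c : R) : 0 < c -> (mu [set x | c <= `|u x : R|]%R < +oo)%E.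
Proof.
move=> c0.
have mc : measurable [set x | c <= `|u x : R|].
  rewrite -[X in measurable X]setTI; apply: measurable_fun_le => //.
  by apply: measurableT_comp.
have : ((c ^+ 2)%:E * mu [set x | (c <= `|u x : R|)%R] <= (`|u| ^+ 2)%:E)%E.
  rewrite L2_norm_sqr -integral_cst//.
  apply: (@le_trans _ _ (\int[mu]_(x in [set x | (c <= `|u x : R|)%R]) ((u x : R) ^+ 2)%:E)%E).
    apply: ge0_le_integral => //.
    - by move=> x _; rewrite lee_fin sqr_ge0.
    - exact/measurable_EFinP/measurable_funX/measurable_funTS.
    - move=> x /= h; rewrite lee_fin -(real_normK (num_real (u x))) ler_pXn2r ?nnegrE// ltW//.
  apply: ge0_subset_integral => //; first exact/measurable_EFinP/measurable_funX.
  by move=> x _; rewrite lee_fin sqr_ge0.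
move=> h; rewrite ltey; apply/eqP => S; move: h.
by rewrite S gt0_muley ?lte_fin ?exprn_gt0// leye_eq.
Qed.

Lemma cauchy_dyadic_cvg (v : nat -> R) (M : R) :
  (forall k, `|v k.+1 - v k| <= M * 2^-1 ^+ k) -> cvgn v.
Proof.
move=> hM; pose dv k := v k.+1 - v k.
have cs : cvgn (series dv).
  apply: normed_cvg; apply: series_le_cvg (hM) _ => [k|k|].
  - exact: normr_ge0.
  - exact: le_trans (normr_ge0 _) (hM k).
  by apply: is_cvg_geometric_series; rewrite ger0_norm ?invr_ge0// invf_lt1// ltr1n.
have -> : v = fun k => v 0%N + series dv k.
  apply/funext; elim => [|k IH]; first by rewrite /series /= big_geq// addr0.
  by rewrite /series /= big_nat_recr//= addrA -[_ + \sum_(_ <= _ < _) _]IH /dv addrC subrK.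
by apply: is_cvgD; [exact: is_cvg_cst|].
Qed.

Lemma dyadic_sum_le n : \sum_(0 <= k < n) (4^-1 ^+ k) <= 2 :> R.
Proof.
suff -> : \sum_(0 <= k < n) (4^-1 ^+ k) = 4 / 3 - 4 / 3 * 4^-1 ^+ n :> R.
  have : 0 <= 4^-1 ^+ n :> R by rewrite exprn_ge0.
  by move: (4^-1 ^+ n) => y; lra.
elim: n => [|n IH]; first by rewrite big_geq// expr0; field.
by rewrite big_nat_recr//= IH exprS; field.
Qed.

(** Riesz-Fischer: a subsequence with steps at most [4^-k] converges almost everywhere, and Fatou's
    lemma identifies the pointwise limit as the limit in norm. *)
Lemma L2_complete : cauchy_complete (L2 mu).
Proof.
move=> x_ hx.
pose del k : R := 4^-1 ^+ k.
have del0 k : 0 < del k by rewrite exprn_gt0.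
have /choice[N_ hN] k : exists N, forall i j, (N <= i)%N -> (N <= j)%N ->
  `|x_ i - x_ j| <= del k by exact: hx.
pose n_ k := (\sum_(j < k.+1) N_ j)%N.
have nN k : (N_ k <= n_ k)%N by rewrite /n_ big_ord_recr /= leq_addl.
have nS k : (n_ k <= n_ k.+1)%N by rewrite [X in (_ <= X)%N]/n_ big_ord_recr /= leq_addr.
have nmono k l : (k <= l)%N -> (n_ k <= n_ l)%N.
  by move=> /subnK <-; elim: (l - k)%N => // j IH; rewrite addSn (leq_trans IH).
pose v k : L2 mu := x_ (n_ k).
have vv k l : (k <= l)%N -> `|v l - v k| <= del k.
  by move=> kl; apply: hN => //; rewrite (leq_trans (nN k))// nmono.
have mv k : measurable_fun setT (v k : T -> R) by exact: mL2.
pose D k x : R := (v k.+1 x : R) - v k x.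
have mD k : measurable_fun setT (D k) by exact: measurable_funB.
have intD k l : (\int[mu]_x (((v l x : R) - v k x) ^+ 2)%:E = (`|v l - v k| ^+ 2)%:E)%E.
  rewrite L2_norm_sqr; apply: ge0_ae_eq_integral => //.
  - exact/measurable_EFinP/measurable_funX/measurable_funB.
  - exact/measurable_EFinP/measurable_funX/mL2.
  - by move=> y _; rewrite lee_fin sqr_ge0.
  - by move=> y _; rewrite lee_fin sqr_ge0.
  by apply: filterS (L2_aeB (v l) (v k)) => y -> _.
(* Each weighted term has integral at most [4^k * 16^-k = 4^-k], so S is integrable; where S is
   finite, [|D k x| <= sqrt (S x) * 2^-k] makes the increments summable. *)
pose S x : \bar R := (\sum_(0 <= k <oo) ((4 ^+ k) * D k x ^+ 2)%:E)%E.
have S0 k x : (0 <= ((4 ^+ k : R) * D k x ^+ 2)%:E)%E.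
  by rewrite lee_fin mulr_ge0 ?sqr_ge0 ?exprn_ge0.
have mS k : measurable_fun setT (fun x => ((4 ^+ k : R) * D k x ^+ 2)%:E).
  by apply/measurable_EFinP/measurable_funM => //; exact: measurable_funX.
have intS : (\int[mu]_x S x <= 2%:E)%E.
  rewrite /S integral_nneseries//.
  apply: lime_le; first by apply: is_cvg_nneseries => k _ _; apply: integral_ge0 => x _; exact: S0.
  apply: nearW => n; rewrite (le_trans _ (_ : (\sum_(0 <= k < n) (4^-1 ^+ k))%:E <= _)%E)//; last first.
    by rewrite lee_fin dyadic_sum_le.
  rewrite -sumEFin; apply: lee_sum => k _.
  under eq_integral do rewrite EFinM.
  rewrite ge0_integralZl//; last 2 first.
  - exact/measurable_EFinP/measurable_funX.
  - by move=> y _; rewrite lee_fin sqr_ge0.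
  rewrite intD -EFinM lee_fin.
  have h : `|v k.+1 - v k| ^+ 2 <= (4^-1 ^+ k) ^+ 2 by rewrite ler_pXn2r ?nnegrE ?vv// ltW.
  rewrite (le_trans (ler_wpM2l _ h)) ?exprn_ge0//.
  by rewrite expr2 mulrA -exprMn mulfV// expr1n mul1r.
have mSS : measurable_fun setT S by apply: ge0_emeasurable_sum => // *; exact: S0.
have Sge0 x : (0 <= S x)%E by apply: nneseries_ge0 => *; exact: S0.
have Sfin : \forall x \ae mu, S x \is a fin_num.
  have : mu.-integrable setT S.
    apply/integrableP; split=> //.
    under eq_integral do rewrite gee0_abs//.
    exact: le_lt_trans intS (ltry _).
  by move/(integrable_ae measurableT); apply: filterS => x /(_ I).
have vcvg : \forall x \ae mu, cvgn (fun k => v k x : R).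
  apply: filterS Sfin => x Sx; pose M := fine (S x).
  have M0 : 0 <= M by rewrite fine_ge0.
  apply: (@cauchy_dyadic_cvg _ (Num.sqrt M)) => k.
  have h : 4 ^+ k * D k x ^+ 2 <= M.
    rewrite -lee_fin fineK//; apply: le_trans (nneseries_lim_ge k.+1 _) => [|*]; last exact: S0.
    by rewrite big_nat_recr//= leeDr// sume_ge0.
  rewrite -[leLHS]sqrtr_sqr -[X in _ * X]ger0_norm ?exprn_ge0// -[ `|_ ^+ k| ]sqrtr_sqr -sqrtrM//.
  rewrite ler_wsqrtr// -(@ler_pM2l _ (4 ^+ k)) ?exprn_gt0// (le_trans h)//.
  rewrite mulrCA -exprM mulnC exprM -exprMn (_ : 4 * _ = 1) ?expr1n ?mulr1//.
  by field.
(* The upper limit is measurable everywhere, and [fine] gives it a real value also where the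
   sequence diverges. *)
pose w x : R := fine (limn_esup (fun k => (v k x : R)%:E)).
have mw : measurable_fun setT w.
  apply: measurableT_comp; first exact: fine_measurable.
  by apply: measurable_fun_limn_esup => k; exact/measurable_EFinP.
have vw : \forall x \ae mu, (fun k => v k x : R) @ \oo --> w x.
  apply: filterS vcvg => x cx.
  have cx' : (fun k => (v k x : R)%:E) @ \oo --> (limn (fun k => v k x : R))%:E.
    by apply: cvg_EFin; [exact: nearW|exact: cx].
  by rewrite /w (cvg_limn_einf_sup cx').2.
have fat k : (\int[mu]_x ((w x - v k x) ^+ 2)%:E <= (del k ^+ 2)%:E)%E.
  have mlk l : measurable_fun setT (fun x => (((v l x : R) - v k x) ^+ 2)%:E).
    exact/measurable_EFinP/measurable_funX/measurable_funB.
  have flk l y : setT y -> (0 <= (((v (l + k)%N y : R) - v k y) ^+ 2)%:E)%E.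
    by rewrite lee_fin sqr_ge0.
  have := fatou mu measurableT (fun l => mlk (l + k)%N) flk.
  move=> fatk; apply: le_trans (le_trans fatk _).
    apply: ae_ge0_le_integral => //.
    - by move=> y _; rewrite lee_fin sqr_ge0.
    - exact/measurable_EFinP/measurable_funX/measurable_funB.
    - move=> y _; rewrite limn_einf_lim; apply: lime_ge; first exact: is_cvg_einfs.
      by apply: nearW => l; apply: le_ereal_inf_tmp => _ [j _ <-]; exact: flk.
    - apply: measurableT_comp => //; apply: measurable_fun_limn_esup => l.
      by apply: measurableT_comp => //; exact: mlk.
    apply: filterS vw => x cx _.
    have : (fun l => (((v (l + k)%N x : R) - v k x) ^+ 2)%:E) @ \oo --> ((w x - v k x) ^+ 2)%:E.
      apply: cvg_EFin; first exact: nearW.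
      have h : (fun l => (v (l + k)%N x : R) - v k x) @ \oo --> w x - v k x.
        have cxk : (fun l => v (l + k)%N x : R) @ \oo --> w x.
          by have := cx; rewrite -(cvg_shiftn k).
        exact: cvgB cxk (cvg_cst _).
      by rewrite [X in X @ _](_ : _ =
        (fun l => ((v (l + k)%N x : R) - v k x) * ((v (l + k)%N x : R) - v k x)))//; exact: (cvgM (h) (h)).
    by move/cvg_limn_einf_sup => [-> _].
  rewrite limn_einf_lim; apply: lime_le; first exact: is_cvg_einfs.
  apply: nearW => l; apply: (le_trans (ereal_inf_lbound _)).
    by exists l => //=; exact: leqnn.
  by rewrite lee_fin ler_pXn2r ?nnegrE ?vv ?leq_addl// ltW.
(* Fatou's lemma bounds only differences, so the limit is recovered as [v 0] plus a square
   integrable function. *)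
have /L2_of/(_ (le_lt_trans (fat 0%N) (ltry _)))[z zE] :
  measurable_fun setT (fun x => w x - v 0%N x) by exact: measurable_funB.
exists (v 0%N + z) => e e0.
have uw : \forall x \ae mu, (v 0%N + z) x = w x :> R.
  near=> x; rewrite (near (L2_aeD (v 0%N) z) x)//.
  have -> : z x = w x - v 0%N x :> R by exact: (near zE x).
  by rewrite addrC subrK.
have uv k : `|v 0%N + z - v k| <= del k.
  rewrite -(@ler_pXn2r _ 2)// ?nnegrE ?(ltW (del0 k))// -lee_fin.
  rewrite L2_norm_sqr (le_trans _ (fat k))//; apply: ae_ge0_le_integral => //.
  - by move=> y _; rewrite lee_fin sqr_ge0.
  - exact/measurable_EFinP/measurable_funX/mL2.
  - by move=> y _; rewrite lee_fin sqr_ge0.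
  - exact/measurable_EFinP/measurable_funX/measurable_funB.
  near=> x => _; rewrite (near (L2_aeB (v 0%N + z) (v k)) x)//.
  by rewrite (near uw x).
have e20 : 0 < e / 2 by rewrite divr_gt0.
have [k hk] := exists_inv_lt e20.
have dk : del k <= e / 2.
  apply: le_trans (hk k (leqnn _)); rewrite /del exprVn lef_pV2 ?posrE ?ltr0n ?exprn_gt0//.
  by rewrite -natrX ler_nat; elim: (k) => // j IH; rewrite expnS; lia.
exists (N_ k) => i iN.
rewrite -(subrKA (v k)) (splitr e) (le_trans (ler_normD _ _))// lerD//.
  by rewrite (le_trans (hN _ _ _ iN (nN k))).
by rewrite distrC (le_trans (uv k)).
Unshelve. all: by end_near. Qed.

End L2_space.

Section multiplication_by_indicator.
Context (R : realType) (X : pmetricType R) (m : {measure set (borel X) -> \bar R}).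
Implicit Types (u v w : L2 m) (F : set (borel X)).

Let ipP : inner_product (@L2ip R X m) := L2_inner_product m.

Lemma mul_indicE F u : measurable F ->
  \forall x \ae m, mul_indic F u x = \1_F x * (u x : R) :> R.
Proof.
move=> mF; suff : mul_indic F u = (fun x => \1_F x * u x) %[ae m].
  by apply: filterS => x /(_ I).
apply: (@xgetPex _ 0 [set v : L2 m | v = (fun x => \1_F x * u x) %[ae m]]).
have [||v vE _] := L2_dom (f := fun x => \1_F x * (u x : R)) (u := u).
- by apply: measurable_funM; [exact: measurable_indic|exact: Lspace_measurable].
- apply: aeW => x; rewrite normrM -[leRHS]mul1r ler_wpM2r//.
  by rewrite indicE; case: (_ \in _); rewrite ?normr1 ?normr0.
- by exists v => /=; apply: filterS vE => x ->.
Qed.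

Lemma mul_indic_norm_le F u : measurable F -> `|mul_indic F u| <= 1 * `|u|.
Proof.
move=> mF; rewrite mul1r; apply: L2_norm_le; apply: filterS (mul_indicE u mF) => x ->.
rewrite normrM -[leRHS]mul1r ler_wpM2r//.
by rewrite indicE; case: (_ \in _); rewrite ?normr1 ?normr0.
Qed.

Lemma mul_indic_linear F : measurable F -> linear (@mul_indic R X m F).
Proof.
move=> mF a u v; apply: L2_ext; near=> x.
rewrite (near (mul_indicE (a *: u + v) mF) x)//.
rewrite (near (L2_aeD (a *: u) v) x)// (near (L2_aeZ a u) x)//.
rewrite (near (L2_aeD (a *: mul_indic F u) (mul_indic F v)) x)//.
rewrite (near (L2_aeZ a (mul_indic F u)) x)// (near (mul_indicE u mF) x)//.
by rewrite (near (mul_indicE v mF) x)// mulrDr mulrCA.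
Unshelve. all: by end_near. Qed.

Lemma mul_indic_sym F u v : measurable F ->
  L2ip (mul_indic F u) v = L2ip u (mul_indic F v).
Proof.
move=> mF; apply: le_anti; apply/andP; split; apply: L2_int_le; near=> x;
  rewrite (near (mul_indicE u mF) x)// (near (mul_indicE v mF) x)//.
  by rewrite mulrCA mulrA.
by rewrite mulrCA mulrA.
Unshelve. all: by end_near. Qed.

Lemma indic_L2 F : measurable F -> (m F < +oo)%E ->
  exists u : L2 m, \forall x \ae m, u x = \1_F x :> R.
Proof.
move=> mF Foo; have [||u uE] := L2_of (mu := m) (f := \1_F).
- exact: measurable_indic.
- rewrite (_ : (\int[m]_x _)%E = m F)//.
  rewrite -[F in m F]setIT -integral_indic//; apply: eq_integral => x _.
  by rewrite indicE expr2 -natrM mulnb andbb.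
- by exists u; apply: filterS uE => x /(_ I).
Qed.

(** The sets are [{1/(n+1) <= |u| <= n}]: of finite measure by Chebyshev's inequality, and
    exhausting [{u <> 0}], so dominated convergence applies. *)
Lemma L2_truncate u (e : R) : 0 < e -> exists F, [/\ measurable F, (m F < +oo)%E,
  exists M : R, forall x, F x -> `|u x : R| <= M & `|u - mul_indic F u| <= e].
Proof.
move=> e0.
have mu_ : measurable_fun setT (u : borel X -> R) := Lspace_measurable u.
have mnu : measurable_fun setT (fun x : borel X => `|u x : R|) by exact: measurableT_comp.
pose F n : set (borel X) := [set x | n.+1%:R^-1 <= `|u x : R|] `&` [set x | `|u x : R| <= n%:R].
have mF n : measurable (F n).
  by apply: measurableI; rewrite -[X in measurable X]setTI; exact: measurable_fun_le.
have Foo n : (m (F n) < +oo)%E.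
  have n0 : 0 < n.+1%:R^-1 :> R by rewrite invr_gt0 ltr0n.
  apply: le_lt_trans (L2_markov u n0); apply: le_measure; rewrite ?inE//.
    by rewrite -[X in measurable X]setTI; exact: measurable_fun_le.
  by move=> x [].
pose g n x : R := (u x : R) - \1_(F n) x * (u x : R).
have mg n : measurable_fun setT (g n).
  by apply: measurable_funB => //; apply: measurable_funM => //; exact: measurable_indic.
have g_le n x : `|g n x| <= `|u x : R|.
  by rewrite /g indicE; case: (_ \in _); rewrite ?mul1r ?mul0r ?subrr ?normr0 ?subr0.
have [|||||_ _] := @dominated_convergence _ _ _ m setT measurableT
  (fun n x => (g n x ^+ 2)%:E) (cst 0%E) (fun x => ((u x : R) ^+ 2)%:E).
- by move=> n; exact/measurable_EFinP/measurable_funX.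
- exact: measurable_cst.
- apply: aeW => x _; apply: cvg_near_cst.
  have [ux|ux] := eqVneq (u x : R) 0.
    by apply: nearW => n; rewrite /g ux mulr0 subrr expr0n.
  have nux : 0 < `|u x : R| by rewrite normr_gt0.
  have [N hN] := exists_inv_lt nux.
  exists (maxn N (Num.truncn `|u x : R|).+1) => // n /=; rewrite geq_max => /andP[Nn nn].
  rewrite /g indicE mem_set ?mul1r ?subrr ?expr0n//.
  split => /=; first exact: hN.
  by rewrite ltW// (lt_le_trans (truncnS_gt _))// ler_nat.
- exact: (L2_mul_integrable u u).
- apply: aeW => x n _; rewrite gee0_abs ?lee_fin ?sqr_ge0//.
  by rewrite -(real_normK (num_real (g n x))) -(real_normK (num_real (u x))) ler_pXn2r.
rewrite /= integral0 => /fine_cvgP[_ /cvgrPdist_le].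
have e20 : 0 < e ^+ 2 by rewrite exprn_gt0.
move=> /(_ _ e20)[N _ /(_ N (leqnn _))] /=; rewrite sub0r normrN => hN.
exists (F N); split=> //; first by exists N%:R => x [].
rewrite -(@ler_pXn2r _ 2)// ?nnegrE ?(ltW e0)//.
apply: le_trans hN; rewrite ger0_norm; last first.
  by apply: fine_ge0; apply: integral_ge0 => x _; rewrite lee_fin sqr_ge0.
have -> : (\int[m]_x (g N x ^+ 2)%:E = (`|u - mul_indic (F N) u| ^+ 2)%:E)%E.
  rewrite L2_norm_sqr; apply: ge0_ae_eq_integral => //.
  - exact/measurable_EFinP/measurable_funX.
  - exact/measurable_EFinP/measurable_funX/Lspace_measurable.
  - by move=> y _; rewrite lee_fin sqr_ge0.
  - by move=> y _; rewrite lee_fin sqr_ge0.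
  near=> x => _; rewrite (near (L2_aeB u (mul_indic (F N) u)) x)//.
  by rewrite (near (mul_indicE u (mF N)) x).
by [].
Unshelve. all: by end_near. Qed.

End multiplication_by_indicator.

(** * Closed forms *)

Create HintDb form_dom.

Lemma lin_quad_eq0 (R : realFieldType) (b c : R) : 0 <= c ->
  (forall t, 0 <= 2 * t * b + t ^+ 2 * c) -> b = 0.
Proof.
move=> c0 h; have c1 : 0 < c + 1 by rewrite ltr_wpDl.
(* Nearly the minimizer [- b / c]; the [+ 1] admits [c = 0]. *)
have := h (- b / (c + 1)).
have -> : 2 * (- b / (c + 1)) * b + (- b / (c + 1)) ^+ 2 * c =
  - (b / (c + 1)) ^+ 2 * (c + 2) by field; rewrite gt_eqF.
rewrite mulNr oppr_ge0 pmulr_lle0; last lra.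
rewrite le_eqVlt ltNge sqr_ge0 orbF sqrf_eq0 mulf_eq0 invr_eq0 (gt_eqF c1) orbF.
by move/eqP.
Qed.

Section closed_forms.
Context (R : realType) (H : normedModType R) (ip : H -> H -> R).
Hypothesis ipP : inner_product ip.
Context (E : energy_form H).
Hypothesis cE : closed_form E.
Implicit Types (u v w z : H) (W : set H).

Local Notation D := (fdom E).
Definition form1 u v : R := fval E u v + ip u v.
Local Notation q := form1.
Local Notation N u := (form1 u u).

Lemma fdomD u v : D u -> D v -> D (u + v).
Proof. by move=> Du Dv; rewrite -[u]scale1r; exact: fdom_lin. Qed.

Lemma fdomZ a u : D u -> D (a *: u).
Proof. by move=> Du; rewrite -[_ *: _]addr0; apply: fdom_lin => //; exact: fdom0. Qed.

Lemma fdomN u : D u -> D (- u).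
Proof. by move=> Du; rewrite -scaleN1r; exact: fdomZ. Qed.

Ltac form_dom := lazymatch goal with
  | |- fdom _ (@GRing.add _ _ _) => apply: fdomD; form_dom
  | |- fdom _ (@GRing.opp _ _) => apply: fdomN; form_dom
  | |- fdom _ (@GRing.scale _ _ _ _) => apply: fdomZ; form_dom
  | |- fdom _ (@GRing.zero _) => exact: fdom0
  | _ => first [assumption|solve [auto with form_dom nocore]]
  end.
Hint Extern 0 (fdom E _) => form_dom : core.

Lemma form1C u v : D u -> D v -> q u v = q v u.
Proof. by move=> Du Dv; rewrite /q (fval_sym cE Du Dv) (ipC ipP). Qed.

Lemma form1Dl u v w : D u -> D v -> D w -> q (u + v) w = q u w + q v w.
Proof.
move=> Du Dv Dw; rewrite /q (ipDl ipP).
have := fval_lin cE 1 Du Dv Dw; rewrite scale1r mul1r => ->; ring.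
Qed.

Lemma form1Zl a u w : D u -> D w -> q (a *: u) w = a * q u w.
Proof.
move=> Du Dw; have D0 := fdom0 cE.
have q0 : q 0 w = 0 by apply: (addrI (q 0 w)); rewrite -form1Dl// !addr0.
move: q0; rewrite /q (ip0l ipP) addr0 => f0; rewrite (ipZl ipP).
by have := fval_lin cE a Du D0 Dw; rewrite addr0 f0 addr0 => ->; rewrite mulrDr.
Qed.

Lemma form1Nl u w : D u -> D w -> q (- u) w = - q u w.
Proof. by move=> Du Dw; rewrite -scaleN1r form1Zl// mulN1r. Qed.

Lemma form1Dr u v w : D u -> D v -> D w -> q w (u + v) = q w u + q w v.
Proof. by move=> *; rewrite form1C// form1Dl// (@form1C u)// (@form1C v). Qed.

Lemma form1Zr a u w : D u -> D w -> q w (a *: u) = a * q w u.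
Proof. by move=> *; rewrite form1C// form1Zl// (@form1C u). Qed.

Lemma form1Nr u w : D u -> D w -> q w (- u) = - q w u.
Proof. by move=> *; rewrite form1C// form1Nl// (@form1C u). Qed.

Definition form1E := (form1Dl, form1Dr, form1Nl, form1Nr, form1Zl, form1Zr).

Lemma norm_le_form1 u : D u -> `|u| ^+ 2 <= N u.
Proof. by move=> Du; rewrite /q (ipE ipP) lerDr fval_ge0. Qed.

Lemma form1_ge0 u : D u -> 0 <= N u.
Proof. by move=> Du; rewrite (le_trans _ (norm_le_form1 Du))// sqr_ge0. Qed.

Lemma form1_eq0 u : D u -> N u <= 0 -> u = 0.
Proof.
move=> Du N0; apply/normr0_eq0/eqP; rewrite -sqrf_eq0 eq_le sqr_ge0 andbT.
exact: le_trans (norm_le_form1 Du) N0.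
Qed.

Lemma energy_normE u : energy_norm E u = Num.sqrt (N u).
Proof. by rewrite /energy_norm /q (ipE ipP). Qed.

Lemma energy_norm_lt u e : 0 < e -> D u -> (energy_norm E u < e) = (N u < e ^+ 2).
Proof.
move=> e0 Du; rewrite energy_normE -[in LHS](ger0_norm (ltW e0)) -sqrtr_sqr.
by rewrite ltr_sqrt ?exprn_gt0.
Qed.

Lemma form1_CS u v : D u -> D v -> q u v ^+ 2 <= N u * N v.
Proof.
move=> Du Dv; have [v0|v0] := eqVneq (N v) 0.
  have -> : v = 0 by apply: form1_eq0 => //; rewrite v0.
  by rewrite -(scale0r 0) !form1Zr// ?mul0r ?mulr0 ?expr0n.
have Nv : 0 < N v by rewrite lt_def v0 form1_ge0.
have : 0 <= N (N v *: u - q u v *: v) by apply: form1_ge0.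
rewrite !form1E//.
rewrite (form1C Dv Du) => h.
by rewrite -(ler_pM2l Nv) -subr_ge0 (le_trans h)// le_eqVlt; apply/orP; left; apply/eqP; ring.
Qed.

Lemma form1_triangle u v : D u -> D v -> N (u + v) <= 2 * N u + 2 * N v.
Proof.
move=> Du Dv; have : 0 <= N (u - v) by apply: form1_ge0.
rewrite !form1E// (form1C Dv Du); lra.
Qed.

Definition form1_lim (w_ : nat -> H) z :=
  forall e : R, 0 < e -> exists n0, forall n, (n0 <= n)%N -> N (w_ n - z) <= e.

Lemma form1_complete (w_ : nat -> H) : (forall n, D (w_ n)) ->
  (forall e : R, 0 < e -> exists n0, forall i j, (n0 <= i)%N -> (n0 <= j)%N ->
    N (w_ i - w_ j) <= e) ->
  exists2 z, D z & form1_lim w_ z.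
Proof.
move=> Dw hw; have [|z Dz hz] := fval_closed cE Dw.
  move=> e e0; have e20 : 0 < e ^+ 2 / 2 by rewrite divr_gt0 ?exprn_gt0.
  have [n0 hn] := hw _ e20; exists n0 => i j ni nj.
  rewrite energy_norm_lt//.
  by rewrite (le_lt_trans (hn _ _ ni nj))// ltr_pdivrMr// ltr_pMr ?exprn_gt0// ltr1n.
exists z => // e e0.
have s0 : 0 < Num.sqrt e by rewrite sqrtr_gt0.
move/cvgrPdist_lt : hz => /(_ _ s0)[n0 _ hn]; exists n0 => n nn.
have := hn n nn; rewrite /= sub0r normrN ger0_norm; last by rewrite sqrtr_ge0.
by rewrite energy_norm_lt ?sqr_sqrtr ?(ltW e0)//; move/ltW.
Qed.

(* A minimizing sequence is Cauchy by the parallelogram identity; varying [C n]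
   also yields closedness under weak limits. *)
Lemma nested_minimizers (C : nat -> set H) (J : H -> R) (a M : R) :
  (forall n u, C n u -> D u) -> (forall n u, C n.+1 u -> C n u) ->
  (forall n u v, C n u -> C n v -> C n (2^-1 *: (u + v))) ->
  (forall n u v, C n u -> C n v -> N (u - v) = 2 * J u + 2 * J v - 4 * J (2^-1 *: (u + v))) ->
  (forall n u, C n u -> a <= J u) -> (forall n, exists2 u, C n u & J u <= M) ->
  exists (w_ : nat -> H) z, [/\ forall n, C n (w_ n),
    forall n v, C n v -> J (w_ n) <= J v + n.+1%:R^-1, D z & form1_lim w_ z].
Proof.
move=> CD CS Cmid Jmid Ja JM.
have Cle n k u : (n <= k)%N -> C k u -> C n u.
  by move=> /subnK <-; elim: (k - n)%N => // j IH; rewrite addSn => /CS.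
pose S n : set R := [set J u | u in C n].
have hS n : has_inf (S n).
  split; first by have [u Cu _] := JM n; exists (J u), u.
  by exists a => _ [u Cu <-]; exact: Ja Cu.
have Sinf n v : C n v -> inf (S n) <= J v.
  by move=> Cv; apply: ge_inf; [exact: (hS n).2|exists v].
have SM n : inf (S n) <= M by have [u Cu /(le_trans (Sinf _ _ Cu))] := JM n.
have Smono n k : (n <= k)%N -> inf (S n) <= inf (S k).
  move=> nk; apply: lb_le_inf; first exact: (hS k).1.
  by move=> _ [u Cu <-]; exact: Sinf (Cle _ _ _ nk Cu).
have /choice[w_ hw] n : exists w, C n w /\ J w <= inf (S n) + n.+1%:R^-1.
  have i0 : 0 < n.+1%:R^-1 :> R by rewrite invr_gt0 ltr0n.
  by have [_ [w Cw <-] /ltW] := inf_adherent i0 (hS n); exists w.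
(* The infima increase with [n] towards [sup I]. Once one of them is close to it, every midpoint has
   [J] almost as large as the near-minimizers, which forces their difference to be small. *)
pose I := [set inf (S n) | n in [set: nat]].
have hI : has_sup I.
  by split; [exists (inf (S 0%N)), 0%N|exists M => _ [n _ <-]; exact: SM].
have Isup n : inf (S n) <= sup I by apply: ub_le_sup; [exact: hI.2|exists n].
have [||z Dz hz] := @form1_complete w_.
- by move=> n; exact: CD (hw n).1.
- move=> e e0; have e80 : 0 < e / 8 by rewrite divr_gt0.
  have [_ [k _ <-] hk] := sup_adherent e80 hI.
  have [l hl] := exists_inv_lt e80.
  exists (maxn k l) => i j; rewrite !geq_max => /andP[ki li] /andP[kj lj].
  have Cki := Cle _ _ _ ki (hw i).1; have Ckj := Cle _ _ _ kj (hw j).1.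
  rewrite (Jmid _ _ _ Cki Ckj).
  have h1 := Sinf _ _ (Cmid _ _ _ Cki Ckj).
  have := (hw i).2; have := (hw j).2; have := hl i li; have := hl j lj.
  have := Isup i; have := Isup j; move: h1 hk.
  move: (J (2^-1 *: _)) (inf (S k)) (inf (S i)) (inf (S j)) (J (w_ i)) (J (w_ j))
    (i.+1%:R^-1) (j.+1%:R^-1) (sup I) => *.
  lra.
exists w_, z; split=> //; first by move=> n; exact: (hw n).1.
by move=> n v Cv; rewrite (le_trans (hw n).2)// lerD2r Sinf.
Qed.

Lemma form1_limB (w_ : nat -> H) z u : (forall n, D (w_ n)) -> D z -> D u -> form1_lim w_ z ->
  forall e : R, 0 < e -> exists n0, forall n, (n0 <= n)%N -> `|q (w_ n) u - q z u| <= e.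
Proof.
move=> Dw Dz Du wz e e0.
have Nu := form1_ge0 Du.
have [d d0 hd] := small_mul (exprn_gt0 2 e0) Nu.
have [n0 hn] := wz _ d0; exists n0 => n nn.
rewrite -(@ler_pXn2r _ 2)// ?nnegrE ?(ltW e0)// real_normK ?num_real//.
rewrite -form1Nl// -form1Dl//.
rewrite (le_trans (form1_CS _ _))//.
by rewrite mulrC (le_trans _ hd)// ler_wpM2l// hn.
Qed.

Definition form1_closed W := forall z, D z ->
  (forall e : R, 0 < e -> exists2 w, W w & N (w - z) <= e) -> W z.

Section subspace.
Context (W : set H).
Hypotheses (W0 : W 0) (Wlin : forall a u v, W u -> W v -> W (a *: u + v)).
Hypotheses (WD : W `<=` D) (Wcl : form1_closed W).

Let WDu u : W u -> D u. Proof. exact: WD. Qed.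
Hint Resolve WDu : form_dom.

Lemma form1_lim_closed (w_ : nat -> H) z : (forall n, W (w_ n)) -> D z -> form1_lim w_ z -> W z.
Proof.
move=> Ww Dz h; apply: Wcl => // e e0.
by have [n0 /(_ _ (leqnn n0)) hn] := h e e0; exists (w_ n0).
Qed.

(** The representing vector is the limit of a minimizing sequence of [N u - 2 l u]; a perturbation
    by [t *: v] then identifies the linear term. *)
Lemma riesz (l : H -> R) (c : R) : 0 <= c ->
  (forall a u v, W u -> W v -> l (a *: u + v) = a * l u + l v) ->
  (forall u, W u -> l u ^+ 2 <= c * N u) ->
  exists2 z, W z & forall v, W v -> q z v = l v.
Proof.
move=> c0 llin lc.
have l0 : l 0 = 0 by apply: (addrI (l 0)); rewrite -{1}[l 0]mul1r -llin// scale1r !addr0.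
have lZ a u : W u -> l (a *: u) = a * l u.
  by move=> Wu; rewrite -[a *: u]addr0 llin// l0 addr0.
have lD u v : W u -> W v -> l (u + v) = l u + l v.
  by move=> Wu Wv; rewrite -[u]scale1r llin// scale1r mul1r.
have WZ a u : W u -> W (a *: u) by move=> Wu; rewrite -[_ *: _]addr0; exact: Wlin.
have Wadd u v : W u -> W v -> W (u + v) by move=> Wu Wv; rewrite -[u]scale1r; exact: Wlin.
pose J u := N u - 2 * l u.
have [|//|n u v Wu Wv|n u v Wu Wv|n u Wu|n|w_ [z [Ww wJ Dz wz]]] :=
  @nested_minimizers (fun=> W) J (- c) 0.
- by [].
- by apply: WZ; exact: Wadd.
- rewrite /J lZ ?lD//; last exact: Wadd.
  by rewrite !form1E// (@form1C v u)//; field.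
- have Nu : 0 <= N u by apply: form1_ge0.
  (* From [4 c N <= (N + c)^2]; it yields the lower bound [- c] for J. *)
  have : (2 * l u) ^+ 2 <= (N u + c) ^+ 2.
    rewrite exprMn; have := lc u Wu; have := sqr_ge0 (N u - c).
    move: (N u) (l u) => *; lra.
  rewrite -(real_normK (num_real (2 * l u))) ler_pXn2r ?nnegrE ?(addr_ge0 Nu c0)// /J.
  by have := ler_norm (2 * l u); lra.
- by exists 0 => //; rewrite /J l0 mulr0 subr0 -(scale0r 0) form1Zl// mul0r.
exists z; first exact: form1_lim_closed wz.
move=> v Wv; apply/eqP; rewrite -subr_eq0; apply/eqP.
apply: (@lin_quad_eq0 _ _ (N v)); first exact: form1_ge0.
move=> t; apply: eps_le => e e0.
have t0 : 0 <= 2 * `|t| + 1 by rewrite addr_ge0 ?mulr_ge0.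
have [d d0 hd] := small_mul (e0 : 0 < (e : R)) t0.
have [n1 hn1] := form1_limB (fun n => WD (Ww n)) Dz (WD Wv) wz d0.
have [n2 hn2] := exists_inv_lt d0.
pose n := maxn n1 n2; have := hn1 n (leq_maxl _ _); have := hn2 n (leq_maxr _ _).
have := wJ n (w_ n + t *: v) (Wadd _ _ (Ww n) (WZ t v Wv)).
rewrite /J lD ?lZ//; last exact: WZ.
have Wn := Ww n; rewrite !form1E// (@form1C v (w_ n))//.
move=> h1 h2 h3.
have : `|t * (q (w_ n) v - q z v)| <= `|t| * d by rewrite normrM ler_wpM2l.
rewrite ler_norml => /andP[_]; move: (n.+1%:R^-1) h1 h2 hd => i.
by move: (N (w_ n)) (q (w_ n) v) (q z v) (N v) (l (w_ n)) (l v) (`|t|) => *; lra.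
Qed.

Lemma riesz_projection u : D u -> exists2 p, W p & forall v, W v -> q p v = q u v.
Proof.
move=> Du; apply: (@riesz (q u) (N u)); first exact: form1_ge0.
  by move=> a v w Wv Ww; rewrite !form1E.
by move=> v Wv; exact: form1_CS.
Qed.

Lemma riesz_resolvent h : exists2 p, W p & forall v, W v -> q p v = ip h v.
Proof.
apply: (@riesz (ip h) (`|h| ^+ 2)); first exact: sqr_ge0.
  by move=> a v w _ _; rewrite (ipDr ipP) (ipZr ipP).
move=> v Wv; rewrite (le_trans _ (ler_wpM2l (sqr_ge0 _) (norm_le_form1 (WD Wv))))//.
by rewrite -exprMn -(real_normK (num_real (ip h v))) ler_pXn2r ?nnegrE ?mulr_ge0// cauchy_schwarz.
Qed.

(** Nearly minimal elements of [W] for the form, under the shrinking constraint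
    [|w - u| <= 1/(n+1)], converge in the form norm; by the constraint their limit is [u]. This
    stands in for weak compactness. *)
Lemma form1_weak_closed u (M : R) :
  (forall e : R, 0 < e -> exists w, [/\ W w, N w <= M & `|w - u| <= e]) -> W u.
Proof.
move=> hu.
have Wadd a b : W a -> W b -> W (2^-1 *: (a + b)).
  by move=> Wa Wb; rewrite -[2^-1 *: _]addr0; apply: Wlin => //; rewrite -[a]scale1r; exact: Wlin.
have i0 n : 0 < n.+1%:R^-1 :> R by rewrite invr_gt0 ltr0n.
have [||n a b [Wa ha] [Wb hb]|n a b [Wa ha] [Wb hb]|n w [Ww _]|n|w_ [z [Ww _ Dz wz]]] :=
  @nested_minimizers (fun n w => W w /\ `|w - u| <= n.+1%:R^-1) (fun w => N w) 0 M.
- by move=> n w [/WD].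
- move=> n w [Ww h]; split=> //; rewrite (le_trans h)// lef_pV2 ?posrE ?ltr0n// ler_nat.
  exact: leqnSn.
- split; first exact: Wadd.
  have -> : 2^-1 *: (a + b) - u = 2^-1 *: (a - u) + 2^-1 *: (b - u).
    rewrite -scalerDr addrACA -opprD [RHS]scalerBr -[u + u]mulr2n -(scaler_nat 2 u) scalerA.
    by rewrite mulVf ?scale1r.
  rewrite (le_trans (ler_normD _ _))// !normrZ ger0_norm ?invr_ge0//.
  by move: (n.+1%:R^-1) ha hb => *; lra.
- by rewrite !form1E// (@form1C b a)//; field.
- exact: form1_ge0.
- by have [w [Ww Nw hw]] := hu _ (i0 n); exists w.
suff -> : u = z by apply: (form1_lim_closed (w_ := w_)) => // n; exact: (Ww n).1.
apply: (@seqlim_uniq _ _ w_) => e e0.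
  have [n0 hn] := exists_inv_lt e0; exists n0 => n nn.
  exact: le_trans (Ww n).2 (hn n nn).
have [n0 hn] := wz _ (exprn_gt0 2 e0); exists n0 => n nn.
rewrite -(@ler_pXn2r _ 2)// ?nnegrE ?(ltW e0)// (le_trans _ (hn n nn))//.
by apply: norm_le_form1; have := (Ww n).1; move=> /WD Dn; form_dom.
Qed.

End subspace.

(** * The resolvent of a closed form *)

Section resolvent.
Context (W V : set H) (T : H -> H).
Hypotheses (W0 : W 0) (Wlin : forall a u v, W u -> W v -> W (a *: u + v)).
Hypotheses (WD : W `<=` D) (WV : W `<=` V).
Hypotheses (TW : forall h, W (T h)) (TE : forall h v, W v -> q (T h) v = ip h v).

Let WDu u : W u -> D u. Proof. exact: WD. Qed.
Hint Resolve WDu : form_dom.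

Lemma form1_inj u v : W u -> W v -> (forall w, W w -> q u w = q v w) -> u = v.
Proof.
move=> Wu Wv h; apply/eqP; rewrite -subr_eq0; apply/eqP/form1_eq0; first by [].
have Wuv : W (u - v) by rewrite addrC -scaleN1r; exact: Wlin.
by rewrite form1Dl// form1Nl// (h _ Wuv) subrr.
Qed.

Lemma form_resolvent :
  (forall a u v, V u -> V v -> V (a *: u + v)) ->
  (forall x l, (forall n, V (x n)) -> seqlim x l -> V l) ->
  (forall x, exists2 p, V p & forall v, V v -> ip (x - p) v = 0) ->
  resolvent_at_m1 ip V (form_operator ip V (EnergyForm W (fval E))) T.
Proof.
move=> Vlin Vcl Vdec.
have Tq u : N (T u) = ip (T u) u by rewrite TE// (ipC ipP).
split=> //=.
- move=> a u v; apply: form1_inj => // [|w Ww]; first exact: Wlin.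
  have Tu := TW u; have Tv := TW v.
  by rewrite TE// !form1E// !TE// (ipDl ipP) (ipZl ipP).
- by move=> u v; have Tu := TW u; have Tv := TW v; rewrite -(TE u (TW v)) form1C// TE// (ipC ipP).
- by move=> u; rewrite -Tq; apply: form1_ge0; have := TW u.
- move=> u; rewrite -Tq.
  have : `|T u| ^+ 2 <= N (T u) by apply: norm_le_form1; have := TW u => /WD.
  rewrite Tq => h.
  have := sqr_ge0 (`|u| - `|T u|); have := cauchy_schwarz ipP (T u) u.
  have := ler_norm (ip (T u) u); rewrite sqrrB; lra.
- by move=> u; exact/WV.
- move=> u hu; apply: form1_eq0; first exact/WD.
  by rewrite Tq (ipC ipP) hu//; exact/WV.
- move=> u Vu; split=> /=; first exact: TW.
    by rewrite addrC -scaleN1r; apply: Vlin => //; exact/WV.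
  by move=> v Wv; have := TE u Wv; rewrite (ipBl ipP) /q => <-; rewrite addrK.
- move=> u v [/= Wu Vv h]; apply: form1_inj => // w Ww.
  by rewrite TE// (ipDl ipP) h// /q addrC.
- move=> a u v u' v' [/= Wu Vv h] [/= Wu' Vv' h']; split=> /=; [exact: Wlin|exact: Vlin|].
  by move=> w Ww; rewrite (ipDl ipP) (ipZl ipP) h// h'// (fval_lin cE)//; exact/WD.
- by move=> u v [/= /WV].
Qed.

End resolvent.
End closed_forms.

(** * Functions with compact support *)

Section compact_support.
Context (R : realType) (T : topologicalType).
Implicit Types (f g : T -> R) (U : set T).

Lemma Cc_sub U f g : Cc U f -> continuous g -> (forall x, f x = 0 -> g x = 0) -> Cc U g.
Proof.
move=> [_ kf fU] cg fg; have gf : supp g `<=` supp f.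
  by apply: closure_subset => x /= gx; apply/eqP => /fg/eqP; exact/negP.
split=> //; last exact: subset_trans gf fU.
by apply: (subclosed_compact _ kf gf); exact: closed_closure.
Qed.

Lemma Cc_lin U (a : R) f g : Cc U f -> Cc U g -> Cc U (fun x => a * f x + g x).
Proof.
move=> [cf kf fU] [cg kg gU]; have s : supp (fun x => a * f x + g x) `<=` supp f `|` supp g.
  rewrite /supp -closureU; apply: closure_subset => x /= fgx.
  have [fx|fx] := eqVneq (f x) 0; [right|left] => //.
  by apply: contra_neq fgx => ->; rewrite fx mulr0 addr0.
split; [|by apply: (subclosed_compact _ (compactU kf kg) s); exact: closed_closure|].
  by move=> x; apply: cvgD; [apply: cvgM; [exact: cvg_cst|exact: cf]|exact: cg].
by apply: subset_trans s _ => x [/fU|/gU].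
Qed.

Lemma Cc0 U : Cc U (fun=> 0 : R).
Proof.
have s0 : supp (fun=> 0 : R) = set0 :> set T.
  rewrite /supp (_ : [set x | _] = set0) ?closure0//.
  by apply/seteqP; split=> // x /=; rewrite eqxx.
by split; [move=> x; exact: cvg_cst|rewrite s0; exact: compact0|rewrite s0].
Qed.

Lemma Cc_bounded U f : Cc U f -> exists2 M : R, 0 <= M & forall x, `|f x| <= M.
Proof.
move=> [cf kf _].
have : compact (f @` supp f).
  by apply: continuous_compact => //; exact: continuous_subspaceT.
move=> /compact_bounded[M [_ hM]].
exists (`|M| + 1) => [|x]; first by rewrite addr_ge0.
have [->|fx] := eqVneq (f x) 0; first by rewrite normr0 addr_ge0.
apply: (hM (`|M| + 1)); first by rewrite ltr_pwDr ?ler_norm.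
by exists x => //; exact: subset_closure.
Qed.

End compact_support.

Section tents.
Context (R : realType) (X : metricType R).
Hypothesis lcX : locally_compact [set: X].

Definition tent (x : X) (r : R) (y : X) : R := Num.max 0 (r - mdist x y).

Lemma mdist_continuous (x : X) : continuous (fun y : X => mdist x y : R).
Proof.
move=> y; apply/cvgrPdist_le => e e0.
have : \forall z \near y, ball y e z by exact: nbhsx_ballx.
apply: filterS => z; rewrite ballEmdist /= => yz.
have := metric_triangle x y z; have := metric_triangle x z y.
rewrite (metric_sym z y) ler_norml; lra.
Qed.

Lemma tent_continuous x r : continuous (tent x r).
Proof.
move=> y; rewrite /tent; apply: (@continuous_max _ _ (fun=> 0) (fun y => r - mdist x y)).
  exact: cvg_cst.
by apply: cvgB; [exact: cvg_cst|exact: mdist_continuous].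
Qed.

Lemma tent_Cc (U : set X) x : open U -> U x -> exists2 r, 0 < r & Cc U (tent x r).
Proof.
move=> oU Ux; have : nbhs x U by exact: open_nbhs_nbhs.
move=> /nbhs_ballP[r1 /= r10 hr1].
have [P] := @lcX x I; rewrite withinET => nP [kP clP].
have /nbhs_ballP[r2 /= r20 hr2] : nbhs x P by exact: nP.
pose r := Num.min r1 r2 / 2.
have r0 : 0 < r by rewrite divr_gt0// lt_min r10.
exists r => //.
have cK : closed [set y | mdist x y <= r].
  by apply: (@preimage_closed _ _ (fun y : X => mdist x y : R) [set z | z <= r]);
    [move=> y _; exact: mdist_continuous|exact: closed_le].
have sK : supp (tent x r) `<=` [set y | mdist x y <= r].
  rewrite {1}/supp ((closure_id _).1 cK); apply: closure_subset => y /=.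
  by apply: contraNT; rewrite -ltNge /tent => h; rewrite max_l// subr_le0 ltW.
have rr : r < r1 /\ r < r2.
  rewrite /r; case: (leP r1 r2) => h; split; lra.
split; first exact: tent_continuous.
- apply: (subclosed_compact _ kP); first exact: closed_closure.
  apply: subset_trans sK _ => y /= h; apply: hr2.
  by rewrite ballEmdist /=; case: rr => _; exact: le_lt_trans.
- apply: subset_trans sK _ => y /= h; apply: hr1.
  by rewrite ballEmdist /=; case: rr => + _; exact: le_lt_trans.
Qed.

End tents.

(** If [P K] failed, the sets [A] with [P (K \ A)] would form a proper filter containing [K]; at a
    cluster point in [K] the local hypothesis is contradicted. *)
Lemma compact_ind (T : topologicalType) (K : set T) (P : set (set T)) : compact K ->
  P set0 -> (forall A B, A `<=` B -> P B -> P A) -> (forall A B, P A -> P B -> P (A `|` B)) ->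
  (forall x, K x -> exists2 U, nbhs x U & P U) -> P K.
Proof.
move=> cK P0 Psub PU Ploc; apply: contrapT => nPK.
pose F : set_system T := [set A | P (K `\` A)].
have FF : ProperFilter F.
  apply: Build_ProperFilter_ex.
    move=> A FA; apply: contrapT => nA; apply: nPK; apply: Psub FA => x Kx.
    by split=> // Ax; apply: nA; exists x.
  split.
  - by rewrite /F /= setDT.
  - by move=> A B FA FB; rewrite /F /= setDIr; exact: PU.
  - by move=> A B AB; apply: Psub; apply: setDS.
have [|x [Kx clx]] := cK F FF; first by rewrite /F /= setDv.
have [U nU PUx] := Ploc x Kx.
have FU : F (~` U) by apply: Psub PUx => y [_ /contrapT].
by have [y []] := clx _ _ FU nU.
Qed.

(** * Regular Dirichlet forms *)

Section contractions.
Context (R : realType).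

Lemma contraction_abs : normal_contraction (fun s : R => `|s|).
Proof. by split=> [|s t]; [exact: normr0|exact: ler_dist_dist]. Qed.

Lemma contraction_shift (e : R) : 0 <= e -> normal_contraction (fun s : R => Num.max 0 (s - e)).
Proof.
move=> e0; split=> [|s t]; first by rewrite sub0r max_l// oppr_le0.
have := ler_norm (s - t); have := ler_norm (t - s); rewrite (distrC t s) ler_norml.
by case: (leP 0 (s - e)); case: (leP 0 (t - e)); lra.
Qed.

Lemma contraction_pos : normal_contraction (fun s : R => Num.max 0 s).
Proof. by have := contraction_shift (lexx 0); under eq_fun do rewrite subr0. Qed.

Lemma contraction_unit : normal_contraction (fun s : R => Num.min 1 (Num.max 0 s)).
Proof.
split=> [|s t]; first by rewrite maxxx min_r.
have := ler_norm (s - t); have := ler_norm (t - s); rewrite (distrC t s) ler_norml.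
by case: (leP 0 s); case: (leP 0 t) => *; case: (leP 1 s); case: (leP 1 t) => *;
  do ?[case: (leP 1 0) => *]; lra.
Qed.

(** This map and the next have the shape [s - 2 * S s] required by [contraction_half], with [S] the
    positive part and the excess over 1. *)
Lemma contraction_neg_abs : normal_contraction (fun s : R => s - 2 * Num.max 0 s).
Proof.
split=> [|s t]; first by rewrite maxxx mulr0 subr0.
have := ler_norm (s - t); have := ler_norm (t - s); rewrite (distrC t s) ler_norml.
by case: (leP 0 s); case: (leP 0 t); lra.
Qed.

Lemma contraction_reflect : normal_contraction (fun s : R => s - 2 * Num.max 0 (s - 1)).
Proof.
split=> [|s t]; first by rewrite max_l ?mulr0 ?subr0// sub0r lerN10.
have := ler_norm (s - t); have := ler_norm (t - s); rewrite (distrC t s) ler_norml.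
by case: (leP 0 (s - 1)); case: (leP 0 (t - 1)); lra.
Qed.

End contractions.

Section min_distances.
Context (R : realType).
Implicit Types a b c : R.

(** In this and the next two bounds, truncating an approximant [b] by constraints that the target
    [a] already satisfies does not increase the distance to [a]. *)
Lemma dist_clamp a b c : 0 <= a <= c -> `|a - Num.min (Num.max 0 b) c| <= `|a - b|.
Proof.
move=> /andP[a0 ac]; have := ler_norm (a - b); have := ler_norm (- (a - b)).
rewrite normrN ler_norml => h1 h2.
by case: (leP 0 b) => hb; [case: (leP b c)|case: (leP 0 c)] => hc; apply/andP; split; lra.
Qed.

Lemma dist_min_abs a b c : 0 <= a <= `|b| -> `|a - Num.min a `|c| | <= `|b - c|.
Proof.
move=> /andP[a0 ab]; have := ler_norm (`|b| - `|c|); have := ler_dist_dist b c.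
have := normr_ge0 (b - c) => h1 h2 h3; rewrite ler_norml.
by case: (leP a `|c|) => hc; apply/andP; split; lra.
Qed.

Lemma dist_min_max0 a b : 0 <= a -> `|a - Num.min a (Num.max 0 b)| <= `|a - b|.
Proof.
move=> a0; have := ler_norm (a - b); have := normr_ge0 (a - b).
rewrite ler_norml => h1 h2.
by case: (leP 0 b) => hb; [case: (leP a b)|case: (leP a 0)] => hc; apply/andP; split; lra.
Qed.

End min_distances.

Section dirichlet_domain.
Context (R : realType) (X : pmetricType R) (m : {measure set (borel X) -> \bar R}).
Context (E : energy_form (L2 m)).
Hypotheses (lcX : locally_compact [set: X]) (dE : regular_dirichlet_form E).
Implicit Types (u v w z f : L2 m) (G : set X).

Let cE := rdf_closed dE.
Let ipP : inner_product (@L2ip R X m) := L2_inner_product m.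
Local Notation D := (fdom E).
Local Notation N u := (form1 (@L2ip R X m) E u u).

Ltac form_dom := lazymatch goal with
  | |- fdom _ (@GRing.add _ _ _) => apply: (fdomD cE); form_dom
  | |- fdom _ (@GRing.opp _ _) => apply: (fdomN cE); form_dom
  | |- fdom _ (@GRing.scale _ _ _ _) => apply: (fdomZ cE); form_dom
  | |- fdom _ (@GRing.zero _) => exact: (fdom0 cE)
  | _ => assumption
  end.
Hint Extern 0 (fdom E _) => form_dom : core.

Lemma dom_contraction C u : normal_contraction C -> D u ->
  exists v, [/\ D v, \forall x \ae m, v x = C (u x) :> R,
    fval E v v <= fval E u u & N v <= N u].
Proof.
move=> nC Du; have [v [Dv vC Ev]] := rdf_markov dE nC Du.
have vC' : \forall x \ae m, v x = C (u x) :> R by apply: filterS vC => x /(_ I).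
exists v; split=> //; rewrite /form1 lerD// !(ipE ipP) ler_pXn2r ?nnegrE//.
apply: L2_norm_le; apply: filterS vC' => x ->.
by case: nC => C0 hC; have := hC (u x) 0; rewrite C0 !subr0.
Qed.

Lemma dom_max0 u : D u ->
  exists v, [/\ D v, \forall x \ae m, v x = Num.max 0 (u x) :> R & N v <= N u].
Proof. by move=> /(dom_contraction (contraction_pos R))[v [? ? _ ?]]; exists v. Qed.

Lemma dom_abs u : D u ->
  exists v, [/\ D v, \forall x \ae m, v x = `|u x : R| :> R & N v <= N u].
Proof. by move=> /(dom_contraction (contraction_abs R))[v [? ? _ ?]]; exists v. Qed.

(** The minimum is [(u + w - |u - w|) / 2]. Its bound follows from the parallelogram identity for
    [u + w] and [a = |u - w|], using [N a <= N (u - w)]. *)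
Lemma dom_min u w : D u -> D w ->
  exists v, [/\ D v, \forall x \ae m, v x = Num.min (u x) (w x) :> R & N v <= N u + N w].
Proof.
move=> Du Dw; have [a [Da aE Na]] : exists v, [/\ D v, \forall x \ae m, v x =
    `|(u - w) x : R| :> R & N v <= N (u - w)] by apply: dom_abs; form_dom.
exists (2^-1 *: (u + w - a)); split; first by [].
  near=> x; rewrite (near (L2_aeZ 2^-1 (u + w - a)) x)// (near (L2_aeB (u + w) a) x)//.
  rewrite (near (L2_aeD u w) x)// (near aE x)// (near (L2_aeB u w) x)//.
  case: (leP (u x : R) (w x)) => h.
    by rewrite ler0_norm ?subr_le0//; field.
  by rewrite gtr0_norm ?subr_gt0//; field.
have : 0 <= N (u + w + a) by apply: (form1_ge0 ipP cE).
move: Na; rewrite !(form1E ipP cE)//.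
rewrite (form1C ipP cE (u := w) (v := u))// (form1C ipP cE (u := w) (v := a))//.
rewrite (form1C ipP cE (u := u) (v := a))//; lra.
Unshelve. all: by end_near. Qed.

(* Expand [E(u - 2 y) <= E(u)]. *)
Lemma contraction_half S u y : normal_contraction (fun s => s - 2 * S s) -> D u -> D y ->
  (\forall x \ae m, y x = S (u x) :> R) -> fval E y y <= fval E u y.
Proof.
move=> nC Du Dy yS; have [v [Dv vE Ev _]] := dom_contraction nC Du.
have vuy : v = (- 2) *: y + u.
  apply: L2_ext; near=> x; rewrite (near (L2_aeD (- 2 *: y) u) x)//.
  by rewrite (near (L2_aeZ (- 2) y) x)// (near vE x)// (near yS x)//; ring.
move: Ev; rewrite {1}vuy (fval_lin cE)// (fval_sym cE Dy Dv) (fval_sym cE Du Dv).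
rewrite vuy !(fval_lin cE)// (fval_sym cE Dy Du); lra.
Unshelve. all: by end_near. Qed.

Lemma dom_Cc_lin G a u v : dom_Cc E G u -> dom_Cc E G v -> dom_Cc E G (a *: u + v).
Proof.
move=> [Du [f fC uf]] [Dv [g gC vg]]; split=> //.
exists (fun x => a * f x + g x); first exact: Cc_lin.
near=> x => _; rewrite (near (L2_aeD (a *: u) v) x)// (near (L2_aeZ a u) x)//.
by congr (_ * _ + _); [exact: (near uf x)|exact: (near vg x)].
Unshelve. all: by end_near. Qed.

Lemma dom_Cc0 G : dom_Cc E G 0.
Proof.
split=> //; exists (fun=> 0); first exact: Cc0.
by apply: filterS (L2_ae0 m) => x ->.
Qed.

Lemma form_onP G u : fdom (form_on E G) u <->
  D u /\ forall e : R, 0 < e -> exists v, [/\ D v, dom_Cc E G v & N (u - v) <= e].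
Proof.
split=> [[Du h]|[Du h]]; split=> // e e0.
  have s0 : 0 < Num.sqrt e by rewrite sqrtr_gt0.
  have [v [Dv Cv] uv] := h _ s0; exists v; split=> //; move: uv.
  by rewrite (energy_norm_lt ipP)// sqr_sqrtr ?(ltW e0)// => /ltW.
have e20 : 0 < e ^+ 2 / 2 by rewrite divr_gt0 ?exprn_gt0.
have [v [Dv Cv uv]] := h _ e20; exists v => //.
rewrite (energy_norm_lt ipP)// (le_lt_trans uv)// ltr_pdivrMr// ltr_pMr ?exprn_gt0//.
by rewrite ltr1n.
Qed.

Lemma dom_core u (e : R) : D u -> 0 < e ->
  exists v, [/\ D v, dom_Cc E [set: X] v & N (u - v) <= e].
Proof.
move=> Du e0; suff /form_onP[_ /(_ e e0)//] : fdom (form_on E [set: X]) u by [].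
by split=> // e' e'0; have [v] := rdf_core dE Du e'0; exists v.
Qed.

Section form_on.
Context (G : set X).
Local Notation W := (fdom (form_on E G)).

Lemma form_on_dom : W `<=` D. Proof. by move=> u []. Qed.

Lemma dom_Cc_form_on : dom_Cc E G `<=` W.
Proof.
move=> u Cu; apply/form_onP; split=> [|e e0]; first by case: Cu.
by exists u; split=> //; [case: Cu|rewrite subrr -(scale0r 0) (form1Zl ipP cE)// mul0r ltW].
Qed.

Lemma form_on0 : W 0. Proof. exact: dom_Cc_form_on (dom_Cc0 G). Qed.

Lemma form_on_lin a u v : W u -> W v -> W (a *: u + v).
Proof.
move=> /form_onP[Du hu] /form_onP[Dv hv]; apply/form_onP; split=> // e e0.
have a0 : 0 <= 2 * a ^+ 2 + 2 by rewrite addr_ge0// mulr_ge0// sqr_ge0.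
have [d d0 hd] := small_mul e0 a0.
have [u' [Du' Cu' uu]] := hu d d0; have [v' [Dv' Cv' vv]] := hv d d0.
exists (a *: u' + v'); split=> //; first exact: dom_Cc_lin.
have -> : a *: u + v - (a *: u' + v') = a *: (u - u') + (v - v').
  by rewrite scalerBr opprD addrACA.
apply: le_trans hd; apply: le_trans (form1_triangle ipP cE _ _) _ => //.
have -> : N (a *: (u - u')) = a ^+ 2 * N (u - u').
  by rewrite (form1Zl ipP cE)// (form1Zr ipP cE)// mulrA.
rewrite [leRHS]mulrDl lerD//; last by rewrite ler_wpM2l.
by rewrite mulrA ler_wpM2l// mulr_ge0// sqr_ge0.
Qed.

Lemma form_on_closed : form1_closed (@L2ip R X m) E W.
Proof.
move=> z Dz h; apply/form_onP; split=> // e e0.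
have e40 : 0 < e / 4 by rewrite divr_gt0.
have [w Ww wz] := h _ e40; have Dw := form_on_dom Ww.
have [_ /(_ _ e40)[v [Dv Cv wv]]] := (form_onP G w).1 Ww.
exists v; split=> //; rewrite -(subrKA w).
apply: le_trans (form1_triangle ipP cE _ _) _ => //.
have -> : N (z - w) = N (w - z).
  by rewrite -opprB (form1Nl ipP cE)// (form1Nr ipP cE)// opprK.
by move: wz wv; lra.
Qed.

Lemma form_on_weak_closed u (M : R) :
  (forall e : R, 0 < e -> exists w, [/\ W w, N w <= M & `|w - u| <= e]) -> W u.
Proof.
exact: (form1_weak_closed ipP cE form_on0 form_on_lin form_on_dom form_on_closed).
Qed.

End form_on.

Lemma norm_form1_small u (e : R) : 0 < e -> D u -> N u <= Num.min 1 (e ^+ 2) ->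
  N u <= 1 /\ `|u| <= e.
Proof.
move=> e0 Du; rewrite le_min => /andP[-> h]; split=> //.
by rewrite -(@ler_pXn2r _ 2)// ?nnegrE ?(ltW e0)// (le_trans (norm_le_form1 ipP cE Du)).
Qed.

Lemma form1_near u v : D u -> D v -> N (u - v) <= 1 -> N v <= 2 * N u + 2.
Proof.
move=> Du Dv uv; have := form1_triangle ipP cE Du (_ : D (v - u)).
rewrite subrKC => /(_ ltac:(form_dom)).
have -> : N (v - u) = N (u - v).
  by rewrite -opprB (form1Nl ipP cE)// (form1Nr ipP cE)// opprK.
by move: uv; lra.
Qed.

(** Approximants of [z] in C_c(X) are clamped between 0 and [w], which puts their support inside
    [G]. The clamped functions have bounded form norm and still converge to [z] in L^2, so weak
    closedness applies. *)
Lemma form_on_below_Cc G z w : D z -> dom_Cc E G w ->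
  (\forall x \ae m, 0 <= (z x : R) <= w x) -> fdom (form_on E G) z.
Proof.
move=> Dz [Dw [f fC wf]] zw.
apply: (@form_on_weak_closed G z (2 * N z + 2 + N w)) => e e0.
have e1 : 0 < Num.min 1 (e ^+ 2) by rewrite lt_min ltr01 exprn_gt0.
have [v [Dv [_ [g gC vg]] zv]] := dom_core Dz e1.
have [N1 zve] : N (z - v) <= 1 /\ `|z - v| <= e by apply: norm_form1_small.
have [p [Dp pE Np]] := dom_max0 Dv.
have [y [Dy yE Ny]] := dom_min Dp Dw.
exists y; split.
- apply: dom_Cc_form_on; split=> //; exists (fun x => Num.min (Num.max 0 (g x)) (f x)).
    apply: (Cc_sub fC) => [x|x ->]; last by rewrite min_r// le_max lexx.
    have cf : continuous f by case: fC.
    have cg : continuous g by case: gC.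
    apply: (@continuous_min _ _ (fun x => Num.max 0 (g x)) f); last exact: cf.
    by apply: (@continuous_max _ _ (fun=> 0) g); [exact: cvg_cst|exact: cg].
  near=> x => _; rewrite (near yE x)// (near pE x)//.
  by congr (Num.min (Num.max 0 _) _); [exact: (near vg x)|exact: (near wf x)].
- have := form1_near Dz Dv N1; move: Np Ny; lra.
- rewrite (le_trans _ zve)// distrC; apply: L2_norm_le; near=> x.
  rewrite (near (L2_aeB z y) x)// (near (L2_aeB z v) x)// (near yE x)// (near pE x)//.
  by apply: dist_clamp; exact: (near zw x).
Unshelve. all: by end_near. Qed.

(** With [v] in C_c(G) close to [w], the function [min(z, |v|)] falls under the previous lemma and
    tends to [z] in L^2 with bounded form norm. *)
Lemma form_on_below G z w : D z -> fdom (form_on E G) w ->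
  (\forall x \ae m, 0 <= (z x : R) <= `|w x : R|) -> fdom (form_on E G) z.
Proof.
move=> Dz /form_onP[Dw hw] zw.
apply: (@form_on_weak_closed G z (N z + 2 * N w + 2)) => e e0.
have e1 : 0 < Num.min 1 (e ^+ 2) by rewrite lt_min ltr01 exprn_gt0.
have [v [Dv [_ [g gC vg]] wv]] := hw _ e1.
have [N1 wve] : N (w - v) <= 1 /\ `|w - v| <= e by apply: norm_form1_small.
have [p [Dp pE Np]] := dom_abs Dv.
have [y [Dy yE Ny]] := dom_min Dz Dp.
exists y; split.
- have Cp : dom_Cc E G p.
    split=> //; exists (fun x => `|g x|).
      apply: (Cc_sub gC) => [x|x ->]; last by rewrite normr0.
      have cg : continuous g by case: gC.
      by apply: (@continuous_comp _ _ _ g (fun t : R => `|t|)); [exact: cg|exact: norm_continuous].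
    near=> x => _; rewrite (near pE x)//.
    by congr `|_|; exact: (near vg x).
  apply: (form_on_below_Cc Dy Cp); near=> x; rewrite (near yE x)//.
  have /andP[h1 _] : 0 <= (z x : R) <= `|w x : R| by exact: (near zw x).
  have -> : p x = `|v x : R| :> R by exact: (near pE x).
  by rewrite le_min h1 normr_ge0 ge_min lexx orbT.
- have := form1_near Dw Dv N1; move: Np Ny; lra.
- rewrite (le_trans _ wve)// distrC; apply: L2_norm_le; near=> x.
  rewrite (near (L2_aeB z y) x)// (near (L2_aeB w v) x)// (near yE x)// (near pE x)//.
  by apply: dist_min_abs; exact: (near zw x).
Unshelve. all: by end_near. Qed.

(** Sums of local bumps. A tent need not belong to the form domain, but a uniform approximation of
    it does; cutting off its values below the error brings the support back into [G]. *)
Lemma cutoff (K G : set X) : compact K -> open G -> K `<=` G ->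
  exists (f : L2 m) (h : X -> R), [/\ D f, Cc G h, f = h %[ae m],
    (forall x, 0 <= h x) & (forall x, K x -> 1 <= h x)].
Proof.
move=> cK oG KG; apply: (compact_ind (P := fun K => exists (f : L2 m) (h : X -> R),
  [/\ D f, Cc G h, f = h %[ae m], (forall x, 0 <= h x) & (forall x, K x -> 1 <= h x)]) cK).
- exists 0, (fun=> 0); split=> //; first exact: Cc0.
  by apply: filterS (L2_ae0 m) => x ->.
- by move=> A B AB [f [h [? ? ? ? h1]]]; exists f, h; split=> // x /AB /h1.
- move=> A B [f [h [Df hC fh h0 h1]]] [f' [h' [Df' hC' fh' h0' h1']]].
  exists (1 *: f + f'), (fun x => 1 * h x + h' x); split=> //.
  + exact: Cc_lin.
  + near=> x => _; rewrite (near (L2_aeD (1 *: f) f') x)// (near (L2_aeZ 1 f) x)//.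
    by congr (_ * _ + _); [exact: (near fh x)|exact: (near fh' x)].
  + by move=> x; rewrite mul1r addr_ge0.
  + by move=> x [/h1|/h1']; rewrite mul1r; [move: (h0' x)|move: (h0 x)]; lra.
move=> x /KG Gx; have [r r0 tC] := tent_Cc lcX oG Gx.
(* On the ball of radius [r / 2] the tent is above [r / 2]; after an approximation error and a shift
   of [r / 8] each, [r / 4] is left, which the factor [4 / r] normalizes. *)
have e0 : 0 < r / 8 by rewrite divr_gt0.
have tT : Cc [set: X] (tent x r) by case: tC => ? ? _; split.
have [g [gC [v Dv vg] tg]] := rdf_sup_dense dE tT e0.
have cg : continuous g by case: gC.
have [f [Df fE _ _]] := dom_contraction (contraction_shift (ltW e0)) Dv.
exists (ball x (r / 2)); first by apply: nbhsx_ballx; rewrite divr_gt0.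
exists ((4 / r) *: f), (fun y => 4 / r * Num.max 0 (g y - r / 8)); split=> //.
- apply: (Cc_sub tC) => [y|y ty].
    apply: cvgM; first exact: cvg_cst.
    apply: (@continuous_max _ _ (fun=> 0) (fun y => g y - r / 8)); first exact: cvg_cst.
    by apply: cvgB; [exact: cg|exact: cvg_cst].
  rewrite max_l ?mulr0// subr_le0; have := tg y; rewrite ty sub0r normrN.
  exact: le_trans (ler_norm _).
- near=> y => _; rewrite (near (L2_aeZ (4 / r) f) y)// (near fE y)//.
  by congr (_ * Num.max 0 (_ - _)); exact: (near vg y).
- by move=> y; rewrite mulr_ge0 ?le_max ?lexx// divr_ge0// ltW.
- move=> y; rewrite ballEmdist /= => xy.
  rewrite (le_trans (_ : 1 <= 4 / r * (r / 4)))//.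
    by rewrite le_eqVlt; apply/orP; left; apply/eqP; field; rewrite gt_eqF.
  rewrite ler_wpM2l ?divr_ge0 ?(ltW r0)// le_max; apply/orP; right.
  have := tg y; rewrite /tent max_r; last lra.
  by rewrite ler_norml => /andP[]; lra.
Unshelve. all: by end_near. Qed.

(* [min(f, v)] with [v] in [C_c(X)] is below a multiple of a cutoff function
   equal to 1 on the compact set [supp v \ U], which is contained in [~` B]. *)
Lemma form_on_vanish (B U : set X) f : closed B -> open U -> B `<=` U -> D f ->
  (\forall x \ae m, 0 <= (f x : R)) -> (\forall x \ae m, U x -> f x = 0 :> R) ->
  fdom (form_on E (~` B)) f.
Proof.
move=> cB oU BU Df f0 fU.
(* The minimum contributes [N f + N v], and [N v <= 2 N f + 2] by [form1_near]. *)
apply: (@form_on_weak_closed (~` B) f (3 * N f + 2)) => e e0.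
have e1 : 0 < Num.min 1 (e ^+ 2) by rewrite lt_min ltr01 exprn_gt0.
have [v [Dv [_ [g gC vg]] fv]] := dom_core Df e1.
have [N1 fve] : N (f - v) <= 1 /\ `|f - v| <= e by apply: norm_form1_small.
have [p [Dp pE Np]] := dom_max0 Dv.
have [y [Dy yE Ny]] := dom_min Df Dp.
exists y; split.
- have [M M0 gM] := Cc_bounded gC.
  have cK : compact (supp g `&` ~` U).
    case: gC => _ kg _; apply: (subclosed_compact _ kg) => //; apply: closedI.
      exact: closed_closure.
    exact: open_closedC.
  have [|w [h [Dw hC wh h0 h1]]] := cutoff cK (closed_openC cB).
    by move=> x [_ nUx] /BU.
  apply: (@form_on_below_Cc _ _ (M *: w)) => //.
    rewrite -[_ *: w]addr0; apply: dom_Cc_lin; last exact: dom_Cc0.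
    by split=> //; exists h.
  near=> x; rewrite (near yE x)// (near pE x)// (near (L2_aeZ M w) x)//.
  have -> : v x = g x by exact: (near vg x).
  have -> : w x = h x by exact: (near wh x).
  have fx0 : 0 <= (f x : R) by exact: (near f0 x).
  rewrite le_min fx0 le_max lexx /=.
  have Mh : 0 <= M * h x by rewrite mulr_ge0.
  have [Ux|nUx] := pselect (U x).
    have -> : f x = 0 by exact: (near fU x).
    by rewrite ge_min Mh.
  have [->|gx] := eqVneq (g x) 0; first by rewrite maxxx ge_min Mh orbT.
  rewrite ge_min; apply/orP; right; rewrite ge_max Mh (le_trans (ler_norm _))//.
  rewrite (le_trans (gM x))// -[leLHS]mulr1 ler_wpM2l// h1//; split=> //.
  exact: subset_closure.
- have := form1_near Df Dv N1; move: Np Ny; lra.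
- rewrite (le_trans _ fve)// distrC; apply: L2_norm_le; near=> x.
  rewrite (near (L2_aeB f y) x)// (near (L2_aeB f v) x)// (near yE x)// (near pE x)//.
  by apply: dist_min_max0; exact: (near f0 x).
Unshelve. all: by end_near. Qed.

End dirichlet_domain.

(** * A Schur test *)

(** Only rational parameters are tested, so that countably many almost everywhere inequalities
    suffice in the application. *)
Lemma quadratic_rat_discriminant (R : realType) (a b c : R) : 0 <= c ->
  (forall r : rat, 0 <= a - 2 * ratr r * b + ratr r ^+ 2 * c) -> b ^+ 2 <= a * c.
Proof.
move=> c0 h.
have hR (t : R) : 0 <= a - 2 * t * b + t ^+ 2 * c.
  (* Between [t] and [s] in [(t, t + 1)] the quadratic changes by [(s - t) (c (s + t) - 2 b)], and
     [M] bounds the second factor. *)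
  apply: eps_le => e e0; set M := 2 * `|b| + c * (2 * `|t| + 1).
  have M0 : 0 <= M by rewrite addr_ge0 ?mulr_ge0 ?addr_ge0 ?mulr_ge0.
  have [d d0 hd] := small_mul (e0 : 0 < (e : R)) M0.
  have [|r] := @rat_in_itvoo _ t (t + Num.min 1 d).
    by rewrite ltrDl lt_min ltr01.
  rewrite in_itv /= => /andP[tr]; rewrite -ltrBlDl lt_min => /andP[r1 rd].
  have := h r; move: (ratr r) tr r1 rd => s ts s1 sd hs.
  suff : (s - t) * (c * (s + t) - 2 * b) <= M * d by move: hd; lra.
  have QM : c * (s + t) - 2 * b <= M.
    have := ler_norm t; have := ler_norm (- b); rewrite normrN => hb ht.
    have st : s + t <= 2 * `|t| + 1 by lra.
    have := ler_wpM2l c0 st; rewrite /M; lra.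
  have st0 : 0 <= s - t by rewrite subr_ge0 ltW.
  by rewrite (le_trans (ler_wpM2l st0 QM))// mulrC ler_wpM2l// ltW.
have [c0'|cn0] := eqVneq c 0.
  have [->|b0] := eqVneq b 0; first by rewrite c0' mulr0 expr0n.
  (* For [c = 0] and [b <> 0] this parameter gives the value -1. *)
  have := hR ((a + 1) / (2 * b)).
  have -> : a - 2 * ((a + 1) / (2 * b)) * b + ((a + 1) / (2 * b)) ^+ 2 * c = - 1.
    by rewrite c0'; field.
  by rewrite oppr_ge0 ler10.
have cp : 0 < c by rewrite lt_def cn0.
have := hR (b / c).
have -> : a - 2 * (b / c) * b + (b / c) ^+ 2 * c = (a * c - b ^+ 2) / c by field.
by rewrite pmulr_lge0 ?invr_gt0// subr_ge0.
Qed.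

Section schur_test.
Context (R : realType) (X : pmetricType R) (m : {measure set (borel X) -> \bar R}).
Implicit Types (u v w h : L2 m) (F : set (borel X)).

Let ipP : inner_product (@L2ip R X m) := L2_inner_product m.

Context (K : L2 m -> L2 m) (e : L2 m) (c : R).
Hypotheses (lK : linear K) (sK : forall u v, L2ip (K u) v = L2ip u (K v)).
Hypotheses (c0 : 0 <= c) (Kc : forall u, `|K u| <= c * `|u|).
Hypothesis K0 : forall h, (\forall x \ae m, 0 <= (h x : R)) -> \forall x \ae m, 0 <= (K h x : R).
Hypothesis K1 : forall h, (\forall x \ae m, 0 <= (h x : R) <= 1) ->
  \forall x \ae m, (K h x : R) <= 1.
Hypothesis Ke : forall h, (\forall x \ae m, 0 <= (h x : R) <= 1) ->
  \forall x \ae m, (K h x : R) <= e x.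

(* [K ((h - l)^2) >= 0] for all rational [l] simultaneously, with [h = 1_F u]:
   a Cauchy-Schwarz inequality for the positive operator [K]. *)
Lemma schur_pointwise u F (M : R) : measurable F -> (m F < +oo)%E ->
  (forall x, F x -> `|u x : R| <= M) ->
  exists k h2 : L2 m, [/\ \forall x \ae m, 0 <= (k x : R) <= 1,
    \forall x \ae m, h2 x = (mul_indic F u x : R) ^+ 2 :> R &
    \forall x \ae m, (K (mul_indic F u) x : R) ^+ 2 <= K k x * K h2 x].
Proof.
move=> mF Foo uM; set h := mul_indic F u.
have hE : \forall x \ae m, h x = \1_F x * (u x : R) :> R := mul_indicE u mF.
have [k kE] := indic_L2 mF Foo.
have mh : measurable_fun setT (h : borel X -> R) := Lspace_measurable h.
have [||h2 h2E _] := @L2_dom _ _ _ m (fun x => (h x : R) ^+ 2) (M *: h).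
- exact: measurable_funX.
- near=> x; rewrite (near (L2_aeZ M h) x)// (near hE x)// indicE.
  have [Fx|] := boolP (x \in F); last by rewrite !mul0r mulr0 expr0n normr0.
  rewrite !mul1r normrX expr2 normrM ler_wpM2r//.
  by rewrite (le_trans (uM x _) (ler_norm _))//; rewrite inE in Fx.
exists k, h2.
have k01 : \forall x \ae m, 0 <= (k x : R) <= 1.
  by apply: filterS kE => x ->; rewrite indicE; case: (_ \in _); rewrite ?ler01 ?lexx.
split=> //.
have Kq (r : rat) : \forall x \ae m,
    0 <= (K h2 x : R) - 2 * ratr r * K h x + ratr r ^+ 2 * K k x.
  pose l : R := ratr r.
  have E : K (h2 + (- (2 * l)) *: h + (l ^+ 2) *: k) =
      K h2 + (- (2 * l)) *: K h + (l ^+ 2) *: K k.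
    by rewrite !(linD lK) !(linZ lK).
  have : \forall x \ae m, 0 <= (K (h2 + (- (2 * l)) *: h + (l ^+ 2) *: k) x : R).
    apply: K0; near=> x.
    rewrite (near (L2_aeD (h2 + (- (2 * l)) *: h) ((l ^+ 2) *: k)) x)//.
    rewrite (near (L2_aeD h2 ((- (2 * l)) *: h)) x)//.
    rewrite (near (L2_aeZ (- (2 * l)) h) x)// (near (L2_aeZ (l ^+ 2) k) x)//.
    rewrite (near h2E x)// (near hE x)// (near kE x)// indicE.
    case: (_ \in _); last by rewrite !mul0r !mulr0 expr0n !addr0.
    by rewrite (_ : _ + _ = (1 * (u x : R) - l) ^+ 2) ?sqr_ge0//=; ring.
  rewrite E => KE; near=> x.
  have : 0 <= ((K h2 + (- (2 * l)) *: K h + (l ^+ 2) *: K k) x : R) by exact: (near KE x).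
  rewrite (near (L2_aeD (K h2 + (- (2 * l)) *: K h) ((l ^+ 2) *: K k)) x)//.
  rewrite (near (L2_aeD (K h2) ((- (2 * l)) *: K h)) x)//.
  rewrite (near (L2_aeZ (- (2 * l)) (K h)) x)// (near (L2_aeZ (l ^+ 2) (K k)) x)//.
  by rewrite mulNr.
(* The rationals are enumerated by [unpickle], so that a single null set serves them all. *)
have Kall : \forall x \ae m, forall n (r : rat), unpickle n = Some r ->
    0 <= (K h2 x : R) - 2 * ratr r * K h x + ratr r ^+ 2 * K k x.
  apply: ae_foralln => n; case: (unpickle n) => [r|].
    by apply: filterS (Kq r) => x + _ [<-].
  exact: aeW.
have k0 : \forall x \ae m, 0 <= (k x : R) by apply: filterS k01 => x /andP[].
near=> x; rewrite mulrC; apply: quadratic_rat_discriminant.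
  exact: (near (K0 k0) x).
by move=> r; apply: (near Kall x _ (pickle r)) => //; exact: pickleK.
Unshelve. all: by end_near. Qed.

(** On [S] the pointwise inequality and [K k <= e <= d] give [(K h)^2 <= d K (h^2)]. Integrating
    against an indicator and moving K onto it by symmetry leaves at most [d |h|^2], because K maps
    functions between 0 and 1 below 1. *)
Lemma schur_truncated u F (M d : R) : measurable F -> (m F < +oo)%E -> 0 <= d ->
  (forall x, F x -> `|u x : R| <= M) ->
  `|mul_indic [set x | (e x : R) <= d] (K (mul_indic F u))| <=
    Num.sqrt d * `|mul_indic F u|.
Proof.
move=> mF Foo d0 uM; set h := mul_indic F u; set S := [set x | _].
have [k [h2 [k01 h2E CS]]] := schur_pointwise mF Foo uM; rewrite -/h in h2E CS.
have mS : measurable S.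
  rewrite -[S]setTI; apply: measurable_fun_le => //; exact: Lspace_measurable.
apply: eps_le => t t0.
(* [S] may have infinite measure, so its indicator need not lie in L^2; the set is cut down to
   finite measure with an error [t] in the norm. *)
have [F1 [mF1 F1oo _ hF1]] := L2_truncate (K h) t0.
have mS1 : measurable (S `&` F1) by exact: measurableI.
have S1oo : (m (S `&` F1) < +oo)%E.
  by apply: le_lt_trans F1oo; apply: le_measure; rewrite ?inE// => x [].
have [k2 k2E] := indic_L2 mS1 S1oo.
have main : `|mul_indic (S `&` F1) (K h)| <= Num.sqrt d * `|h|.
  rewrite -(@ler_pXn2r _ 2)// ?nnegrE ?mulr_ge0 ?sqrtr_ge0// exprMn sqr_sqrtr//.
  rewrite -!(ipE ipP).
  have h20 : \forall x \ae m, 0 <= (h2 x : R) by apply: filterS h2E => x ->; exact: sqr_ge0.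
  have k201 : \forall x \ae m, 0 <= (k2 x : R) <= 1.
    by apply: filterS k2E => x ->; rewrite indicE; case: (_ \in _); rewrite ?ler01 ?lexx.
  apply: (@le_trans _ _ (L2ip (d *: K h2) k2)).
    apply: L2_int_le; near=> x.
    rewrite (near (mul_indicE (K h) mS1) x)// (near (L2_aeZ d (K h2)) x)// (near k2E x)//.
    rewrite indicE; have [xS|_] := boolP (x \in _); last by rewrite !mul0r mulr0.
    rewrite !mul1r mulr1 -expr2 (le_trans (near CS x _))// ler_wpM2r//.
      exact: (near (K0 h20) x).
    rewrite (le_trans (near (Ke k01) x _))//.
    by move: xS; rewrite inE => -[].
  rewrite (ipZl ipP) sK ler_wpM2l//; apply: L2_int_le; near=> x.
  rewrite (near h2E x)// -expr2 -[leRHS]mulr1 ler_wpM2l ?sqr_ge0//.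
  exact: (near (K1 k201) x).
have -> : mul_indic S (K h) =
    mul_indic S (K h - mul_indic F1 (K h)) + mul_indic (S `&` F1) (K h).
  apply: L2_ext; near=> x.
  rewrite (near (L2_aeD (mul_indic S (K h - mul_indic F1 (K h))) (mul_indic (S `&` F1) (K h))) x)//.
  rewrite (near (mul_indicE (K h) mS) x)// (near (mul_indicE (K h - mul_indic F1 (K h)) mS) x)//.
  rewrite (near (mul_indicE (K h) mS1) x)// (near (L2_aeB (K h) (mul_indic F1 (K h))) x)//.
  by rewrite (near (mul_indicE (K h) mF1) x)// indicI /=; ring.
rewrite (le_trans (ler_normD _ _))// addrC lerD//.
by rewrite (le_trans (mul_indic_norm_le _ mS))// mul1r.
Unshelve. all: by end_near. Qed.

Lemma schur_bound u (d : R) : 0 <= d ->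
  `|mul_indic [set x | (e x : R) <= d] (K u)| <= Num.sqrt d * `|u|.
Proof.
move=> d0; set S := [set x | _].
have mS : measurable S.
  rewrite -[S]setTI; apply: measurable_fun_le => //; exact: Lspace_measurable.
apply: eps_le => t t0; have [s s0 hs] := small_mul (t0 : 0 < (t : R)) c0.
have [F [mF Foo [M uM] uF]] := L2_truncate u s0.
have -> : K u = K (mul_indic F u) + K (u - mul_indic F u) by rewrite -(linD lK) subrKC.
rewrite (linD (mul_indic_linear mS)) (le_trans (ler_normD _ _))// lerD//.
  rewrite (le_trans (schur_truncated mF Foo d0 uM))// ler_wpM2l ?sqrtr_ge0//.
  by rewrite (le_trans (mul_indic_norm_le _ mF))// mul1r.
rewrite (le_trans (mul_indic_norm_le _ mS))// mul1r (le_trans (Kc _))//.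
by rewrite (le_trans _ hs)// ler_wpM2l.
Qed.

Lemma schur_tb_operator :
  (forall F, measurable F -> (m F < +oo)%E -> tb_operator (fun u => mul_indic F (K u))) ->
  tb_operator K.
Proof.
move=> tK; apply: tb_operator_approx => t t0.
have t20 : 0 < t ^+ 2 by rewrite exprn_gt0.
(* The Schur bound is the square root of the level, hence the square. *)
pose S : set (borel X) := [set x | (e x : R) <= t ^+ 2].
have mS : measurable S.
  rewrite -[S]setTI; apply: measurable_fun_le => //; exact: Lspace_measurable.
exists (fun u => mul_indic (~` S) (K u)).
  apply: tK; first exact: measurableC.
  apply: le_lt_trans (L2_markov e t20); apply: le_measure; rewrite ?inE.
  - exact: measurableC.
  - rewrite -[X in measurable X]setTI; apply: measurable_fun_le => //.
    by apply: measurableT_comp => //; exact: Lspace_measurable.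
  - by move=> x /= /negP; rewrite -ltNge => /ltW/le_trans; apply; exact: ler_norm.
move=> u u1.
have -> : K u - mul_indic (~` S) (K u) = mul_indic S (K u).
  apply: L2_ext; near=> x.
  rewrite (near (L2_aeB (K u) (mul_indic (~` S) (K u))) x)//.
  rewrite (near (mul_indicE (K u) mS) x)// (near (mul_indicE (K u) (measurableC mS)) x)//.
  by rewrite !indicE in_setC; case: (_ \in _) => /=; rewrite ?mul1r ?mul0r ?subrr ?subr0.
rewrite (le_trans (schur_bound u (ltW t20)))// sqrtr_sqr gtr0_norm//.
by rewrite -[leRHS]mulr1 ler_wpM2l// ltW.
Unshelve. all: by end_near. Qed.

End schur_test.

(** * The part of a Dirichlet form on an open set *)

(** That is, [K^2 <= K] for [0 <= K <= 1]: expand the form of K at [u - K u] and use [K <= 1] at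
    [K u]. *)
Lemma norm_sqr_le_quadratic (R : realType) (H : normedModType R) (ip : H -> H -> R)
    (K : H -> H) : inner_product ip -> linear K ->
  (forall u v, ip (K u) v = ip u (K v)) ->
  (forall u, 0 <= ip (K u) u) -> (forall u, ip (K u) u <= `|u| ^+ 2) ->
  forall u, `|K u| ^+ 2 <= ip (K u) u.
Proof.
move=> ipP lK sK K0 K1 u; have := K0 (u - K u).
rewrite (linB lK) !(ipBl ipP) !(ipBr ipP) (sK (K u) u) !(ipE ipP).
by have := K1 (K u); lra.
Qed.

Section functions_on_subset.
Context (R : realType) (X : pmetricType R) (m : {measure set (borel X) -> \bar R}).
Implicit Types (u v w : L2 m).
Let ipP : inner_product (@L2ip R X m) := L2_inner_product m.

Context (G : set (borel X)) (mG : measurable G).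

Lemma mul_indic_idem u : mul_indic G (mul_indic G u) = mul_indic G u.
Proof.
apply: L2_ext; near=> x.
rewrite (near (mul_indicE (mul_indic G u) mG) x)// (near (mul_indicE u mG) x)//.
by rewrite mulrA indicE; case: (_ \in _); rewrite ?mul1r ?mul0r.
Unshelve. all: by end_near. Qed.

Lemma L2onE u : L2on m G u <-> mul_indic G u = u.
Proof.
split=> [Gu|<-].
  apply: L2_ext; near=> x; rewrite (near (mul_indicE u mG) x)// indicE.
  have [Gx|/negP Gx] := boolP (x \in G); first by rewrite mul1r.
  rewrite mul0r; apply/esym/(near Gu x) => //; by move/mem_set.
by apply: filterS (mul_indicE u mG) => x -> nGx; rewrite indicE memNset// mul0r.
Unshelve. all: by end_near. Qed.

Lemma L2on_lin a u v : L2on m G u -> L2on m G v -> L2on m G (a *: u + v).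
Proof. by move=> /L2onE uE /L2onE vE; apply/L2onE; rewrite mul_indic_linear// uE vE. Qed.

Lemma L2on_closed (x : nat -> L2 m) l : (forall n, L2on m G (x n)) -> seqlim x l -> L2on m G l.
Proof.
move=> Gx xl; apply/L2onE; apply: (@seqlim_uniq _ _ x) (xl) => //.
have := seqlim_bounded ler01 (mul_indic_linear mG) (fun u => mul_indic_norm_le u mG) xl.
by rewrite (_ : mul_indic G \o x = x)//; apply/funext => n; exact: (L2onE (x n)).1 (Gx n).
Qed.

Lemma L2on_dec u : exists2 p, L2on m G p & forall v, L2on m G v -> L2ip (u - p) v = 0.
Proof.
exists (mul_indic G u).
  by apply/L2onE; exact: mul_indic_idem.
by move=> v /L2onE vG; rewrite (ipBl ipP) mul_indic_sym// vG subrr.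
Qed.

End functions_on_subset.

Section resolvent_difference.
Context (R : realType) (X : pmetricType R) (m : {measure set (borel X) -> \bar R}).
Context (E : energy_form (L2 m)) (B : set X).
Hypotheses (lcX : locally_compact [set: X]) (dE : regular_dirichlet_form E).
Hypothesis cB : closed B.
Implicit Types (u v w z f h : L2 m).

Let cE := rdf_closed dE.
Let ipP : inner_product (@L2ip R X m) := L2_inner_product m.
Local Notation D := (fdom E).
Local Notation q := (form1 (@L2ip R X m) E).
Local Notation W := (fdom (form_on E (~` B))).

Let WD : W `<=` D. Proof. by move=> u []. Qed.
Let WDu u : W u -> D u. Proof. exact: WD. Qed.

Ltac form_dom := lazymatch goal with
  | |- fdom _ (@GRing.add _ _ _) => apply: (fdomD cE); form_dom
  | |- fdom _ (@GRing.opp _ _) => apply: (fdomN cE); form_dom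
  | |- fdom _ (@GRing.scale _ _ _ _) => apply: (fdomZ cE); form_dom
  | |- fdom _ (@GRing.zero _) => exact: (fdom0 cE)
  | _ => first [assumption|apply: WDu; assumption|solve [auto with form_dom nocore]]
  end.
Hint Extern 0 (fdom E _) => form_dom : core.

Lemma dom_Cc_L2on (G : set (borel X)) u : dom_Cc E G u -> L2on m G u.
Proof.
move=> [_ [f [_ _ fG] uf]]; apply: filterS uf => x /(_ I) -> nGx.
apply/eqP/negPn/negP => fx; apply: nGx; apply: fG; exact: subset_closure.
Qed.

Lemma form_on_L2on (G : set (borel X)) : measurable G -> fdom (form_on E G) `<=` L2on m G.
Proof.
move=> mG u /(form_onP dE)[Du hu]; apply/(L2onE mG).
apply/eqP; rewrite -subr_eq0; apply/eqP/eps_eq0 => e e0.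
have e20 : 0 < (e / 2) ^+ 2 by rewrite exprn_gt0// divr_gt0.
have [v [Dv /dom_Cc_L2on/(L2onE mG) vG uv]] := hu _ e20.
have uve : `|u - v| <= e / 2.
  rewrite -(@ler_pXn2r _ 2)// ?nnegrE ?divr_ge0 ?(ltW e0)//.
  by rewrite (le_trans _ uv)// (norm_le_form1 ipP cE).
have -> : mul_indic G u - u = mul_indic G (u - v) + (v - u).
  by rewrite (linB (mul_indic_linear mG)) vG subrKA.
rewrite (splitr e) (le_trans (ler_normD _ _))// lerD//; last by rewrite distrC.
by rewrite (le_trans (mul_indic_norm_le _ mG))// mul1r.
Qed.

Lemma positive_part_form u : D u -> exists v, [/\ D v,
  \forall x \ae m, v x = Num.max 0 (u x) :> R & q v v <= q u v].
Proof.
move=> Du; have [v [Dv vE _]] := dom_max0 dE Du; exists v; split=> //.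
rewrite /form1 lerD//.
  by apply: (contraction_half dE (S := fun s => Num.max 0 s)) => //; exact: contraction_neg_abs.
apply: L2_int_le; near=> x; rewrite (near vE x)//.
by case: (leP 0 (u x : R)) => h; rewrite ?mulr0.
Unshelve. all: by end_near. Qed.

(** A weak maximum principle: tested against the negative part [v] of [u], the form satisfies
    [q v v <= - q u v <= 0], hence [v = 0]. *)
Lemma nonneg_of_form u : D u ->
  (forall v, D v -> (\forall x \ae m, v x = Num.max 0 (- (u x : R)) :> R) -> 0 <= q u v) ->
  \forall x \ae m, 0 <= (u x : R).
Proof.
move=> Du hu; have [v [Dv vE vq]] : exists v, [/\ D v,
  \forall x \ae m, v x = Num.max 0 ((- u) x : R) :> R & q v v <= q (- u) v].
  by apply: positive_part_form.
have vE' : \forall x \ae m, v x = Num.max 0 (- (u x : R)) :> R.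
  by near=> x; rewrite (near vE x)// (near (L2_aeN u) x).
have v0 : v = 0.
  apply: (form1_eq0 ipP cE) => //; rewrite (le_trans vq)//.
  by rewrite (form1Nl ipP cE)// oppr_le0; exact: hu.
near=> x; have : v x = Num.max 0 (- (u x : R)) by exact: (near vE' x).
rewrite v0 (near (L2_ae0 m) x)// => h.
have : - (u x : R) <= 0 by rewrite h le_max lexx orbT.
by rewrite oppr_le0.
Unshelve. all: by end_near. Qed.

(** As [p >= 0], the negative part of [p - z] is at most [|z|] and so belongs to [W], where
    [q (p - z)] vanishes. *)
Lemma complement_projection_ge0 p z : D p -> (\forall x \ae m, 0 <= (p x : R)) -> W z ->
  (forall v, W v -> q z v = q p v) -> \forall x \ae m, 0 <= ((p - z) x : R).
Proof.
move=> Dp p0 Wz zp; apply: nonneg_of_form => // v Dv vE.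
suff Wv : W v by rewrite (form1Dl ipP cE)// (form1Nl ipP cE)// zp// subrr.
apply: (form_on_below dE Dv Wz); near=> x; rewrite (near vE x)//.
rewrite (near (L2_aeB p z) x)// le_max lexx /= ge_max normr_ge0 /=.
have p0x : 0 <= (p x : R) by exact: (near p0 x).
by have := ler_norm (z x : R); lra.
Unshelve. all: by end_near. Qed.

(* [eta - f] is split into its positive part, on which [1 - P] is nonnegative,
   and its negative part, which vanishes near [B] and is killed by [1 - P]. *)
Lemma finite_cap_potential : (cap E B < +oo)%E -> exists2 e : L2 m,
    (\forall x \ae m, 0 <= (e x : R)) &
  forall f z, D f -> (\forall x \ae m, 0 <= (f x : R) <= 1) -> W z ->
    (forall v, W v -> q z v = q f v) -> \forall x \ae m, ((f - z) x : R) <= e x.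
Proof.
move=> /ereal_inf_lt[_ [U [oU BU] <-]] /ereal_inf_lt[_ [v [Dv vU] <-] _].
(* Finite capacity provides [v >= 1] almost everywhere on an open [U] containing [B]; clamping it to
   [0, 1] makes it equal to 1 there. *)
have [eta [Deta etaE _ _]] := dom_contraction dE (contraction_unit R) Dv.
have eta0 : \forall x \ae m, 0 <= (eta x : R).
  by apply: filterS etaE => x ->; rewrite le_min ler01 le_max lexx.
have [p Wp pE] := riesz_projection ipP cE (form_on0 dE (~` B))
  (@form_on_lin _ _ _ _ dE (~` B)) WD (@form_on_closed _ _ _ _ dE (~` B)) Deta.
exists (eta - p); first exact: complement_projection_ge0.
move=> f z Df f01 Wz zE.
have [a [Da aE _]] : exists a, [/\ D a, \forall x \ae m, a x = Num.max 0 ((f - eta) x : R) :> R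
    & q a a <= q (f - eta) (f - eta)] by apply: (dom_max0 dE).
have [b [Db bE _]] : exists b, [/\ D b, \forall x \ae m, b x = Num.max 0 ((eta - f) x : R) :> R
    & q b b <= q (eta - f) (eta - f)] by apply: (dom_max0 dE).
have Wa : W a.
  apply: (form_on_vanish lcX dE cB oU BU Da).
    by apply: filterS aE => x ->; rewrite le_max lexx.
  have eta1 : \forall x \ae m, U x -> eta x = 1 :> R.
    apply: filterS2 etaE vU => x -> + Ux; rewrite indicE mem_set// => v1.
    by rewrite max_r ?min_l// (le_trans ler01).
  have fe : \forall x \ae m, a x = Num.max 0 ((f x : R) - eta x) :> R.
    by apply: filterS2 aE (L2_aeB f eta) => x -> ->.
  apply: filterS3 fe eta1 f01 => x -> + /andP[_ f1] Ux => ->//.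
  by rewrite max_l// subr_le0.
have ba : b - a = eta - f.
  apply: L2_ext; near=> x.
  rewrite (near (L2_aeB b a) x)// (near bE x)// (near aE x)//.
  rewrite (near (L2_aeB f eta) x)// (near (L2_aeB eta f) x)//.
  rewrite -(opprB (eta x : R)).
  case: (leP 0 ((eta x : R) - f x)) => h; first by rewrite max_l ?subr0// oppr_le0.
  by rewrite max_r ?sub0r ?opprK// oppr_ge0 ltW.
have Wlin := @form_on_lin _ _ _ _ dE (~` B).
(* This is the projection of [b = eta - f + a], because [a] lies in [W]; subtracting it from [b]
   leaves [(eta - p) - (f - z)]. *)
have Wy : W (p - z + a).
  rewrite -[p - z]addrC -scaleN1r -addrA; apply: (Wlin) => //.
  by rewrite -[p]scale1r; apply: (Wlin).
have by0 : \forall x \ae m, 0 <= ((b - (p - z + a)) x : R).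
  apply: complement_projection_ge0 => //.
    by apply: filterS bE => x ->; rewrite le_max lexx.
  move=> w Ww; have -> : b = eta - f + a by rewrite -ba subrK.
  by rewrite !(form1E ipP cE)// pE// zE.
have E' : b - (p - z + a) = (eta - p) - (f - z).
  have -> : b = eta - f + a by rewrite -ba subrK.
  by ip_ring ipP.
move: by0; rewrite E' => by0; near=> x.
rewrite -subr_ge0 -(near (L2_aeB (eta - p) (f - z)) x)//.
exact: (near by0 x).
Unshelve. all: by end_near. Qed.

Section difference.
Context (T TG : L2 m -> L2 m).
Hypotheses (TD : forall h, D (T h)) (TE : forall h v, D v -> q (T h) v = L2ip h v).
Hypotheses (TGW : forall h, W (TG h)) (TGE : forall h v, W v -> q (TG h) v = L2ip h v).

Let TGD h : D (TG h). Proof. exact: WDu. Qed.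
Hint Resolve TGW : core.
Hint Resolve TD TGD : form_dom.

Lemma resolvent_ge0 h : (\forall x \ae m, 0 <= (h x : R)) -> \forall x \ae m, 0 <= (T h x : R).
Proof.
move=> h0; apply: nonneg_of_form => // v Dv vE; rewrite TE//.
by apply: L2_int_ge0 => //; apply: filterS vE => x ->; rewrite le_max lexx.
Qed.

Lemma part_resolvent_ge0 h : (\forall x \ae m, 0 <= (h x : R)) -> \forall x \ae m, 0 <= (TG h x : R).
Proof.
move=> h0; apply: nonneg_of_form => // v Dv vE; rewrite TGE//.
  by apply: L2_int_ge0 => //; apply: filterS vE => x ->; rewrite le_max lexx.
apply: (form_on_below dE Dv (TGW h)); apply: filterS vE => x ->.
by rewrite le_max lexx ge_max normr_ge0 /= -normrN ler_norm.
Qed.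

(** With [v] the excess of [T h] over 1, [E(v, v) <= E(T h, v) = <h - T h, v> <= - <v, v>], so
    [v = 0]. *)
Lemma resolvent_le1 h : (\forall x \ae m, (h x : R) <= 1) -> \forall x \ae m, (T h x : R) <= 1.
Proof.
move=> h1; have [v [Dv vE _ _]] := dom_contraction dE (contraction_shift ler01) (TD h).
have Ev := contraction_half dE (contraction_reflect R) (TD h) Dv vE.
have : L2ip (h - T h) v <= L2ip (- v) v.
  apply: L2_int_le; near=> x.
  rewrite (near (L2_aeB h (T h)) x)// (near (L2_aeN v) x)// (near vE x)//.
  have h1x : (h x : R) <= 1 by exact: (near h1 x).
  case: (leP 0 ((T h x : R) - 1)) => Th; last by rewrite !mulr0.
  by rewrite ler_wpM2r// opprB lerD2r.
rewrite (ipBl ipP) (ipNl ipP) -TE// /form1 => hv.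
have v0 : v = 0.
  by apply: (form1_eq0 ipP cE) => //; rewrite /form1; move: hv Ev; lra.
near=> x; have : v x = Num.max 0 ((T h x : R) - 1) by exact: (near vE x).
rewrite v0 (near (L2_ae0 m) x)// => hx.
have : (T h x : R) - 1 <= 0 by rewrite hx le_max lexx orbT.
by rewrite subr_le0.
Unshelve. all: by end_near. Qed.

Local Notation K := (fun u => T u - TG u).

Lemma difference_sym u v : L2ip (K u) v = L2ip u (K v).
Proof.
rewrite (ipBl ipP) (ipBr ipP) (ipC ipP (T u)) (ipC ipP (TG u)).
rewrite -(TE v (TD u)) -(TE u (TD v)) -(TGE v (TGW u)) -(TGE u (TGW v)).
by rewrite (form1C ipP cE (u := T v))// (form1C ipP cE (u := TG v)).
Qed.

(** [TG u] is the q-projection of [T u], so the form of K is the squared form norm of the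
    complementary part; in particular it is nonnegative. *)
Lemma difference_quadratic u : L2ip (K u) u = q (T u - TG u) (T u - TG u).
Proof.
rewrite (ipC ipP) (ipBr ipP) !(form1E ipP cE)//.
by rewrite (form1C ipP cE (u := TG u) (v := T u))// !TE// TGE//; ring.
Qed.

Lemma difference_ge0 h : (\forall x \ae m, 0 <= (h x : R)) -> \forall x \ae m, 0 <= (K h x : R).
Proof.
move=> h0; apply: complement_projection_ge0 => //; first exact: resolvent_ge0.
by move=> v Wv; rewrite TGE// TE.
Qed.

(** The Schur test requires [1_F K] to be tb, whereas the hypothesis concerns [1_F T]. With S the
    multiplication by [1_F], compactness passes from [S T S] to [K S] and then to [S K], each time
    by an inequality between quadratic forms. *)
Lemma difference_tb_operator : linear T -> linear TG -> (cap E B < +oo)%E ->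
  (forall F : set (borel X), measurable F -> (m F < +oo)%E ->
    tb_operator (fun u => mul_indic F (T u))) -> tb_operator K.
Proof.
move=> lT lTG capB tT.
have lK : linear K.
  by move=> a u v /=; rewrite lT lTG scalerBr opprD addrACA.
have Tq u : L2ip (T u) u = q (T u) (T u) by rewrite TE// (ipC ipP).
have TGq u : L2ip (TG u) u = q (TG u) (TG u) by rewrite TGE// (ipC ipP).
have KT u : L2ip (K u) u <= L2ip (T u) u.
  by rewrite (ipBl ipP) gerBl TGq (form1_ge0 ipP cE).
have T1 u : L2ip (T u) u <= `|u| ^+ 2.
  have : `|T u| ^+ 2 <= L2ip (T u) u by rewrite Tq (norm_le_form1 ipP cE).
  have := cauchy_schwarz ipP (T u) u; have := ler_norm (L2ip (T u) u).
  by have := sqr_ge0 (`|u| - `|T u|); rewrite sqrrB; lra.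
have K0 u : 0 <= L2ip (K u) u by rewrite difference_quadratic (form1_ge0 ipP cE).
have K1 u : L2ip (K u) u <= `|u| ^+ 2 := le_trans (KT u) (T1 u).
have KK := norm_sqr_le_quadratic ipP lK difference_sym K0 K1.
have Kn u : `|K u| <= 1 * `|u|.
  apply: (norm_le_quadratic ipP lK ler01 difference_sym) => v.
  by rewrite ger0_norm// mul1r.
have [e e0 he] := finite_cap_potential capB.
have Tge1 h : (\forall x \ae m, 0 <= (h x : R) <= 1) -> \forall x \ae m, 0 <= (T h x : R) <= 1.
  move=> h01; have h0 : \forall x \ae m, 0 <= (h x : R) by apply: filterS h01 => x /andP[].
  have h1 : \forall x \ae m, (h x : R) <= 1 by apply: filterS h01 => x /andP[].
  by apply: filterS2 (resolvent_ge0 h0) (resolvent_le1 h1) => x -> ->.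
apply: (@schur_tb_operator _ _ _ K e 1) => //.
- exact: difference_sym.
- exact: difference_ge0.
- move=> h h01; have h0 : \forall x \ae m, 0 <= (h x : R) by apply: filterS h01 => x /andP[].
  near=> x; rewrite (near (L2_aeB (T h) (TG h)) x)//.
  have /andP[_] : 0 <= (T h x : R) <= 1 by exact: (near (Tge1 h h01) x).
  have : 0 <= (TG h x : R) by exact: (near (part_resolvent_ge0 h0) x).
  lra.
- move=> h h01; apply: he => //; first exact: Tge1.
  by move=> v Wv; rewrite TGE// TE.
move=> F mF Foo; pose S := @mul_indic R X m F.
have lS : linear S := mul_indic_linear mF.
have S1 u : `|S u| <= 1 * `|u| := mul_indic_norm_le u mF.
have norm2 u v : `|u| <= 1 -> `|v| <= 1 -> `|u - v| <= 2 :> R.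
  by move=> u1 v1; rewrite (le_trans (ler_normB _ _))//; lra.
have tSTS : tb_operator ((fun u => S (T u)) \o S).
  apply: (tb_operator_compr _ ler01) => //; last exact: tT.
  by move=> a u v; rewrite lT lS.
(* The bound is [|K S w|^2 <= <K S w, S w> <= <T S w, S w> = <S T S w, w>], with [|w| <= 2] for a
   difference [w] of two unit ball vectors. *)
have tKS : tb_operator (K \o S).
  apply: (@tb_operator_dom _ _ _ _ 2) tSTS => // u v u1 v1.
  have -> : (K \o S) u - (K \o S) v = K (S (u - v)) by rewrite (linB lS) (linB lK).
  have -> : ((fun u => S (T u)) \o S) u - ((fun u => S (T u)) \o S) v = S (T (S (u - v))).
    by rewrite (linB lS) (linB lT) (linB lS).
  rewrite (le_trans (KK _))// (le_trans (KT _))// -mul_indic_sym//.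
  rewrite (le_trans (ler_norm _))// (le_trans (cauchy_schwarz ipP _ _))//.
  by rewrite mulrC ler_wpM2r// norm2.
have lKS : linear (K \o S) by move=> a u v; rewrite /= lS; exact: lK.
(* Since S is a symmetric idempotent, [|S K w|^2 = <K S K w, w>], which moves the cutoff to the left
   of K. *)
have tKSK : tb_operator ((K \o S) \o K) := tb_operator_compr lKS ler01 Kn tKS.
apply: (@tb_operator_dom _ _ _ _ 2) tKSK => // u v u1 v1.
rewrite -(linB lS) -[T u - TG u - _](linB lK).
have -> : ((K \o S) \o K) u - ((K \o S) \o K) v = K (S (K (u - v))).
  by rewrite (linB lK) (linB lS) (linB lK).
rewrite -(ipE ipP) mul_indic_sym// mul_indic_idem// difference_sym.
rewrite (le_trans (ler_norm _))// (le_trans (cauchy_schwarz ipP _ _))//.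
by rewrite ler_wpM2r// norm2.
Unshelve. all: by end_near. Qed.

End difference.
End resolvent_difference.

Lemma open_borel (X : ptopologicalType) (U : set X) : open U -> measurable (U : set (borel X)).
Proof. by move=> oU; exact: sub_sigma_algebra. Qed.

Theorem theorem2p3 (R : realType) (X : pmetricType R)
    (m : {measure set (borel X) -> \bar R}) (E : energy_form (L2 m)) (B : set X) :
  locally_compact [set: X] -> separable X ->
  radon_measure m -> msupp m = [set: X] ->
  regular_dirichlet_form E -> spatially_locally_compact E ->
  closed B -> (cap E B < +oo)%E ->
  (forall phi : R -> R, C0 phi ->
     compact_operator (fun u => phi_op_on E (~` B) phi u - phi_op E phi u)) /\
  ess_spectrum (L2on m (~` B)) (assoc_op_on E (~` B)) =
    ess_spectrum [set: L2 m] (assoc_op E).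
Proof.
move=> lcX _ _ _ dE slc cB capB.
pose ipP : inner_product (@L2ip R X m) := L2_inner_product m.
have cH : cauchy_complete (L2 m) by exact: L2_complete.
have cE := rdf_closed dE; set G := ~` B.
have mG : measurable (G : set (borel X)) by apply: open_borel; exact: closed_openC.
have /choice[T hT] h : exists z, fdom E z /\
    forall v, fdom E v -> form1 (@L2ip R X m) E z v = L2ip h v.
  have [|z Dz zE] := riesz_resolvent ipP cE (fdom0 cE) (fdom_lin cE) (@subset_refl _ _) _ h.
    by move=> z Dz _.
  by exists z.
have /choice[TG hTG] h : exists z, fdom (form_on E G) z /\
    forall v, fdom (form_on E G) v -> form1 (@L2ip R X m) E z v = L2ip h v.
  have [z Wz zE] := riesz_resolvent ipP cE (form_on0 dE G) (@form_on_lin _ _ _ _ dE G)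
    (@form_on_dom _ _ _ E G) (@form_on_closed _ _ _ _ dE G) h.
  by exists z.
have AT : resolvent_at_m1 (@L2ip R X m) setT (assoc_op E) T.
  rewrite /assoc_op (_ : E = EnergyForm (fdom E) (fval E)); last by case: (E).
  apply: (form_resolvent ipP cE) => //.
  - exact: fdom_lin.
  - by move=> h; exact: (hT h).1.
  - by move=> h; exact: (hT h).2.
  - by move=> x; exists x => // v _; rewrite subrr (ip0l ipP).
have ATG : resolvent_at_m1 (@L2ip R X m) (L2on m G) (assoc_op_on E G) TG.
  apply: (form_resolvent ipP cE (W := fdom (form_on E G))).
  - exact: (form_on_lin dE).
  - exact: form_on_dom.
  - exact: (form_on_L2on dE).
  - by move=> h; exact: (hTG h).1.
  - by move=> h; exact: (hTG h).2.
  - exact: L2on_lin.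
  - exact: L2on_closed.
  - exact: L2on_dec.
have calc := fun_calcP ipP cH AT; have calcG := fun_calcP ipP cH ATG.
have tT (F : set (borel X)) : measurable F -> (m F < +oo)%E ->
    tb_operator (fun u => mul_indic F (T u)).
  move=> mF Foo; apply: (tb_heat_res ipP AT calc (mul_indic_linear mF) ler01) => //.
    by move=> u; exact: mul_indic_norm_le.
  exact: compact_tb_operator (slc F mF Foo).
have tD : tb_operator (fun u => TG u - T u).
  have := @difference_tb_operator _ _ _ _ _ lcX dE cB T TG (fun h => (hT h).1)
    (fun h => (hT h).2) (fun h => (hTG h).1) (fun h => (hTG h).2) (res_lin AT) (res_lin ATG)
    capB tT.
  by move=> /(tb_operatorZ (- 1)); congr tb_operator; apply/funext => u; rewrite scaleN1r opprB.
split=> [phi phi0|]; last exact: (ess_spectrum_invariant ipP AT ATG calc calcG tD).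
apply: tb_compact_operator => //; last exact: (compact_diff_C0 ipP AT ATG calc calcG tD phi0).2.
move=> a u v; rewrite /phi_op_on /phi_op (calc_linear calcG phi0) (calc_linear calc phi0).
by rewrite scalerBr opprD addrACA.
Qed.
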